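(* For any $\mathcal O$-irreducible $\Phi\in\operatorname{Aut}(G,\mathcal O)$, the infimum $\lambda_\Phi=\inf_{X\in\mathcal O}\Lambda_R(X,\Phi(X))$ is a minimum, attained at some $X\in\mathcal O$.
   Context: Setting. $G=G_1*\dots*G_p*F_k$, where $(G_i)_{i=1}^p$ is a finite family of groups and $F_k$ is the free group of rank $0\le k<\infty$. A simplicial metric tree is a simplicial tree (not necessarily locally compact) with a complete path metric such that edges are isometric to closed intervals of $\mathbb R$; all branch points are vertices. A $G$-tree is a simplicial metric tree on which $G$ acts simplicially by isometries. A vertex $v$ is redundant if it has degree two and every $g\in G$ fixing $v$ also fixes the edges adjacent to $v$. $\mathcal O=\mathcal O(G,(G_i)_{i=1}^p,F_k)$ is the set of $G$-trees $T$, up to $G$-equivariant isometry, such that: (C0) $T$ has no redundant vertices; (C1) the action is minimal (no proper invariant subtree), with trivial edge stabilizers; (C2) for each $i=1,\dots,p$ there is exactly one orbit of vertices with stabilizer conjugate to $G_i$; (C3) all other vertices have trivial stabilizer. A vertex is free if its stabilizer is trivial, non-free otherwise. $l_T(g)=\inf_{x\in T}d_T(x,gx)$; $g$ is hyperbolic if it fixes no point of $T$ (independent of $T\in\mathcal O$), and $\operatorname{Hyp}(\mathcal O)$ is the set of hyperbolic elements. For $A,B\in\mathcal O$, $\Lambda_R(A,B)=\sup_{g\in\operatorname{Hyp}(\mathcal O)}\frac{l_B(g)}{l_A(g)}$. $\operatorname{Aut}(G,\mathcal O)$ is the group of automorphisms of $G$ that preserve the set of conjugacy classes of the $G_i$'s.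 For $\Phi\in\operatorname{Aut}(G,\mathcal O)$ and $T\in\mathcal O$, $\Phi(T)$ is the same metric tree with action $(g,x)\mapsto\Phi(g)x$. A Lipschitz surjective map $f:T\to T$ represents $\Phi$ if $f(gt)=\Phi(g)f(t)$ for all $g\in G$, $t\in T$. $\Phi$ is $\mathcal O$-irreducible if for any $T\in\mathcal O$ and any $f:T\to T$ representing $\Phi$, if $W\subset T$ is a proper $f$-invariant $G$-subgraph (i.e. $G$-invariant subgraph), then $G\backslash W$ is a union of trees each of which contains at most one non-free vertex. *)

(* Defs.v *)
From HB Require Import structures.
From mathcomp Require Import all_boot all_order all_algebra.
From mathcomp Require Import all_classical all_reals all_analysis.

Set Implicit Arguments.
Unset Strict Implicit.
Unset Printing Implicit Defensive.

Import Order.TTheory GRing.Theory Num.Theory.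

Local Open Scope classical_set_scope.
Local Open Scope ring_scope.

Notation group_hom := monoid.UMagmaMorphism.type (only parsing).

(** * Graphs *)

(* Graphs in the sense of Serre: edges come with an orientation and [bar]
   reverses them, so loops and multiple edges are allowed.  Vertices and edges
   are subsets of ambient types; only the restrictions of [org], [ter] and
   [bar] to [medges] are meaningful. *)
Record multigraph := Multigraph {
  mvertex : Type;
  medge : Type;
  mverts : set mvertex;
  medges : set medge;
  org : medge -> mvertex;
  ter : medge -> mvertex;
  bar : medge -> medge
}.

Inductive joined (Q : multigraph) : mvertex Q -> mvertex Q -> Prop :=
| joined_refl x : joined x x
| joined_step e y : medges e -> joined (ter e) y -> joined (org e) y.

(* A circuit of length [n > 0] is a cyclic sequence of oriented edges through
   pairwise distinct vertices, without backtracking; [ordS] is the cyclic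
   successor on ['I_n]. *)
Definition circuit (Q : multigraph) (n : nat) (c : 'I_n -> medge Q) : Prop :=
  [/\ (0 < n)%N,
      forall i, medges (c i),
      forall i, ter (c i) = org (c (ordS i)),
      injective (fun i => org (c i))
    & forall i, c (ordS i) <> bar (c i)].

Definition is_forest (Q : multigraph) : Prop :=
  forall n (c : 'I_n -> medge Q), ~ circuit c.

Definition is_tree (Q : multigraph) : Prop :=
  [/\ mverts (m := Q) !=set0,
      forall x y : mvertex Q, mverts x -> mverts y -> joined x y
    & is_forest Q].

(** * Simplicial metric trees *)

Section Complexes.
Context {R : realType} {T : metricType R} (V : set T) (E : set (set T)).

(* [e] is isometric to [[0, l]] for some [l > 0], and its two endpoints are the
   only points of [e] that are vertices. *)
Definition metric_edge (e : set T) : Prop :=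
  exists (l : R) (c : R -> T),
    [/\ 0 < l,
        e = c @` `[0, l]%classic,
        forall s t, s \in `[0, l] -> t \in `[0, l] -> mdist (c s) (c t) = `|s - t|
      & forall t, t \in `[0, l] -> (V (c t) <-> t = 0 \/ t = l)].

(* The edges of a simplicial complex have distinct endpoints and are determined
   by them, so an oriented edge is the ordered pair of its endpoints. *)
Definition oriented_edges (W : set T) : set (T * T) :=
  [set uv | [/\ V uv.1, V uv.2, uv.1 <> uv.2
              & exists2 e, E e & [/\ e uv.1, e uv.2 & e `<=` W]]].

Definition swap (uv : T * T) : T * T := (uv.2, uv.1).

Definition subgraph_graph (W : set T) : multigraph :=
  @Multigraph T (T * T)%type (V `&` W) (oriented_edges W) fst snd swap.

Definition chain (x : T) (p : seq T) : bool :=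
  path (fun a b => `[< exists2 e, E e & e a /\ e b >]) x p.

Definition chain_length (x : T) (p : seq T) : R :=
  \sum_(d <- pairmap (@mdist R T) x p) d.

(* The metric is the path metric of the complex: the distance is the infimum of
   the lengths of the piecewise linear paths. *)
Definition path_metric : Prop := forall x y : T,
  (mdist x y)%:E =
  ereal_inf [set (chain_length x p)%:E | p in [set p | chain x p /\ last x p = y]].

Definition metric_complete : Prop :=
  forall F : set_system T, ProperFilter F -> cauchy F -> exists x : T, F --> x.

End Complexes.

(* Branch points are vertices, because edges only meet at vertices. *)
Record simplicial_metric_tree (R : realType) := SimplicialMetricTree {
  points :> metricType R;
  vertices : set points;
  edges : set (set points);
  edgesP : forall e, edges e -> metric_edge vertices e;
  points_cover : forall x, vertices x \/ exists2 e, edges e & e x;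
  edges_meet : forall e e', edges e -> edges e' -> e <> e' ->
    forall x, e x -> e' x ->
      vertices x /\ (forall y, e y -> e' y -> y = x);
  tree_graph : is_tree (subgraph_graph vertices edges [set: points]);
  tree_path_metric : path_metric edges;
  tree_complete : metric_complete (T := points)
}.

(* The points of [W] form a subcomplex. *)
Definition is_subgraph (R : realType) (T : simplicial_metric_tree R) (W : set T)
    : Prop :=
  forall x, W x -> vertices x \/ exists2 e, edges e & e x /\ e `<=` W.

Definition is_subtree (R : realType) (T : simplicial_metric_tree R) (W : set T)
    : Prop :=
  is_subgraph W /\ is_tree (subgraph_graph (@vertices R T) (@edges R T) W).

(** * G-trees *)

Record gtree (R : realType) (G : groupType) := GTree {
  gtree_tree :> simplicial_metric_tree R;
  act : G -> gtree_tree -> gtree_tree;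
  act1 : forall x, act 1%g x = x;
  actM : forall g h x, act (g * h)%g x = act g (act h x);
  act_isometry : forall g x y, mdist (act g x) (act g y) = mdist x y;
  act_vertices : forall g v, vertices v -> vertices (act g v);
  act_edges : forall g e, edges e -> edges (act g @` e)
}.

Section GTrees.
Context {R : realType} {G : groupType}.
Implicit Type T : gtree R G.

Definition stabilizer T (x : T) : set G := [set g | act g x = x].

Definition edge_stabilizer T (e : set T) : set G := [set g | act g @` e = e].

Definition gorbit T (x : T) : set T := [set act g x | g in [set: G]].

Definition gorbit2 T (uv : T * T) : set (T * T) :=
  [set (act g uv.1, act g uv.2) | g in [set: G]].

Definition ginvariant T (W : set T) : Prop :=
  forall g x, W x -> W (act g x).

Definition minimal_action T : Prop :=
  forall W : set T, is_subtree W -> ginvariant W -> W = [set: T].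

Definition degree_two T (v : T) : Prop :=
  exists e1 e2 : set T, e1 <> e2 /\
    [set e | edges e /\ e v] = [set e | e = e1 \/ e = e2].

Definition redundant T (v : T) : Prop :=
  [/\ vertices v, degree_two v
    & forall g, stabilizer v g ->
        forall e, edges e -> e v -> edge_stabilizer e g].

Definition free_vertex T (v : T) : Prop :=
  vertices v /\ stabilizer v = [set 1%g].

Definition nonfree_vertex T (v : T) : Prop :=
  vertices v /\ stabilizer v <> [set 1%g].

(* The vertices of the quotient graph are the orbits of vertices of [W], its
   oriented edges are the orbits of oriented edges of [W]. *)
Definition quotient_graph T (W : set T) : multigraph :=
  @Multigraph (set T) (set (T * T))
    [set gorbit v | v in @vertices R T `&` W]
    [set gorbit2 uv | uv in oriented_edges (@vertices R T) (@edges R T) W]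
    (fun b => fst @` b) (fun b => snd @` b) (fun b => @swap R T @` b).

Definition quotient_union_of_trees T (W : set T) : Prop :=
  is_forest (quotient_graph W) /\
  forall v w : T, W v -> W w -> nonfree_vertex v -> nonfree_vertex w ->
    @joined (quotient_graph W) (gorbit v) (gorbit w) -> gorbit v = gorbit w.

Definition translation_length T (g : G) : R :=
  inf [set mdist x (act g x) | x in [set: T]].

Definition hyperbolic T (g : G) : Prop := forall x : T, act g x <> x.

(* [Phi(T)] *)
Section Twist.
Context (Phi : group_hom G G) (T : gtree R G).
Let tact (g : G) (x : T) : T := act (Phi g) x.

Lemma tact1 x : tact 1%g x = x.
Proof. by rewrite /tact gmulf1 act1. Qed.

Lemma tactM g h x : tact (g * h)%g x = tact g (tact h x).
Proof. by rewrite /tact gmulfM actM. Qed.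

Definition twist : gtree R G :=
  @GTree R G T tact tact1 tactM
    (fun g => act_isometry (Phi g))
    (fun g => @act_vertices R G T (Phi g))
    (fun g => @act_edges R G T (Phi g)).

End Twist.

End GTrees.

(** * Free products and the outer space *)

(* The homomorphisms [iota i : Gi i -> G] and the elements [b j] exhibit [G] as
   the free product of the groups [Gi i] and of a free group with basis [b]. *)
Definition is_free_product (p k : nat) (Gi : 'I_p -> groupType) (G : groupType)
    (iota : forall i, group_hom (Gi i) G) (b : 'I_k -> G) : Prop :=
  forall (H : groupType) (phi : forall i, group_hom (Gi i) H)
         (y : 'I_k -> H),
    exists psi : group_hom G H,
      ((forall i a, psi (iota i a) = phi i a) /\ (forall j, psi (b j) = y j)) /\
      forall psi' : group_hom G H,
        (forall i a, psi' (iota i a) = phi i a) ->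
        (forall j, psi' (b j) = y j) -> psi' =1 psi.

Section OuterSpace.
Context {R : realType} {p : nat} {Gi : 'I_p -> groupType} {G : groupType}.
Context (iota : forall i, group_hom (Gi i) G).

Definition conjugate_set (A : set G) (g : G) : set G :=
  [set (a ^ g)%g | a in A].

Definition conjugacy_class (A : set G) : set (set G) :=
  [set conjugate_set A g | g in [set: G]].

Definition factor_classes : set (set (set G)) :=
  [set conjugacy_class (range (iota i)) | i in [set: 'I_p]].

(* Each point of the outer space is represented by a tree; all the notions
   below are invariant under equivariant isometry. *)
Definition outer_space (T : gtree R G) : Prop :=
  [/\ forall v : T, ~ redundant v,
      minimal_action T /\
        (forall e : set T, edges e -> edge_stabilizer e = [set 1%g]),
      forall i, exists v : T,
                 [/\ vertices v,
                     conjugacy_class (range (iota i)) (stabilizer v)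
                   & forall w : T, vertices w ->
                       conjugacy_class (range (iota i)) (stabilizer w) ->
                       gorbit v w]
    & forall v : T, vertices v ->
                 (forall i, ~ conjugacy_class (range (iota i)) (stabilizer v)) ->
                 free_vertex v].

(* Hyperbolicity does not depend on the tree chosen in the outer space. *)
Definition Hyp : set G :=
  [set g | forall T : gtree R G, outer_space T -> hyperbolic T g].

Definition Lambda_R (A B : gtree R G) : \bar R :=
  ereal_sup [set (translation_length B g / translation_length A g)%:E | g in Hyp].

Definition Aut_O (Phi : group_hom G G) : Prop :=
  bijective Phi /\
  [set [set Phi @` A | A in C] | C in factor_classes] = factor_classes.

Definition lipschitz_map (S T : metricType R) (f : S -> T) : Prop :=
  exists K : R, forall x y, mdist (f x) (f y) <= K * mdist x y.

Definition represents (Phi : group_hom G G) (T : gtree R G)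
    (f : T -> T) : Prop :=
  [/\ lipschitz_map f,
      forall y, exists x, f x = y
    & forall g x, f (act g x) = act (Phi g) (f x)].

Definition irreducible (Phi : group_hom G G) : Prop :=
  forall (T : gtree R G) (f : T -> T),
    outer_space T -> represents Phi f ->
    forall W : set T,
      is_subgraph W -> ginvariant W -> f @` W `<=` W -> W <> [set: T] ->
      quotient_union_of_trees W.

Definition lambda (Phi : group_hom G G) : \bar R :=
  ereal_inf
    [set r | exists2 X : gtree R G, outer_space X & r = Lambda_R X (twist Phi X)].

End OuterSpace.

(* Main.v *)
Require Import Defs.
From HB Require Import structures.
From mathcomp Require Import all_boot all_order all_algebra.
From mathcomp Require Import all_classical all_reals all_analysis.
From mathcomp Require Import generic_quotient lra zify.

Set Implicit Arguments.
Unset Strict Implicit.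
Unset Printing Implicit Defensive.

Import Order.TTheory GRing.Theory Num.Theory.
Import numFieldNormedType.Exports.

Local Open Scope classical_set_scope.
Local Open Scope ring_scope.

(* Let [X_n] be a minimizing sequence.  The number of edge orbits of a point of
   the outer space is bounded in terms of [p] and [k], so the edge orbits of all
   the [X_n] can be labelled by one finite set; let [l] be a cluster point of the
   vectors of edge lengths, normalized to have maximum 1.  Give lengths [l] to the
   edges of the combinatorial tree [T] of some [X_n] with [n] large, so that the
   edges with [l e = 0] are collapsed, and let [Y] be the resulting tree.

   A map from the vertices of [T] to [Y] that is [Phi]-equivariant and
   [lambda]-Lipschitz is a solution of a finite system of constraints
   [d (y_s, g y_t) <= r] in a 0-hyperbolic space.  By Helly's property the
   unknowns can be eliminated one at a time, and the system is equivalent to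
   finitely many bounds on translation lengths of elements of [G].  These bounds
   compare nonnegative integral combinations of the edge lengths, with
   coefficients that are bounded independently of [n].  They hold in [X_n] up to
   an error that tends to 0, hence exactly in [Y] if [n] is large, since only
   finitely many combinations are involved.

   The map [f] so obtained identifies the ends of the edges with [l e = 0].  After
   pushing its values to vertices and extending it linearly over the tree [T]
   with unit lengths, one gets a representative of [Phi] that preserves the
   proper subgraph formed by those edges.  By irreducibility they form trees with
   at most one nonfree vertex in the quotient.  Hence [Y] is a point of the outer
   space, and [f] shows that its stretching factor is at most [lambda]. *)

(** * Group actions on geodesic 0-hyperbolic spaces *)

(** Only the length vectors of the minimizing sequence converge. The trees may carry infinitely many
    different actions of [G], so no limit of actions is taken, and the limiting lengths are put on
    one tree of the sequence. Hence the bounds must not depend on that tree: at most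
    [M = 3 (p + k + 1) + 1] unknowns are eliminated, and each elimination at most triples the
    integer weights, whence [3 ^ M]. The coefficients in the translation lengths of the elements
    [Phi h] have no a priori bound; the inequality in [X_n] itself bounds them at the edges that
    survive, and the other edges contribute nothing in the limit. Irreducibility has to be applied
    before collapsing, since the collapsed tree is not yet known to be in the outer space; hence the
    detour through unit lengths. The infinite cyclic group is set apart because its line has only
    redundant vertices. For the other groups a point comes from the Bass-Serre tree; it settles the
    cases without hyperbolic elements or with infinite infimum. *)

Record hspace (R : realType) (G : groupType) := HSpace {
  hpt :> Type;
  hpt0 : hpt;
  hd : hpt -> hpt -> R;
  hact : G -> hpt -> hpt;
  hdxx : forall x, hd x x = 0;
  hdC : forall x y, hd x y = hd y x;
  hd4 : forall x y z w, hd x y + hd z w <= hd x z + hd y w \/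
                        hd x y + hd z w <= hd x w + hd y z;
  hgeo : forall x y s, 0 <= s -> s <= hd x y ->
    exists z, hd x z = s /\ hd z y = hd x y - s;
  hact1 : forall x, hact 1%g x = x;
  hactM : forall g h x, hact (g * h)%g x = hact g (hact h x);
  hactd : forall g x y, hd (hact g x) (hact g y) = hd x y
}.

Ltac hsym_eq x y :=
  lazymatch goal with
  | _ : hd x y = hd y x |- _ => fail
  | _ : hd y x = hd x y |- _ => fail
  | _ => pose proof (hdC x y)
  end.

Ltac hlra :=
  rewrite ?hactd;
  repeat match goal with
  | |- context [hd ?x ?y] => hsym_eq x y
  | H : context [hd ?x ?y] |- _ => hsym_eq x y
  end; lra.

Section HSpace.
Context {R : realType} {G : groupType} (Y : hspace R G).
Local Notation d := (@hd R G Y).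
Local Notation "g ** x" := (@hact R G Y g x) (at level 40).
Implicit Types (x y z : Y) (g : G) (r s t : R).

Lemma hd_tri y x z : d x z <= d x y + d y z.
Proof. by have := hd4 x z y y; rewrite hdxx (hdC z y) addr0; case. Qed.

Lemma hd_ge0 x y : 0 <= d x y.
Proof. by have := hd_tri y x x; rewrite hdxx (hdC y x); lra. Qed.

Lemma hactK g x : g ** (g^-1 ** x) = x.
Proof. by rewrite -hactM mulgV hact1. Qed.

Lemma hactVK g x : g^-1 ** (g ** x) = x.
Proof. by rewrite -hactM mulVg hact1. Qed.

Lemma hactVd g x y : d (g^-1 ** x) y = d x (g ** y).
Proof. by rewrite -(hactd g) hactK. Qed.

Definition hconvex (C : Y -> Prop) : Prop :=
  forall u v m, C u -> C v -> d u m + d m v = d u v -> C m.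

Lemma hmedian x y z : exists m,
  [/\ d x m + d m y = d x y, d x m + d m z = d x z & d y m + d m z = d y z].
Proof.
have t1 := hd_tri x y z; have t2 := hd_tri y x z; have t3 := hd_tri z x y.
(* The distance from [x] to the median is the Gromov product of [y] and [z] at [x]. *)
have [||m [xm my]] := @hgeo _ _ Y x y ((d x y + d x z - d y z) / 2); [hlra|hlra|].
have t4 := hd_tri m x z; have t5 := hd_tri m y z.
by exists m; split; case: (hd4 m z x y); hlra.
Qed.

(** The median of three points, one in each pairwise intersection, lies on a segment of each of the
    three sets. *)
Lemma helly3 (A B C : Y -> Prop) : hconvex A -> hconvex B -> hconvex C ->
  (exists z, A z /\ B z) -> (exists z, A z /\ C z) -> (exists z, B z /\ C z) ->
  exists z, [/\ A z, B z & C z].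
Proof.
move=> cA cB cC [x [Ax Bx]] [y [Ay Cy]] [z [Bz Cz]].
have [m [e1 e2 e3]] := hmedian x y z.
by exists m; split; [apply: (cA x y)|apply: (cB x z)|apply: (cC y z)].
Qed.

Lemma hconvexI (A B : Y -> Prop) : hconvex A -> hconvex B ->
  hconvex (fun z => A z /\ B z).
Proof.
by move=> cA cB u v m [Au Bu] [Av Bv] e; split; [apply: (cA u v)|apply: (cB u v)].
Qed.

(** All sets are intersected with the first one. By [helly3] the intersections still meet pairwise,
    and the induction has one set less. *)
Lemma helly (J : eqType) (js : seq J) (F : J -> Y -> Prop) :
  (forall j, hconvex (F j)) ->
  (forall j k, j \in js -> k \in js -> exists z, F j z /\ F k z) ->
  exists z, forall j, j \in js -> F j z.
Proof.
elim: js F => [|j js IH] F cF pF; first by exists (hpt0 Y).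
have [js0|[j' j'js]] : js = [::] \/ exists j', j' \in js.
- by case: (js) => [|a l]; [left|right; exists a; rewrite mem_head].
- have [z [Fz _]] := pF j j (mem_head _ _) (mem_head _ _).
  by exists z => k; rewrite js0 inE => /eqP ->.
- have [||z Fz] := IH (fun k z => F j z /\ F k z).
  + by move=> k; apply: hconvexI.
  + move=> k l kjs ljs.
    have [||||||z [Fj Fk Fl]] := @helly3 (F j) (F k) (F l) => //.
    * by apply: pF; rewrite inE ?eqxx ?kjs ?orbT.
    * by apply: pF; rewrite inE ?eqxx ?ljs ?orbT.
    * by apply: pF; rewrite inE ?kjs ?ljs ?orbT.
    * by exists z.
  + exists z => k; rewrite inE => /orP[/eqP ->|/Fz[] //].
    by have [] := Fz _ j'js.
Qed.

Lemma hconvex_ball x r : hconvex (fun z => d z x <= r).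
Proof.
move=> u v m du dv e.
have gu := hd_ge0 u m; have gv := hd_ge0 m v.
by case: (hd4 m x u v); hlra.
Qed.

(** Displacement is a convex function on a tree: the four-point condition bounds the distances from
    [u] and [v] to [g m], and then the one from [m]. *)
Lemma hconvex_displacement g r : hconvex (fun z => d z (g ** z) <= r).
Proof.
move=> u v m du dv e.
have gu := hd_ge0 u m; have gv := hd_ge0 m v.
have dvm : d v (g ** m) <= d m v + r.
  have t := hd_tri u v (g ** u).
  by case: (hd4 (g ** m) v (g ** u) (g ** v)); hlra.
have dum : d u (g ** m) <= d u m + r.
  have t := hd_tri v u (g ** v).
  by case: (hd4 (g ** m) u (g ** u) (g ** v)); hlra.
by case: (hd4 m (g ** m) u v); hlra.
Qed.

Definition moves g s : Prop := exists z, d z (g ** z) <= s.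

Lemma moves_ge0 g s : moves g s -> 0 <= s.
Proof. by move=> [z]; apply: le_trans; apply: hd_ge0. Qed.

Lemma movesV g s : moves g s -> moves g^-1 s.
Proof. by move=> [w dw]; exists w; rewrite hdC hactVd. Qed.

(** A displacement of [x] above [s] comes from the way to and from [z]; the segments from [x] to
    [g x] and on to [g g x] therefore overlap along at least half of the excess. *)
Lemma moves_sq g s x : moves g s -> d x (g ** (g ** x)) <= d x (g ** x) + s.
Proof.
move=> [z zs].
have t3 := hd_tri (g ** z) z (g ** x); have t4 := hd_tri z x (g ** z).
rewrite ?hactd in t3 t4.
by have := hd4 x (g ** (g ** x)) (g ** x) (g ** z); rewrite ?hactd; case; hlra.
Qed.

(** The overlap in [moves_sq] makes the displacement drop at speed 2 when [p] moves in from either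
    end of the segment, until it is at most [s]. *)
Lemma moves_segment g s x p : moves g s ->
  d x p + d p (g ** x) = d x (g ** x) ->
  [\/ d p (g ** p) <= s, d p (g ** p) <= d x (g ** x) - 2 * d x p
    | d p (g ** p) <= 2 * d x p - d x (g ** x)].
Proof.
move=> mg e; have s0 := moves_ge0 mg; have sq := moves_sq x mg.
have gp := hd_ge0 x p; have gq := hd_ge0 p (g ** x).
have h : d x (g ** p) <= d x p + s \/ d x (g ** p) <= d p (g ** x).
  by case: (hd4 (g ** p) x (g ** x) (g ** (g ** x)));
    rewrite ?hactd; [left|right]; hlra.
have := hd4 p (g ** p) (g ** x) x; rewrite ?hactd; case=> h4.
  by case: h => h; [constructor 1|constructor 2]; hlra.
by constructor 3; hlra.
Qed.

Lemma ball_meets_ball x y r s : 0 <= r -> 0 <= s -> d x y <= r + s ->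
  exists z, d z x <= r /\ d z y <= s.
Proof.
move=> r0 s0 h; have [le|/ltW lt] := leP (d x y) r.
  by exists y; rewrite hdxx hdC.
have [z [e1 e2]] := @hgeo _ _ Y x y r r0 lt.
by exists z; rewrite hdC e1 e2; split; lra.
Qed.

Lemma ball_meets_displacement g s x r : 0 <= r -> moves g s ->
  d x (g ** x) <= s + 2 * r -> exists z, d z x <= r /\ d z (g ** z) <= s.
Proof.
move=> r0 mg h; have s0 := moves_ge0 mg; have [le|lt] := leP (d x (g ** x)) s.
  by exists x; rewrite hdxx.
(* Going half of the excess displacement toward [g x] uses it up, by [moves_segment]. *)
have [||z [e1 e2]] := @hgeo _ _ Y x (g ** x) ((d x (g ** x) - s) / 2); [lra|lra|].
have e : d x z + d z (g ** x) = d x (g ** x) by lra.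
exists z; rewrite hdC e1; split; first lra.
by case: (moves_segment mg e); lra.
Qed.

(** The point is taken far enough along the segment from [y] to [g y] to settle [g], whose excess is
    the larger one. The bound on the distance of [h y] and [g y] puts it either within [t - d y z]
    of [h y], or on the segment from [y] to [h y], where [moves_segment] applies to [h]. *)
Lemma displacements_meet_aux g h s t y : moves g s -> moves h t ->
  d (h ** y) (g ** y) <= s + t -> s < d y (g ** y) ->
  d y (h ** y) - t <= d y (g ** y) - s ->
  exists z, d z (g ** z) <= s /\ d z (h ** z) <= t.
Proof.
move=> mg mh dI lt le; have s0 := moves_ge0 mg; have t0 := moves_ge0 mh.
have [||z [e1 e2]] := @hgeo _ _ Y y (g ** y) ((d y (g ** y) - s) / 2); [lra|lra|].
have e : d y z + d z (g ** y) = d y (g ** y) by lra.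
exists z; split; first by case: (moves_segment mg e); lra.
have tI := hd_tri (h ** y) y (g ** y).
have [A|B] : d z (h ** y) <= t - d y z \/ d z (h ** y) <= d y (h ** y) - d y z.
  by case: (hd4 z (h ** y) y (g ** y)); [left|right]; hlra.
- by have := hd_tri (h ** y) z (h ** z); hlra.
- have tz := hd_tri z y (h ** y).
  have eB : d y z + d z (h ** y) = d y (h ** y) by lra.
  by case: (moves_segment mh eB); lra.
Qed.

(** For [s = t = 0] this is Serre's lemma: if [g], [h] and [g h] have fixed points, then [g] and [h]
    have a common one. The auxiliary lemma is applied at [y = h w] to [g] and the inverse of [h],
    which has the same displacements as [h]. *)
Lemma displacements_meet g h s t : moves g s -> moves h t ->
  moves (g * h)%g (s + t) -> exists z, d z (g ** z) <= s /\ d z (h ** z) <= t.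
Proof.
move=> mg mh [w]; rewrite hactM; set y := h ** w => dw.
have dh z : d z (h^-1 ** z) = d z (h ** z) by rewrite hdC hactVd.
rewrite -(hactVK h w) -/y in dw.
have [lg|lg] := leP (d y (g ** y)) s; have [lh|lh] := leP (d y (h ** y)) t.
- by exists y.
all: have mh' := movesV mh; have dw' := dw; rewrite hdC addrC in dw'.
all: have [le|/ltW le] := leP (d y (h ** y) - t) (d y (g ** y) - s).
all: try lra.
all: suff [z [z1 z2]] : exists z, d z (g ** z) <= s /\ d z (h^-1 ** z) <= t
  by exists z; rewrite -dh.
all: try by apply: (displacements_meet_aux mg mh' dw); rewrite ?dh; lra.
all: suff [z [z1 z2]] : exists z, d z (h^-1 ** z) <= t /\ d z (g ** z) <= s
  by exists z.
all: by apply: (displacements_meet_aux mh' mg dw'); rewrite ?dh; lra.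
Qed.

End HSpace.

(** * Eliminating unknown points from distance constraints *)

Section Elimination.
Context {R : realType} {G : groupType} {I : eqType} {M : nat}.
Implicit Types (Y : hspace R G) (c : {ffun 'I_M -> nat}) (r : 'I_M -> R).

Definition dot c r : R := \sum_e (c e)%:R * r e.
Definition wsize c : nat := (\sum_e c e)%N.
Definition wadd c c' : {ffun 'I_M -> nat} := [ffun e => c e + c' e]%N.

Lemma dotD c c' r : dot (wadd c c') r = dot c r + dot c' r.
Proof.
by rewrite /dot -big_split; apply: eq_bigr => e _; rewrite ffunE natrD mulrDl.
Qed.

Lemma wsizeD c c' : wsize (wadd c c') = (wsize c + wsize c')%N.
Proof. by rewrite /wsize -big_split; apply: eq_bigr => e _; rewrite ffunE. Qed.

Lemma dot_ge0 c r : (forall e, 0 <= r e) -> 0 <= dot c r.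
Proof. by move=> r0; apply: sumr_ge0 => e _; apply: mulr_ge0. Qed.

(* [(s, g, t, c)] is the constraint [d (y s) (g y t) <= c . r] on an unknown
   family of points [y], the weights [r >= 0] being parameters. *)
Definition cstr : Type := I * G * I * {ffun 'I_M -> nat}.
Definition csize (x : cstr) : nat := wsize x.2.

Definition csat Y (y : I -> Y) r (x : cstr) : Prop :=
  let: (s, g, t, c) := x in hd (y s) (hact g (y t)) <= dot c r.

Definition hcstr : Type := G * {ffun 'I_M -> nat}.

Definition hsat Y r (x : hcstr) : Prop := moves Y x.1 (dot x.2 r).

(** A constraint with the unknown [i] on the right only is inverted, so that in both cases it
    confines this unknown to a ball around a translate of another one. *)
Definition ball_at (i : I) (x : cstr) : option (G * I * {ffun 'I_M -> nat}) :=
  let: (s, g, t, c) := x in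
  if s == i then if t == i then None else Some (g, t, c)
  else if t == i then Some (g^-1%g, s, c) else None.

Definition loop_at (i : I) (x : cstr) : option hcstr :=
  let: (s, g, t, c) := x in
  if (s == i) && (t == i) then Some (g, c) else None.

Definition avoids (i : I) (x : cstr) : bool :=
  let: (s, g, t, c) := x in (s != i) && (t != i).

Definition vars_in (vs : seq I) (x : cstr) : bool :=
  let: (s, g, t, c) := x in (s \in vs) && (t \in vs).

(** Besides the constraints that avoid [i], these say that any two balls meet and that each ball
    meets each displacement set: a point that is moved by at most [a] and lies within [b] of [w]
    forces [w] to be moved by at most [a + 2 b]. *)
Definition elim_cstr (i : I) (L : seq cstr) : seq cstr :=
  let B := pmap (ball_at i) L in let A := pmap (loop_at i) L in
  [seq x <- L | avoids i x] ++
  [seq (x.1.2, (x.1.1^-1 * x'.1.1)%g, x'.1.2, wadd x.2 x'.2) | x <- B, x' <- B] ++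
  [seq (x.1.2, (x.1.1^-1 * a.1 * x.1.1)%g, x.1.2, wadd a.2 (wadd x.2 x.2))
     | a <- A, x <- B].

(** The displacement sets have to be nonempty and to meet pairwise. By [displacements_meet] this is
    a condition on single group elements, in which no unknown occurs any more. *)
Definition elim_hcstr (i : I) (L : seq cstr) : seq hcstr :=
  let A := pmap (loop_at i) L in
  A ++ [seq ((a.1 * a'.1)%g, wadd a.2 a'.2) | a <- A, a' <- A].

Definition upd Y (y : I -> Y) i z : I -> Y := fun j => if j == i then z else y j.

Lemma csat_ball Y (y : I -> Y) r i z x b : ball_at i x = Some b ->
  csat (upd y i z) r x <-> hd z (hact b.1.1 (y b.1.2)) <= dot b.2 r.
Proof.
case: x => [[[s g] t] c] /=; rewrite /upd.
case: eqP => // _; case: eqP => // _ [<-] //=.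
by rewrite [X in _ <-> X <= _]hdC hactVd.
Qed.

Lemma csat_loop Y (y : I -> Y) r i z x a : loop_at i x = Some a ->
  csat (upd y i z) r x <-> hd z (hact a.1 z) <= dot a.2 r.
Proof.
case: x => [[[s g] t] c] /=; rewrite /upd.
by case: eqP => // _; case: eqP => // _ [<-].
Qed.

Lemma csat_avoids Y (y : I -> Y) r i z x : avoids i x ->
  csat (upd y i z) r x <-> csat y r x.
Proof.
by case: x => [[[s g] t] c] /=; rewrite /upd => /andP[/negPf -> /negPf ->].
Qed.

Lemma cstr_cases i x :
  [\/ avoids i x, exists b, ball_at i x = Some b | exists a, loop_at i x = Some a].
Proof.
case: x => [[[s g] t] c] /=; case: (s == i); case: (t == i).
- by constructor 3; eexists.
- by constructor 2; eexists.
- by constructor 2; eexists.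
- by constructor 1.
Qed.

Lemma csat_upd_id Y (y : I -> Y) r i x : csat (upd y i (y i)) r x = csat y r x.
Proof.
have -> // : upd y i (y i) = y by apply/funext => j; rewrite /upd; case: eqP => [->|].
Qed.

Lemma elim_sound Y r i (L : seq cstr) (y : I -> Y) :
  {in L, forall x, csat y r x} ->
  {in elim_cstr i L, forall x, csat y r x} /\
  {in elim_hcstr i L, forall h, hsat Y r h}.
Proof.
move=> sL.
have sB b : b \in pmap (ball_at i) L -> hd (y i) (hact b.1.1 (y b.1.2)) <= dot b.2 r.
  rewrite mem_pmap => /mapP[x xL e].
  by apply/(csat_ball y r (y i) (esym e)); rewrite csat_upd_id; apply: sL.
have sA a : a \in pmap (loop_at i) L -> hd (y i) (hact a.1 (y i)) <= dot a.2 r.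
  rewrite mem_pmap => /mapP[x xL e].
  by apply/(csat_loop y r (y i) (esym e)); rewrite csat_upd_id; apply: sL.
split=> x; rewrite !mem_cat.
- case/orP => [|/orP[]].
  + by rewrite mem_filter => /andP[_ /sL].
  + case/allpairsP=> [[b b'] [/sB hb /sB hb' ->]] /=.
    rewrite hactM hdC hactVd dotD hdC.
    by have := hd_tri (y i) (hact b.1.1 (y b.1.2)) (hact b'.1.1 (y b'.1.2)); move: hb hb' => /=; hlra.
  + case/allpairsP=> [[a b] [/sA ha /sB hb ->]] /=.
    rewrite !hactM hdC hactVd !dotD hdC.
    set w := hact b.1.1 _ in hb *.
    have := hd_tri (y i) w (hact a.1 w); have := hd_tri (hact a.1 (y i)) (y i) (hact a.1 w).
    by move: ha hb => /=; rewrite hactd; hlra.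
- case/orP => [/sA ha|/allpairsP[[a a'] [/sA ha /sA ha' ->]]]; first by exists (y i).
  exists (y i) => /=; rewrite hactM dotD.
  have := hd_tri (hact a.1 (y i)) (y i) (hact a.1 (hact a'.1 (y i))).
  by move: ha ha' => /=; rewrite hactd; lra.
Qed.

Lemma elim_complete Y r i (L : seq cstr) (y : I -> Y) : (forall e, 0 <= r e) ->
  {in elim_cstr i L, forall x, csat y r x} ->
  {in elim_hcstr i L, forall h, hsat Y r h} ->
  exists z, {in L, forall x, csat (upd y i z) r x}.
Proof.
move=> r0 sL sH; set B := pmap (ball_at i) L; set A := pmap (loop_at i) L.
pose F (j : (G * I * {ffun 'I_M -> nat}) + hcstr) (z : Y) : Prop := match j with
  | inl b => hd z (hact b.1.1 (y b.1.2)) <= dot b.2 r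
  | inr a => hd z (hact a.1 z) <= dot a.2 r end.
have mB b : inl b \in map inl B ++ map inr A -> b \in B.
  by rewrite mem_cat => /orP[/mapP[b' b'B [->]]|/mapP[]].
have mA a : inr a \in map inl B ++ map inr A -> a \in A.
  by rewrite mem_cat => /orP[/mapP[]|/mapP[a' a'A [->]]].
have hA a : a \in A -> moves Y a.1 (dot a.2 r).
  by move=> aA; apply: sH; rewrite mem_cat aA.
have hAB a b : a \in A -> b \in B -> exists z, F (inl b) z /\ F (inr a) z.
  move=> aA bB; apply: ball_meets_displacement; [exact: dot_ge0|exact: hA|].
  have := sL (b.1.2, (b.1.1^-1 * a.1 * b.1.1)%g, b.1.2, wadd a.2 (wadd b.2 b.2)).
  rewrite !mem_cat /= => h.
  have {h} := h; rewrite !hactM hdC hactVd hdC !dotD.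
  by move=> h; rewrite mulrDl mul1r h //; apply/orP; right; apply/orP; right;
    apply/allpairsP; exists (a, b).
have [|[b|a] [b'|a'] jB kB|z Fz] := @helly _ _ Y _ (map inl B ++ map inr A) F.
- by case=> ?; [apply: hconvex_ball|apply: hconvex_displacement].
- apply: ball_meets_ball; [exact: dot_ge0|exact: dot_ge0|].
  have := sL (b.1.2, (b.1.1^-1 * b'.1.1)%g, b'.1.2, wadd b.2 b'.2).
  rewrite !mem_cat /= hactM hdC hactVd hdC dotD; apply.
  by apply/orP; right; apply/orP; left; apply/allpairsP; exists (b, b');
    split => //; apply: mB.
- by apply: hAB; [apply: mA|apply: mB].
- by have [z [? ?]] := hAB a b' (mA _ jB) (mB _ kB); exists z.
- have [] // := @displacements_meet _ _ Y a.1 a'.1 (dot a.2 r) (dot a'.2 r).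
  + exact/hA/mA.
  + exact/hA/mA.
  + rewrite -dotD; apply: (sH ((a.1 * a'.1)%g, wadd a.2 a'.2)).
    rewrite mem_cat; apply/orP; right; apply/allpairsP; exists (a, a').
    by split => //; apply: mA.
  + by move=> z [? ?]; exists z.
- exists z => x xL; case: (cstr_cases i x) => [xi|[b eb]|[a ea]].
  + by apply/csat_avoids => //; apply: sL; rewrite mem_cat mem_filter xi xL.
  + apply/(csat_ball _ _ _ eb); apply: (Fz (inl b)); rewrite mem_cat map_f //.
    by rewrite mem_pmap -eb map_f.
  + apply/(csat_loop _ _ _ ea); apply: (Fz (inr a)); rewrite mem_cat orbC map_f //.
    by rewrite mem_pmap -ea map_f.
Qed.

Lemma ball_at_size i x b : ball_at i x = Some b -> wsize b.2 = csize x.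
Proof.
by case: x => [[[s g] t] c] /=; case: eqP => // _; case: eqP => // _ [<-].
Qed.

Lemma loop_at_size i x a : loop_at i x = Some a -> wsize a.2 = csize x.
Proof.
by case: x => [[[s g] t] c] /=; case: eqP => // _; case: eqP => // _ [<-].
Qed.

Lemma ball_at_vars i vs x b : ball_at i x = Some b -> vars_in (i :: vs) x ->
  b.1.2 \in vs.
Proof.
case: x => [[[s g] t] c] /=; rewrite !inE.
by case: eqP => // _; case: eqP => // _ [<-] //= /andP[].
Qed.

(* Elimination of the points [y s] one at a time, as in the Fourier-Motzkin
   method: each constraint on [y s] confines it to a convex set, a ball or the
   set of points moved by at most a given distance by some [g], and by Helly's
   property these sets have a common point as soon as they meet pairwise. *)
Lemma tree_elimination (vs : seq I) (L : seq cstr) (K : nat) :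
  {in L, forall x, vars_in vs x && (csize x <= K)%N} ->
  exists H : seq hcstr, {in H, forall h, (wsize h.2 <= 3 ^ size vs * K)%N} /\
    forall Y r, (forall e, 0 <= r e) ->
      {in H, forall h, hsat Y r h} <->
      exists y : I -> Y, {in L, forall x, csat y r x}.
Proof.
elim: vs L K => [|i vs IH] L K vL.
  exists [::]; split=> // Y r r0; split=> // _.
  by exists (fun=> hpt0 Y) => -[[[s g] t] c] /vL/andP[].
have sB b : b \in pmap (ball_at i) L -> (b.1.2 \in vs) && (wsize b.2 <= K)%N.
  rewrite mem_pmap => /mapP[x /vL/andP[xv xK] /esym e].
  by rewrite (ball_at_size e) xK (ball_at_vars e xv).
have sA a : a \in pmap (loop_at i) L -> (wsize a.2 <= K)%N.
  by rewrite mem_pmap => /mapP[x /vL/andP[xv xK] /esym e]; rewrite (loop_at_size e).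
(* The largest new weight has the form [a + 2 b], so sizes at most triple. *)
have [|H [sH eH]] := IH (elim_cstr i L) (3 * K)%N.
  move=> x; rewrite !mem_cat => /orP[|/orP[]].
  - rewrite mem_filter => /andP[xi /vL/andP[xv xK]]; apply/andP; split; last lia.
    case: x xi xv {xK} => [[[s g] t] c] /= /andP[/negPf si /negPf ti].
    by rewrite !inE si ti.
  - case/allpairsP=> [[b b'] [/sB/andP[hb kb] /sB/andP[hb' kb'] ->]] /=.
    by rewrite /= hb hb' /= /csize /= wsizeD /=; move: kb kb' => /=; lia.
  - case/allpairsP=> [[a b] [/sA ka /sB/andP[hb kb] ->]] /=.
    by rewrite /= hb /= /csize /= !wsizeD /=; move: ka kb => /=; lia.
have KP : (K <= 3 ^ size vs * K)%N by rewrite leq_pmull // expn_gt0.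
exists (elim_hcstr i L ++ H); split.
  move=> h; change (size (i :: vs)) with (size vs).+1.
  rewrite expnS -mulnA mem_cat => /orP[|/sH]; last by rewrite mulnCA.
  rewrite mem_cat => /orP[/sA ka|/allpairsP[[a a'] [/sA ka /sA ka' ->]]] /=.
    by apply: leq_trans (leq_trans ka KP) _; rewrite leq_pmull.
  by rewrite wsizeD; move: ka ka' => /=; lia.
move=> Y r r0; split=> [sat|[y sy]].
- have [y sy] : exists y : I -> Y, {in elim_cstr i L, forall x, csat y r x}.
    by apply/eH => // h hH; apply: sat; rewrite mem_cat hH orbT.
  have [|z sz] := elim_complete r0 sy; last by exists (upd y i z).
  by move=> h hH; apply: sat; rewrite mem_cat hH.
- have [sC sh] := elim_sound i sy.
  move=> h; rewrite mem_cat => /orP[/sh //|].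
  by apply: (iffRL (eH Y r r0)); exists y.
Qed.

End Elimination.

(** * Combinatorial trees *)

Section ReducedPaths.
Context {V : eqType} (adj : rel V).

Fixpoint nobacktrack (x : V) (p : seq V) : bool :=
  if p is y :: q then (if q is z :: _ then z != x else true) && nobacktrack y q
  else true.

Definition redp (x : V) (p : seq V) : bool := path adj x p && nobacktrack x p.

Lemma redp_cons x y q : redp x (y :: q) =
  [&& adj x y, (if q is z :: _ then z != x else true) & redp y q].
Proof. by rewrite /redp /= -!andbA; congr (_ && _); rewrite andbCA. Qed.

Lemma redp_cat x p y z q : redp x (rcons p y) -> redp y (z :: q) ->
  last x p != z -> redp x (rcons p y ++ z :: q).
Proof.
elim: p x => [|a p IH] x.
  by move=> h r n; move: h; rewrite [rcons _ _]/= [_ ++ _]/= !(redp_cons x) r eq_sym n => /and3P[->].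
move=> /= h r' n; move: h; rewrite !redp_cons => /and3P[-> h r].
by rewrite IH // andbT; case: p h {IH r n} => //=.
Qed.

Lemma redp_split x p q : redp x (p ++ q) -> redp x p && redp (last x p) q.
Proof.
elim: p x => [|a p IH] x //=; rewrite redp_cons => /and3P[xa h /IH/andP[r ->]].
by rewrite redp_cons xa r !andbT; case: p h {IH r}.
Qed.

Hypothesis adjC : symmetric adj.

Lemma redp_rev x p : redp x p -> redp (last x p) (rev (belast x p)).
Proof.
elim: p x => [|a p IH] x //; rewrite redp_cons => /and3P[xa h r].
rewrite [last _ _]/= [belast _ _]/= rev_cons.
case: p h r IH => [|b p] h r IH; first by rewrite /redp /= adjC xa.
have := IH _ r; rewrite [belast a _]/= rev_cons -(cats1 (rcons _ _)) => r'.
apply: redp_cat => //; first by rewrite /redp /= adjC xa.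
rewrite [last a _]/=; case: p {IH r r'} => [|c p] //=.
by rewrite rev_cons last_rcons.
Qed.

End ReducedPaths.

Section WeightedLength.
Context {V : eqType} {A : zmodType} (l : V -> V -> A).

(** The values lie in any abelian group: in [R] for lengths, and in [bool] for the parities used to
    count edge orbits. *)
Definition wlen (x : V) (p : seq V) : A := \sum_(d <- pairmap l x p) d.

Lemma wlen_nil x : wlen x [::] = 0.
Proof. by rewrite /wlen big_nil. Qed.

Lemma wlen_cons x y p : wlen x (y :: p) = l x y + wlen y p.
Proof. by rewrite /wlen /= big_cons. Qed.

Lemma wlen_cat x p q : wlen x (p ++ q) = wlen x p + wlen (last x p) q.
Proof. by rewrite /wlen pairmap_cat big_cat. Qed.

Lemma wlen_rcons x p y : wlen x (rcons p y) = wlen x p + l (last x p) y.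
Proof. by rewrite -cats1 wlen_cat wlen_cons wlen_nil addr0. Qed.

Lemma wlen_rev x p : (forall u v, l u v = l v u) ->
  wlen (last x p) (rev (belast x p)) = wlen x p.
Proof.
move=> lC; elim: p x => [|a p IH] x; first by rewrite !wlen_nil.
rewrite [last _ _]/= [belast _ _]/= rev_cons wlen_rcons IH wlen_cons addrC lC.
congr (l _ _ + _); case: p {IH} => [|b p] //=.
by rewrite rev_cons last_rcons.
Qed.

End WeightedLength.

Record ctree (G : groupType) := CTree {
  cv :> choiceType;
  cbase : cv;
  cadj : rel cv;
  cact : G -> cv -> cv;
  cadjC : symmetric cadj;
  cadjxx : irreflexive cadj;
  cact1 : forall u, cact 1%g u = u;
  cactM : forall g h u, cact (g * h)%g u = cact g (cact h u);
  cadj_act : forall g u v, cadj (cact g u) (cact g v) = cadj u v;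
  c_connected : forall u v, exists p, redp cadj u p && (last u p == v);
  c_acyclic : forall u p, redp cadj u p -> last u p = u -> p = [::]
}.

Section CTree.
Context {G : groupType} (T : ctree G).
Local Notation adj := (@cadj G T).
Local Notation "g ** x" := (@cact G T g x) (at level 40).
Implicit Types (u v w x y z a b : T) (g h : G).

Lemma cactK g x : g ** (g^-1 ** x) = x.
Proof. by rewrite -cactM mulgV cact1. Qed.

Lemma cactVK g x : g^-1 ** (g ** x) = x.
Proof. by rewrite -cactM mulVg cact1. Qed.

Lemma cact_inj g : injective (@cact G T g).
Proof. exact: can_inj (cactVK g). Qed.

Definition geo u v : seq T := projT1 (cid (c_connected u v)).

Lemma geo_red u v : redp adj u (geo u v).
Proof. by rewrite /geo; case: cid => p /= /andP[]. Qed.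

Lemma last_geo u v : last u (geo u v) = v.
Proof. by rewrite /geo; case: cid => p /= /andP[_ /eqP]. Qed.

Lemma redp_uniq u p q : redp adj u p -> redp adj u q -> last u p = last u q ->
  p = q.
Proof.
elim: p u q => [|a p IH] u q rp rq.
  by move=> /= e; rewrite (c_acyclic rq).
case: q rq => [|b q] rq; first by move=> /= e; have := c_acyclic rp e.
have [ab|ab] := eqVneq a b.
  rewrite -ab => /= e; congr (_ :: _); move: rp rq; rewrite -ab !redp_cons.
  by move=> /and3P[_ _ rp] /and3P[_ _ rq]; apply: (IH a).
move=> e; have := redp_rev (@cadjC _ T) rp.
rewrite [belast _ _]/= rev_cons => rr.
have /(c_acyclic (u := last u (a :: p))) : redp adj (last u (a :: p))
    (rcons (rev (belast a p)) u ++ b :: q).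
  apply: redp_cat => //; case: (p) => [|c p'] //=.
  by rewrite rev_cons last_rcons.
rewrite last_cat last_rcons => /(_ (esym e)).
by case: (rev _).
Qed.

Lemma geo_uniq u v p : redp adj u p -> last u p = v -> geo u v = p.
Proof.
by move=> rp e; apply: (redp_uniq (geo_red u v) rp); rewrite last_geo e.
Qed.

Lemma geoxx u : geo u u = [::].
Proof. exact: geo_uniq. Qed.

Lemma geo_rev u v : geo v u = rev (belast u (geo u v)).
Proof.
apply: geo_uniq; first by rewrite -{1}(last_geo u v); apply/redp_rev/geo_red/cadjC.
rewrite -{1}(last_geo u v); case: (geo u v) => [|a p] //=.
by rewrite rev_cons last_rcons.
Qed.

Lemma geo_act g u v : geo (g ** u) (g ** v) = map (cact g) (geo u v).
Proof.
apply: geo_uniq; last by rewrite last_map last_geo.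
move: (geo u v) (geo_red u v) => p; elim: p u {v} => [|a p IH] u //=.
rewrite !redp_cons cadj_act => /and3P[-> h /IH ->]; rewrite andbT /=.
by case: p h {IH} => //= b p; rewrite (inj_eq (@cact_inj g)).
Qed.

(* [nearer x y w]: the edge [x y] points away from [w]. *)
Definition nearer x y w : bool := geo w y == rcons (geo w x) y.

Lemma nearer_adj x y w : nearer x y w -> adj x y.
Proof.
move=> /eqP e; have := geo_red w y; rewrite e -cats1 => /redp_split/andP[_].
by rewrite last_geo redp_cons => /and3P[].
Qed.

(** The edge either prolongs the reduced path from [w] to [x], or is its last edge traversed
    backwards. *)
Lemma nearerP x y w : adj x y -> nearer x y w = ~~ nearer y x w.
Proof.
move=> xy; apply/idP/negP => [/eqP e /eqP e'|n].
  by move: (congr1 size e); rewrite e' !size_rcons; lia.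
have r := geo_red w x; have l := last_geo w x; apply/eqP.
case: (lastP (geo w x)) r l => [|p z] r.
  by move=> /= ->; apply: geo_uniq; rewrite // redp_cons xy.
rewrite last_rcons => zx; subst z.
have [e|ne] := eqVneq (last w p) y.
  case: n; apply/eqP; move: r; rewrite -cats1 => r.
  rewrite (geo_uniq r) ?cats1 ?last_rcons //; congr (rcons _ _).
  by case/redp_split/andP: r => r _; rewrite (geo_uniq r e).
by apply: geo_uniq; rewrite ?last_rcons // -cats1; apply: redp_cat; rewrite // redp_cons xy.
Qed.

Lemma nearer_refl x y : adj x y -> nearer x y x.
Proof. by move=> xy; rewrite /nearer geoxx (@geo_uniq x y [:: y]) // redp_cons xy. Qed.

Lemma nearer_act g x y w : nearer (g ** x) (g ** y) (g ** w) = nearer x y w.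
Proof.
by rewrite /nearer !geo_act -map_rcons (inj_eq (inj_map (@cact_inj g))).
Qed.

Lemma nearer_cons x y b : nearer y x b -> geo x b = y :: geo y b.
Proof.
move=> /eqP e; rewrite (geo_rev b x) e belast_rcons (geo_rev b y).
by rewrite lastI rev_rcons last_geo.
Qed.

Lemma geo_sep x y a b : nearer x y a -> nearer y x b ->
  geo a b = geo a x ++ y :: geo y b.
Proof.
move=> xa yb; have xy := nearer_adj xa; have := geo_red a y.
rewrite (eqP xa) => r; apply: geo_uniq; last by rewrite last_cat /= last_geo.
rewrite -cat_rcons; have := geo_red x b; rewrite (nearer_cons yb) redp_cons.
have := geo_red y b; case: (geo y b) => [|z q] ry; first by rewrite cats0.
by case/and3P=> _ zx _; apply: redp_cat; rewrite // last_geo eq_sym.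
Qed.

Lemma geo_first u v : u <> v -> exists x, nearer x u v.
Proof.
move=> uv; move: (geo_red v u) (last_geo v u).
case e: _ / (lastP (geo v u)) => [|q z]; first by move=> _ /= vu; case: uv.
rewrite last_rcons => r zu; subst z.
exists (last v q); apply/eqP; rewrite e; congr rcons; apply/esym/geo_uniq => //.
by move: r; rewrite -cats1 => /redp_split/andP[].
Qed.

Section Dist.
Context {A : zmodType} (l : T -> T -> A).

Definition tdist u v : A := wlen l u (geo u v).

Lemma tdistxx u : tdist u u = 0.
Proof. by rewrite /tdist geoxx wlen_nil. Qed.

Lemma tdist_nearer x y w : nearer x y w -> tdist w y = tdist w x + l x y.
Proof. by move=> /eqP e; rewrite /tdist e wlen_rcons last_geo. Qed.

Lemma tdist_sep x y a b : nearer x y a -> nearer y x b ->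
  tdist a b = tdist a x + (l x y + tdist y b).
Proof.
by move=> xa yb; rewrite /tdist (geo_sep xa yb) wlen_cat last_geo wlen_cons.
Qed.

Lemma tdist_adj x y : adj x y -> tdist x y = l x y.
Proof. by move/nearer_refl/tdist_nearer => ->; rewrite tdistxx add0r. Qed.

Lemma tdist_first x y b : nearer y x b -> tdist x b = l x y + tdist y b.
Proof. by move=> /nearer_cons e; rewrite /tdist e wlen_cons. Qed.

Hypothesis lC : forall u v, l u v = l v u.

Lemma tdistC u v : tdist u v = tdist v u.
Proof. by rewrite /tdist (geo_rev u v) -{2}(last_geo u v) wlen_rev. Qed.

Hypothesis lA : forall g u v, l (g ** u) (g ** v) = l u v.

Lemma tdist_act g u v : tdist (g ** u) (g ** v) = tdist u v.
Proof.
rewrite /tdist geo_act; move: (geo u v) => p; elim: p u {v} => [|a p IH] u /=.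
  by rewrite !wlen_nil.
by rewrite !wlen_cons IH lA.
Qed.

End Dist.

Definition nsteps u v : nat := size (geo u v).

Lemma nsteps_nearer x y w : nearer x y w -> nsteps w y = (nsteps w x).+1.
Proof. by move=> /eqP e; rewrite /nsteps e size_rcons. Qed.

Lemma nsteps_first x y b : nearer y x b -> nsteps x b = (nsteps y b).+1.
Proof. by move=> /nearer_cons e; rewrite /nsteps e. Qed.

Lemma nsteps_sep x y a b : nearer x y a -> nearer y x b ->
  nsteps a b = (nsteps a x + (nsteps y b).+1)%N.
Proof. by move=> xa yb; rewrite /nsteps (geo_sep xa yb) size_cat. Qed.

Lemma nstepsC u v : nsteps u v = nsteps v u.
Proof. by rewrite /nsteps (geo_rev u v) size_rev size_belast. Qed.

Lemma nsteps_eq0 u v : (nsteps u v == 0)%N = (u == v).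
Proof.
apply/eqP/eqP => [/size0nil e|->]; last by rewrite /nsteps geoxx.
by rewrite -(last_geo u v) e.
Qed.

Lemma nsteps_adj x y : adj x y -> nsteps x y = 1%N.
Proof. by move/nearer_refl/nsteps_nearer ->; rewrite /nsteps geoxx. Qed.

(** A path from one side of an edge to the other contains this edge, and a path of length one has no
    room for more. *)
Lemma nearer_crossing a b x y : adj x y -> nearer a b x -> nearer b a y ->
  x = a /\ y = b.
Proof.
move=> /nsteps_adj xy ax by_; move: (nsteps_sep ax by_); rewrite xy => e.
by rewrite nstepsC in e; split; apply/eqP; rewrite -nsteps_eq0 nstepsC; lia.
Qed.

(** Induction along the geodesic toward a fixed [v], stated on vertices so that most arguments below
    need not handle paths. *)
Lemma tree_ind_to v (P : T -> Prop) : P v ->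
  (forall x y, nearer y x v -> P y -> P x) -> forall u, P u.
Proof.
move=> Pv Pstep u; move e: (nsteps u v) => n.
elim: n u e => [|n IH] u e; first by move/eqP: e; rewrite nsteps_eq0 => /eqP ->.
have [|y yu] := @geo_first u v.
  by move=> uv; move: e; rewrite uv /nsteps geoxx.
by apply: (Pstep _ y) => //; apply: IH; move: (nsteps_first yu); lia.
Qed.

Definition separates a b x y : bool := nearer a b x && nearer b a y.

Lemma separates_cat a b x y z : adj a b -> separates a b x z ->
  separates a b x y || separates a b y z.
Proof.
move=> ab /andP[ax bz]; rewrite /separates ax bz andbT /=.
by rewrite (nearerP _ ab) orbN.
Qed.

Lemma separates_act g a b x y :
  separates (g ** a) (g ** b) (g ** x) (g ** y) = separates a b x y.
Proof. by rewrite /separates !nearer_act. Qed.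

Lemma next_separates u u1 v a b : nearer u1 u v -> separates a b u1 v ->
  separates a b u v.
Proof.
move=> n /andP[n1 n2]; rewrite /separates n2 andbT.
apply: contraT => nu; have ab := nearer_adj n1.
have {}nu : nearer b a u by rewrite nearerP 1?cadjC.
have [e1 e2] := nearer_crossing (nearer_adj n) n1 nu; subst u1 u.
by move: n2; rewrite nearerP 1?cadjC // n.
Qed.

Lemma next_edge_separates u u1 v : nearer u1 u v -> separates u u1 u v.
Proof. by move=> n; rewrite /separates n nearer_refl // cadjC (nearer_adj n). Qed.

Lemma nsteps_tri y x z : (nsteps x z <= nsteps x y + nsteps y z)%N.
Proof.
apply: (@tree_ind_to z (fun y => nsteps x z <= nsteps x y + nsteps y z)%N).
  by rewrite leq_addr.
move=> u v n h; rewrite (nsteps_first n); have uv := nearer_adj n.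
case nx : (nearer u v x); first by have := nsteps_nearer nx; lia.
have nx' : nearer v u x by rewrite nearerP ?nx.
by have := nsteps_nearer nx'; lia.
Qed.

Lemma separates_sub a b x y c d : separates a b x y -> separates c d a x ->
  separates d c x y.
Proof.
move=> /[dup] ab /andP[a1 b1] /andP[c1 d1]; rewrite /separates d1 /=.
have cd := nearer_adj c1; have dc : cadj d c by rewrite cadjC.
rewrite nearerP //; apply/negP => dy.
have e1 := nsteps_sep c1 d1; have e2 := nsteps_sep c1 dy; have e3 := nsteps_sep a1 b1.
have t1 := nsteps_tri d x y; have t2 := nsteps_tri b a y.
have e4 := nsteps_adj (nearer_adj a1).
by rewrite (nstepsC x a) in e3; rewrite (nstepsC x d) in t1; lia.
Qed.

End CTree.

(** * The metric realization of a weighted combinatorial tree *)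

(* Edges of length zero are allowed; they are collapsed in the realization.  The
   gap between zero and the positive lengths makes it complete. *)
Record wtree (R : realType) (G : groupType) := WTree {
  wt :> ctree G;
  wl : wt -> wt -> R;
  wl_ge0 : forall u v, 0 <= wl u v;
  wlC : forall u v, wl u v = wl v u;
  wl_act : forall g u v, wl (cact g u) (cact g v) = wl u v;
  wl_gap : exists2 eps : R, 0 < eps &
    forall u v, cadj u v -> wl u v = 0 \/ eps <= wl u v
}.

Section Realization.
Context {R : realType} {G : groupType} (W : wtree R G).
Local Notation T := (wt W).
Local Notation adj := (@cadj G T).
Local Notation "g ** x" := (@cact G T g x) (at level 40).
Implicit Types (u v w : T) (g h : G).

Definition wd u v : R := tdist (@wl R G W) u v.

Lemma wdxx u : wd u u = 0.
Proof. exact: tdistxx. Qed.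

Lemma wdC u v : wd u v = wd v u.
Proof. exact/tdistC/wlC. Qed.

Lemma wd_act g u v : wd (g ** u) (g ** v) = wd u v.
Proof. exact/tdist_act/wl_act. Qed.

Lemma wd_adj u v : adj u v -> wd u v = wl u v.
Proof. exact: tdist_adj. Qed.

Lemma wd_ge0 u v : 0 <= wd u v.
Proof.
apply: (@tree_ind_to G T v (fun u => 0 <= wd u v)); first by rewrite wdxx.
by move=> x y n h; rewrite /wd (tdist_first _ n) addr_ge0 // wl_ge0.
Qed.

Lemma wd_nearer u v w : nearer u v w -> wd w v = wd w u + wd u v.
Proof. by move=> n; rewrite /wd (tdist_nearer _ n) (tdist_adj _ (nearer_adj n)). Qed.

Lemma wd_first u v w : nearer v u w -> wd u w = wd u v + wd v w.
Proof.
move=> n; have uv : adj u v by rewrite cadjC (nearer_adj n).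
by rewrite (wd_adj uv) /wd (tdist_first _ n).
Qed.

Lemma wd_sep x y a b : separates x y a b -> wd a b = wd a x + wd x y + wd y b.
Proof.
move=> /andP[n m]; rewrite /wd (tdist_sep _ n m) addrA.
by rewrite (tdist_adj _ (nearer_adj n)).
Qed.

Lemma wd_dich u v w : adj u v -> wd w v = wd w u + wd u v \/ wd w u = wd w v + wd u v.
Proof.
move=> uv; case n : (nearer u v w); first by left; apply: wd_nearer.
by right; rewrite (wdC u); apply: wd_nearer; rewrite nearerP ?n // cadjC.
Qed.

Lemma wd_tri y x z : wd x z <= wd x y + wd y z.
Proof.
apply: (@tree_ind_to G T z (fun y => wd x z <= wd x y + wd y z)).
  by rewrite wdxx addr0.
move=> u v n h; have uv := nearer_adj n; rewrite cadjC in uv.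
by rewrite (wd_first n); have := wd_ge0 u v; case: (wd_dich x uv); lra.
Qed.

Ltac wsym_eq x y :=
  lazymatch goal with
  | _ : wd x y = wd y x |- _ => fail
  | _ : wd y x = wd x y |- _ => fail
  | _ => pose proof (wdC x y)
  end.

Ltac wlra :=
  repeat match goal with
  | |- context [wd ?x ?y] => wsym_eq x y
  | H : context [wd ?x ?y] |- _ => wsym_eq x y
  end; lra.

Lemma wd4 x a b c : wd x a + wd b c <= wd x b + wd a c \/
                    wd x a + wd b c <= wd x c + wd a b.
Proof.
apply: (@tree_ind_to G T a (fun x => wd x a + wd b c <= wd x b + wd a c \/
                    wd x a + wd b c <= wd x c + wd a b)).
  by left; have := wd_tri a b c; rewrite wdxx; wlra.
move=> u v n IH; have vu := nearer_adj n; have uv : adj u v by rewrite cadjC.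
have e := wd_first n; have t1 := wd_tri u b c; have l0 := wd_ge0 u v.
have sep z : nearer u v z -> wd a z = wd a v + wd u v + wd u z.
  move=> nz; have s : separates v u a z by rewrite /separates n nz.
  by rewrite (wd_sep s) (wdC v u).
case nb : (nearer u v b).
  by have := sep _ nb; right; wlra.
case nc : (nearer u v c).
  by have := sep _ nc; left; wlra.
have eb : wd u b = wd u v + wd v b by apply: wd_first; rewrite nearerP ?nb //.
have ec : wd u c = wd u v + wd v c by apply: wd_first; rewrite nearerP ?nc //.
by case: IH; [left|right]; lra.
Qed.

(** [(u, v, t)] stands for the point at distance [t] from [u] on the geodesic from [u] to [v].
    Arbitrary pairs of vertices are allowed rather than edges only: a vertex is then [(u, u, 0)],
    and collapsed edges need no separate treatment. Triples at distance 0 are identified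
    afterwards. *)
Definition triple : Type :=
  {x : T * T * R | (0 <= x.2) && (x.2 <= wd x.1.1 x.1.2)}.
HB.instance Definition _ := Choice.on triple.

(** By the triangle inequality both terms are lower bounds for the distance, and in a tree one of
    them is attained. *)
Definition vdist u (y : triple) : R :=
  Num.max (wd u (val y).1.1 - (val y).2)
          (wd u (val y).1.2 - (wd (val y).1.1 (val y).1.2 - (val y).2)).

Definition rdist (x y : triple) : R :=
  Num.max (vdist (val x).1.1 y - (val x).2)
          (vdist (val x).1.2 y - (wd (val x).1.1 (val x).1.2 - (val x).2)).

Fact vtriple_subproof u : (0 <= (u, u, 0 : R).2) &&
  ((u, u, 0 : R).2 <= wd (u, u, 0 : R).1.1 (u, u, 0 : R).1.2).
Proof. by rewrite /= lexx wd_ge0. Qed.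

Definition vtriple u : triple := exist _ (u, u, 0) (vtriple_subproof u).

Lemma rdist_vtriple u y : rdist (vtriple u) y = vdist u y.
Proof. by rewrite /rdist /= wdxx !subr0 maxxx. Qed.

Lemma vdist_vtriple u v : vdist u (vtriple v) = wd u v.
Proof. by rewrite /vdist /= wdxx !subr0 maxxx. Qed.

Lemma vdist_cases u y : let: (a, b, t) := val y in
  [/\ wd u a - t <= vdist u y, wd u b - (wd a b - t) <= vdist u y &
      vdist u y = wd u a - t \/ vdist u y = wd u b - (wd a b - t)].
Proof.
rewrite /vdist; case: (val y) => -[a b] t /=.
by split; rewrite ?le_max ?lexx ?orbT //; case: leP; [right|left].
Qed.

Lemma rdist_cases x y : let: (u, v, t) := val x in
  [/\ vdist u y - t <= rdist x y, vdist v y - (wd u v - t) <= rdist x y &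
      rdist x y = vdist u y - t \/ rdist x y = vdist v y - (wd u v - t)].
Proof.
rewrite /rdist; case: (val x) => -[a b] t /=.
by split; rewrite ?le_max ?lexx ?orbT //; case: leP; [right|left].
Qed.

Lemma rdist_le_sym x y : rdist x y <= rdist y x.
Proof.
have := rdist_cases x y; have := rdist_cases y x.
case: x y => [[[u v] s] /= p] [[[a b] t] /= q] [h1 h2 _] [_ _].
have [/= k1 k2 _] := vdist_cases a (exist _ (u, v, s) p).
have [/= k3 k4 _] := vdist_cases b (exist _ (u, v, s) p).
have [/= _ _ m1] := vdist_cases u (exist _ (a, b, t) q).
have [/= _ _ m2] := vdist_cases v (exist _ (a, b, t) q).
have e1 := wdC a u; have e2 := wdC a v; have e3 := wdC b u; have e4 := wdC b v.
by case=> ->; [case: m1 => ->|case: m2 => ->]; lra.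
Qed.

Lemma rdistC x y : rdist x y = rdist y x.
Proof. by apply/eqP; rewrite eq_le !rdist_le_sym. Qed.

Let quad (x y z w : triple) := rdist x y + rdist z w <= rdist x z + rdist y w \/
                    rdist x y + rdist z w <= rdist x w + rdist y z.

Let quad_vertex (y z w : triple) : (forall u, quad (vtriple u) y z w) -> forall x, quad x y z w.
Proof.
move=> h x; have := (rdist_cases x y, (rdist_cases x z, rdist_cases x w)).
case: (val x) => -[u v] s [[y1 y2 y3] [[z1 z2 _] [w1 w2 _]]].
have := h u; have := h v; rewrite /quad !rdist_vtriple.
by case: y3 => ->; do 2 case=> ?; (try by left; lra); right; lra.
Qed.

Let quadC (x y z w : triple) : quad x y z w -> quad y x z w.
Proof. by rewrite /quad (rdistC y x); case; [right|left]; lra. Qed.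

Let quadC2 (x y z w : triple) : quad x y z w -> quad z w x y.
Proof.
rewrite /quad (rdistC z x) (rdistC z y) (rdistC w x) (rdistC w y).
by case; [left|right]; lra.
Qed.

(** In each argument [rdist] is a maximum of two values at vertices, shifted by constants that are
    the same on both sides. So the inequality passes from vertices to points, one argument at a
    time. *)
Lemma rdist4 (x y z w : triple) : rdist x y + rdist z w <= rdist x z + rdist y w \/
                       rdist x y + rdist z w <= rdist x w + rdist y z.
Proof.
apply: quad_vertex x => a; apply: quadC; apply: quad_vertex y => b.
apply: quadC2; apply: quad_vertex z => c; apply: quadC; apply: quad_vertex w => e.
by rewrite /quad !rdist_vtriple !vdist_vtriple; apply: wd4.
Qed.

Lemma rdistxx x : rdist x x = 0.
Proof.
have := rdist_cases x x.
case: x => [[[u v] t] /= p] [h1 h2 h3].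
have [/= k1 k2 k3] := vdist_cases u (exist _ (u, v, t) p).
have [/= m1 m2 m3] := vdist_cases v (exist _ (u, v, t) p).
have /andP[/= t0 t1] := p.
have e := wdC v u; rewrite ?wdxx in k1 k2 k3 m1 m2 m3.
by case: h3 => h3; [case: k3 => k3|case: m3 => m3]; lra.
Qed.

Lemma rdist_tri y x z : rdist x z <= rdist x y + rdist y z.
Proof. by have := rdist4 x z y y; rewrite rdistxx (rdistC z y); case; lra. Qed.

Lemma rdist_ge0 x y : 0 <= rdist x y.
Proof. by have := rdist_tri y x x; rewrite rdistxx (rdistC y x); lra. Qed.

Definition requiv (x y : triple) : bool := rdist x y == 0.

Lemma requiv_equiv : equiv_class_of requiv.
Proof.
split=> [x|x y|y x z]; rewrite /requiv ?rdistxx //; first by rewrite rdistC.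
move=> /eqP xy /eqP yz; rewrite eq_le rdist_ge0 andbT.
by have := rdist_tri y x z; lra.
Qed.

Canonical requiv_rel := EquivRelPack requiv_equiv.

Local Open Scope quotient_scope.

Definition rpt : Type := {eq_quot requiv_rel}.
HB.instance Definition _ := Choice.on rpt.
HB.instance Definition _ := EqQuotient.on rpt.

Implicit Types (x y z : rpt) (s t : R).

Local Notation d := (fun x y : rpt => rdist (repr x) (repr y)).

Lemma rdist_pi (a b : triple) : d (\pi_rpt a) (\pi_rpt b) = rdist a b.
Proof.
have e a' : rdist a' (repr (\pi_rpt a')) = 0.
  by apply/eqP; have /eqmodP := esym (reprK (\pi_rpt a')).
have := (e a, e b); set a' := repr _; set b' := repr _ => -[ea eb].
have := (rdist_tri a' a b', (rdist_tri b a b', (rdist_tri a a' b', rdist_tri b' a b))).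
rewrite (rdistC a' a) (rdistC b' b) ea eb => -[h1 [h2 [h3 h4]]].
by apply/eqP; rewrite eq_le; apply/andP; split; lra.
Qed.

Fact rpt_positivity x y : d x y = 0 -> x = y.
Proof. by move=> e; rewrite -[x]reprK -[y]reprK; apply/eqmodP/eqP. Qed.

HB.instance Definition _ := isMetric.Build R rpt (fun x => rdistxx (repr x))
  rpt_positivity (fun x y => rdistC (repr x) (repr y))
  (fun y x z => rdist_tri (repr y) (repr x) (repr z)).

(** Outside the range [0 <= t <= wd u v] the default value is the vertex [u]. *)
Definition rp u v (t : R) : rpt := \pi_rpt (insubd (vtriple u) (u, v, t)).
Definition rv u : rpt := rp u u 0.

Lemma val_rp u v t : 0 <= t -> t <= wd u v -> val (insubd (vtriple u) (u, v, t)) = (u, v, t).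
Proof. by move=> t0 t1; rewrite val_insubd /= t0 t1. Qed.

Lemma rvE u : rv u = \pi_rpt (vtriple u).
Proof. by congr (\pi_rpt _); apply: val_inj; rewrite val_rp ?wd_ge0. Qed.

Lemma mdist_rv u v : mdist (rv u) (rv v) = wd u v.
Proof. by rewrite !rvE [LHS]rdist_pi rdist_vtriple vdist_vtriple. Qed.

Lemma mdist_rp u v t y : 0 <= t -> t <= wd u v ->
  [/\ mdist (rv u) y - t <= mdist (rp u v t) y,
      mdist (rv v) y - (wd u v - t) <= mdist (rp u v t) y &
      mdist (rp u v t) y = mdist (rv u) y - t \/
      mdist (rp u v t) y = mdist (rv v) y - (wd u v - t)].
Proof.
move=> t0 t1; rewrite -[y]reprK !rvE ![mdist _ _]rdist_pi !rdist_vtriple.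
have := rdist_cases (insubd (vtriple u) (u, v, t)) (repr y).
by rewrite val_rp.
Qed.

Lemma rpt_cases x : exists u v t, [/\ 0 <= t, t <= wd u v & x = rp u v t].
Proof.
rewrite -[x]reprK; case: (repr x) => [[[u v] t] /= p].
have /andP[/= t0 t1] := p; exists u, v, t; split=> //.
by congr (\pi_rpt _); apply: val_inj; rewrite val_rp.
Qed.

Lemma mdist4 x y z (w : rpt) : mdist x y + mdist z w <= mdist x z + mdist y w \/
                       mdist x y + mdist z w <= mdist x w + mdist y z.
Proof. exact: rdist4. Qed.

Lemma mdist_eq x y : mdist x y <= 0 -> x = y.
Proof. by move=> le; apply: mdist_positivity; apply/eqP; rewrite eq_le le mdist_ge0. Qed.

Lemma mdist_rvl u v t : 0 <= t -> t <= wd u v -> mdist (rv u) (rp u v t) = t.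
Proof.
move=> t0 t1; have [h1 h2 h3] := mdist_rp (rv u) t0 t1.
by rewrite !mdist_rv wdxx (wdC v) in h1 h2 h3; rewrite metric_sym; case: h3; lra.
Qed.

Lemma mdist_rvr u v t : 0 <= t -> t <= wd u v -> mdist (rv v) (rp u v t) = wd u v - t.
Proof.
move=> t0 t1; have [h1 h2 h3] := mdist_rp (rv v) t0 t1.
by rewrite !mdist_rv wdxx in h1 h2 h3; rewrite metric_sym; case: h3; lra.
Qed.

Lemma mdist_same u v s t : 0 <= s -> s <= wd u v -> 0 <= t -> t <= wd u v ->
  mdist (rp u v s) (rp u v t) = `|s - t|.
Proof.
move=> s0 s1 t0 t1; have [h1 h2 h3] := mdist_rp (rp u v t) s0 s1.
rewrite mdist_rvl // mdist_rvr // in h1 h2 h3.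
by have [le|lt] := leP s t; [rewrite ler0_norm|rewrite gtr0_norm]; try lra; case: h3; lra.
Qed.

Lemma rp_flip u v t : 0 <= t -> t <= wd u v -> rp v u (wd u v - t) = rp u v t.
Proof.
move=> t0 t1; apply: mdist_eq.
have [||_ _] := @mdist_rp v u (wd u v - t) (rp u v t); try by rewrite ?(wdC v); lra.
by rewrite mdist_rvl // mdist_rvr // (wdC v); case=> ->; lra.
Qed.

Lemma rp0 u v : rp u v 0 = rv u.
Proof. by apply: mdist_eq; rewrite metric_sym mdist_rvl ?wd_ge0. Qed.

Lemma rp1 u v : rp u v (wd u v) = rv v.
Proof. by apply: mdist_eq; rewrite metric_sym mdist_rvr ?wd_ge0 ?subrr. Qed.

Lemma rp_unique u v t x : 0 <= t -> t <= wd u v -> mdist (rv u) x = t ->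
  mdist (rv v) x = wd u v - t -> x = rp u v t.
Proof.
move=> t0 t1 h1 h2; apply/esym/mdist_eq; have [_ _] := mdist_rp x t0 t1.
by rewrite h1 h2; case; lra.
Qed.

Lemma rv_eq u v : (rv u = rv v) <-> (wd u v = 0).
Proof.
split=> [e|e]; first by rewrite -mdist_rv e mdistxx.
by apply: mdist_eq; rewrite mdist_rv e.
Qed.

Fact ract_subproof g (a : triple) :
  let b := (g ** (val a).1.1, g ** (val a).1.2, (val a).2) in
  (0 <= b.2) && (b.2 <= wd b.1.1 b.1.2).
Proof. by case: a => [[[u v] t] /= /andP[/= t0 t1]]; rewrite wd_act t0. Qed.

Definition ract_triple g (a : triple) : triple :=
  exist _ (g ** (val a).1.1, g ** (val a).1.2, (val a).2) (ract_subproof g a).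

Definition ract g x : rpt := \pi_rpt (ract_triple g (repr x)).

Lemma mdist_ract g x y : mdist (ract g x) (ract g y) = mdist x y.
Proof. by rewrite /ract [LHS]rdist_pi /rdist /vdist /= !wd_act. Qed.

Lemma ract_rv g u : ract g (rv u) = rv (g ** u).
Proof.
rewrite !rvE /ract; apply: mdist_eq; rewrite [mdist _ _]rdist_pi.
rewrite (_ : vtriple (g ** u) = ract_triple g (vtriple u)); last exact: val_inj.
rewrite le_eqVlt; apply/orP; left; apply/eqP; transitivity (rdist (repr (\pi_rpt (vtriple u))) (vtriple u)).
  by rewrite /rdist /vdist /= !wd_act.
rewrite -rdist_pi reprK; exact: rdistxx.
Qed.

Lemma ract_rp g u v t : 0 <= t -> t <= wd u v ->
  ract g (rp u v t) = rp (g ** u) (g ** v) t.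
Proof.
by move=> t0 t1; apply: rp_unique; rewrite ?wd_act // -ract_rv mdist_ract
  ?mdist_rvl ?mdist_rvr.
Qed.

Lemma ract1 x : ract 1%g x = x.
Proof.
by have [u [v [t [t0 t1 ->]]]] := rpt_cases x; rewrite ract_rp // !cact1.
Qed.

Lemma ractM g h x : ract (g * h)%g x = ract g (ract h x).
Proof.
have [u [v [t [t0 t1 ->]]]] := rpt_cases x.
by rewrite !ract_rp ?wd_act // !cactM.
Qed.

(** The segment is prolonged beyond each of its ends to a vertex: of the two vertices that define a
    point, one lies behind it as seen from the other point. *)
Lemma rpt_on_geodesic x y : exists u v s t,
  [/\ [/\ 0 <= s, s <= t & t <= wd u v], x = rp u v s & y = rp u v t].
Proof.
have near_end z (w : rpt) : exists u, mdist (rv u) w = mdist (rv u) z + mdist z w.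
  have [u [v [t [t0 t1 ->]]]] := rpt_cases z.
  have [_ _ [e|e]] := mdist_rp w t0 t1; [exists u|exists v].
  - by rewrite mdist_rvl // e; lra.
  - by rewrite mdist_rvr // e; lra.
have [u eu] := near_end x y; have [v ev] := near_end y (rv u).
rewrite mdist_rv (metric_sym y (rv u)) in ev.
have t1 := metric_triangle (rv u) x (rv v).
have t2 := metric_triangle x y (rv v).
have [g1 [g2 g3]] := (mdist_ge0 (rv u) x, (mdist_ge0 x y, mdist_ge0 (rv v) y)).
rewrite mdist_rv (metric_sym x (rv v)) (metric_sym y (rv v)) (wdC u) in t1 t2.
exists u, v, (mdist (rv u) x), (mdist (rv u) y); split.
- by split; rewrite ?(wdC u); lra.
- by apply: rp_unique; rewrite ?(wdC u); lra.
- by apply: rp_unique; rewrite ?(wdC u); lra.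
Qed.

Lemma rpt_geodesic x y s : 0 <= s -> s <= mdist x y ->
  exists z, mdist x z = s /\ mdist z y = mdist x y - s.
Proof.
have [u [v [a [b [[a0 ab b1] -> ->]]]]] := rpt_on_geodesic x y.
rewrite mdist_same; [|lra..]; rewrite ler0_norm; [|lra] => s0 s1.
exists (rp u v (a + s)); rewrite !mdist_same; try lra.
by split; rewrite ler0_norm; lra.
Qed.

End Realization.

(** * The simplicial structure of the realization *)

Section SimplicialRealization.
Context {R : realType} {G : groupType} (W : wtree R G).
Local Notation T := (wt W).
Local Notation adj := (@cadj G T).
Local Notation "g ** x" := (@cact G T g x) (at level 40).
Local Notation rpt := (rpt W).
Implicit Types (u v w a b : T) (g h : G) (x y z : rpt) (s t : R).

Lemma rp_prefix u m v t : wd u m + wd m v = wd u v -> 0 <= t -> t <= wd u m ->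
  rp u v t = rp u m t.
Proof.
move=> e t0 t1; have g := wd_ge0 m v; apply/esym/rp_unique => //; first lra.
  by rewrite mdist_rvl.
have h1 := metric_triangle (rv v) (rv m) (rp u m t).
have h2 := metric_triangle (rv u) (rp u m t) (rv v).
rewrite !mdist_rv mdist_rvr // (metric_sym (rp _ _ _)) mdist_rvl // (wdC v) in h1 h2.
lra.
Qed.

Lemma rp_suffix u m v t : wd u m + wd m v = wd u v -> wd u m <= t -> t <= wd u v ->
  rp u v t = rp m v (t - wd u m).
Proof.
move=> e t0 t1; have g := wd_ge0 u m.
have g' := wd_ge0 m v; have e' : wd v m + wd m u = wd v u.
  by rewrite (wdC v u) (wdC v m) (wdC m u); lra.
rewrite -(rp_flip (u := u) (v := v) (t := t)) ?(le_trans g) //.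
rewrite -(rp_flip (u := m) (v := v) (t := t - wd u m)) ?subr_ge0 //; last by lra.
rewrite (rp_prefix e') ?subr_ge0 //; last by rewrite (wdC v); lra.
by congr rp; lra.
Qed.

Definition redge u v : set rpt := rp u v @` `[0, wd u v]%classic.
Definition redges : set (set rpt) :=
  [set e | exists u v, [/\ adj u v, 0 < wd u v & e = redge u v]].
Definition rverts : set rpt := range (@rv R G W).

Lemma redgeP u v z : redge u v z <-> exists2 t, (0 <= t) && (t <= wd u v) & z = rp u v t.
Proof.
split=> [[t /=]|[t tuv ->]]; first by rewrite in_itv /= => tuv <-; exists t.
by exists t => //=; rewrite in_itv.
Qed.

Lemma redge_flip u v : redge v u = redge u v.
Proof.
suff sub a b : redge a b `<=` redge b a by apply/seteqP; split.
move=> z /redgeP[t /andP[t0 t1] ->]; apply/redgeP; exists (wd a b - t).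
  by rewrite (wdC b); apply/andP; split; lra.
by rewrite -(rp_flip t0 t1).
Qed.

Lemma redge_l u v : redge u v (rv u).
Proof. by apply/redgeP; exists 0; rewrite ?rp0 // lexx wd_ge0. Qed.

Lemma redge_r u v : redge u v (rv v).
Proof. by rewrite -redge_flip; apply: redge_l. Qed.

Lemma redge_vertex u v w t : adj u v -> 0 <= t -> t <= wd u v ->
  rp u v t = rv w -> t = 0 \/ t = wd u v.
Proof.
move=> uv t0 t1 e.
have e1 : wd u w = t by rewrite -mdist_rv -e mdist_rvl.
have e2 : wd v w = wd u v - t by rewrite -mdist_rv -e mdist_rvr.
by have := wd_dich w uv; rewrite !(wdC w) e1 e2; case; [left|right]; lra.
Qed.

Lemma mdist_near_side u v w t : nearer u v w -> 0 <= t -> t <= wd u v ->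
  mdist (rv w) (rp u v t) = wd w u + t.
Proof.
move=> n t0 t1; have [h1 h2 h3] := mdist_rp (rv w) t0 t1.
rewrite !mdist_rv !(wdC _ w) (wd_nearer n) (metric_sym (rp _ _ _)) in h1 h2 h3.
by case: h3; lra.
Qed.

(** If [u] and [v] were on the same side of the edge [[a b]], both paths to the interior point would
    pass through the same end and together exceed the length of [[u v]]. *)
Lemma redge_interior a b u v s t : adj a b -> adj u v -> 0 < t -> t < wd a b ->
  0 <= s -> s <= wd u v -> rp a b t = rp u v s ->
  (u = a /\ v = b) \/ (u = b /\ v = a).
Proof.
move=> ab uv t0 t1 s0 s1 e; have ba : adj b a by rewrite cadjC.
have vu : adj v u by rewrite cadjC.
have eu : mdist (rv u) (rp a b t) = s by rewrite e mdist_rvl.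
have ev : mdist (rv v) (rp a b t) = wd u v - s by rewrite e mdist_rvr.
have [lt0 lt1] := (ltW t0, ltW t1).
case nu : (nearer a b u); case nv : (nearer a b v).
- exfalso; have := wd_tri a u v; rewrite (mdist_near_side nu) // in eu.
  by rewrite (mdist_near_side nv) // (wdC v) in ev; lra.
- by left; apply: (nearer_crossing uv nu); rewrite nearerP // nv.
- have nu' : nearer b a u by rewrite nearerP // nu.
  by right; have [-> ->] := nearer_crossing vu nv nu'.
- exfalso; have {}nu : nearer b a u by rewrite nearerP ?nu.
  have {}nv : nearer b a v by rewrite nearerP ?nv.
  rewrite -(rp_flip lt0 lt1) in eu ev.
  rewrite (mdist_near_side nu) ?(wdC b a) in eu; [|lra..].
  rewrite (mdist_near_side nv) ?(wdC b a) in ev; [|lra..].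
  by have := wd_tri b u v; rewrite (wdC b v); lra.
Qed.

Lemma redge_ends a b u v : rv a = rv u -> rv b = rv v -> redge a b = redge u v.
Proof.
suff sub a' b' u' v' : rv a' = rv u' -> rv b' = rv v' -> redge a' b' `<=` redge u' v'.
  by move=> au bv; apply/seteqP; split; apply: sub.
move=> au bv z /redgeP[t /andP[t0 t1] ->]; apply/redgeP; exists t.
  by rewrite t0 -mdist_rv -au -bv mdist_rv.
apply: rp_unique; rewrite ?t0 // -?au -?bv ?mdist_rvl ?mdist_rvr //.
all: by rewrite -(mdist_rv u') -au -bv mdist_rv.
Qed.

Lemma rp_cover u v t : 0 <= t -> t <= wd u v ->
  (exists w, rp u v t = rv w) \/
  exists a b s, [/\ separates a b u v, 0 < s, s < wd a b & rp u v t = rp a b s].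
Proof.
move: t; apply: (@tree_ind_to G T v (fun u => forall t, 0 <= t -> t <= wd u v ->
  (exists w, rp u v t = rv w) \/
  exists a b s, [/\ separates a b u v, 0 < s, s < wd a b & rp u v t = rp a b s])).
  move=> t t0; rewrite wdxx => t1; left; exists v.
  by have -> : t = 0 by lra; rewrite rp0.
move=> {}u u1 n IH t t0 t1; have e := wd_first n.
have [le|lt] := leP t (wd u u1).
  rewrite (@rp_prefix u u1 v) //.
  have [->|tn0] := eqVneq t 0; first by left; exists u; rewrite rp0.
  have [->|tn1] := eqVneq t (wd u u1); first by left; exists u1; rewrite rp1.
  right; exists u, u1, t; split; rewrite ?lt_neqAle ?tn1 ?le // 1?eq_sym ?tn0 //.
  exact: next_edge_separates.
rewrite (@rp_suffix u u1 v) //; [|lra].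
have [||[w ->]|[a [b [s [ab s0 s1 ->]]]]] := IH (t - wd u u1); [lra|lra|by left; exists w|].
by right; exists a, b, s; split=> //; apply: next_separates ab.
Qed.

Lemma rv_chain u v s t : 0 <= s -> s <= t -> t <= wd u v ->
  exists p, [/\ chain redges (rp u v s) p, last (rp u v s) p = rp u v t &
                chain_length (rp u v s) p = t - s].
Proof.
move: s t; apply: (@tree_ind_to G T v (fun u => forall s t, 0 <= s -> s <= t -> t <= wd u v ->
  exists p, [/\ chain redges (rp u v s) p, last (rp u v s) p = rp u v t &
                chain_length (rp u v s) p = t - s])).
  move=> s t s0 st; rewrite wdxx => t0; exists [::].
  have -> : s = 0 by lra.
  have -> : t = 0 by lra.
  by split=> //; rewrite /chain_length /= big_nil subrr.
move=> {}u u1 n IH s t s0 st t1; have e := wd_first n.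
have [les|lts] := leP s (wd u u1); last first.
  rewrite !(@rp_suffix u u1 v) //; [|lra..].
  by have [|||p [p1 p2 p3]] := IH (s - wd u u1) (t - wd u u1); [lra..|exists p; split=> //; lra].
have [z0|l0] : wd u u1 = 0 \/ 0 < wd u u1 by have := wd_ge0 u u1; lra.
  rewrite !(@rp_suffix u u1 v) ?z0 ?subr0 //; [|lra..].
  by apply: IH; lra.
have inedge q : 0 <= q -> q <= wd u u1 -> redge u u1 (rp u v q).
  by move=> q0 q1; rewrite (rp_prefix _ q0 q1) //; apply/redgeP; exists q => //; rewrite q0.
have edge : redges (redge u u1).
  by exists u, u1; split=> //; rewrite cadjC (nearer_adj n).
have [let_|ltt] := leP t (wd u u1).
  exists [:: rp u v t]; split=> //=.
    by rewrite andbT; apply/asboolP; exists (redge u u1) => //; split; apply: inedge; lra.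
  rewrite /chain_length /= big_cons big_nil addr0 mdist_same //; [|lra..].
  by rewrite ler0_norm; lra.
have [|||p [p1 p2 p3]] := IH 0 (t - wd u u1); [lra..|].
rewrite rp0 in p1 p2 p3; exists (rv u1 :: p).
have e1 : rp u v (wd u u1) = rv u1 by rewrite (@rp_prefix u u1 v) ?rp1 //; lra.
split.
- rewrite /chain /= -/(chain _ _ _) p1 andbT; apply/asboolP; exists (redge u u1) => //.
  by split; [apply: inedge|rewrite -e1; apply: inedge]; lra.
- by rewrite /= p2 -rp_suffix //; lra.
- rewrite /chain_length /= big_cons -/(chain_length (rv u1) p) p3 -e1.
  by rewrite mdist_same //; [rewrite ler0_norm; lra|lra..].
Qed.

Lemma chain_length_ge x p : mdist x (last x p) <= chain_length x p.
Proof.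
elim: p x => [|y p IH] x; first by rewrite /chain_length /= big_nil mdistxx.
rewrite /chain_length /= big_cons -/(chain_length y p).
by have := metric_triangle x y (last y p); have := IH y; lra.
Qed.

Lemma rpt_chain x y : exists p,
  [/\ chain redges x p, last x p = y & chain_length x p = mdist x y].
Proof.
have [u [v [s [t [[s0 st t1] -> ->]]]]] := rpt_on_geodesic x y.
have [p [p1 p2 p3]] := rv_chain s0 st t1; exists p; split=> //.
by rewrite p3 mdist_same; [rewrite ler0_norm; lra|lra..].
Qed.

Lemma rpt_path_metric : path_metric redges.
Proof.
move=> x y; apply/eqP; rewrite eq_le; apply/andP; split.
  by apply: le_ereal_inf_tmp => _ [p [_ <-] <-]; rewrite lee_fin chain_length_ge.
have [p [p1 p2 p3]] := rpt_chain x y.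
by apply: ereal_inf_lbound; exists p => //; rewrite p3.
Qed.

End SimplicialRealization.

Section RealizedGTree.
Context {R : realType} {G : groupType} (W : wtree R G).
Local Notation T := (wt W).
Local Notation adj := (@cadj G T).
Local Notation "g ** x" := (@cact G T g x) (at level 40).
Local Notation rpt := (rpt W).
Local Notation rverts := (@rverts R G W).
Local Notation redges := (@redges R G W).
Implicit Types (u v w a b : T) (g h : G) (x y z : rpt) (s t : R).

Lemma redge_metric e : redges e -> metric_edge rverts e.
Proof.
case=> u [v [uv l0 ->]]; exists (wd u v), (rp u v); split=> //.
  by move=> s t; rewrite !in_itv /= => /andP[s0 s1] /andP[t0 t1]; apply: mdist_same.
move=> t; rewrite in_itv /= => /andP[t0 t1]; split=> [[w _ e']|[->|->]].
- exact: (redge_vertex uv t0 t1 (esym e')).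
- by exists u => //; rewrite rp0.
- by exists v => //; rewrite rp1.
Qed.

Lemma redge_cover x : rverts x \/ exists2 e, redges e & e x.
Proof.
have [u [v [t [t0 t1 ->]]]] := rpt_cases x.
have [[w ->]|[a [b [s [ab s0 s1 ->]]]]] := rp_cover t0 t1; first by left; exists w.
right; exists (redge a b); last by apply/redgeP; exists s => //; rewrite !ltW.
by exists a, b; split=> //; [case/andP: ab => /nearer_adj|lra].
Qed.

Lemma redge_eq a b u v s t : adj a b -> adj u v -> 0 < t -> t < wd a b ->
  0 <= s -> s <= wd u v -> rp a b t = rp u v s -> redge a b = redge u v.
Proof.
move=> ab uv t0 t1 s0 s1 /(redge_interior ab uv t0 t1 s0 s1)[[-> ->]//|[-> ->]].
by rewrite redge_flip.
Qed.

Lemma redge_vertices a b x : adj a b -> redge a b x -> rverts x ->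
  x = rv a \/ x = rv b.
Proof.
move=> ab /redgeP[t /andP[t0 t1] ->] [w _ e].
by have [->|->] := redge_vertex ab t0 t1 (esym e); [left; rewrite rp0|right; rewrite rp1].
Qed.

Lemma redges_meet e e' : redges e -> redges e' -> e <> e' ->
  forall x, e x -> e' x -> rverts x /\ (forall y, e y -> e' y -> y = x).
Proof.
move=> [a [b [ab l0 ->]]] [u [v [uv l1 ->]]] ne.
have vert x : redge a b x -> redge u v x -> rverts x.
  move=> /redgeP[t /andP[t0 t1] ->] /redgeP[s /andP[s0 s1] e1].
  have [->|tn0] := eqVneq t 0; first by rewrite rp0; exists a.
  have [->|tn1] := eqVneq t (wd a b); first by rewrite rp1; exists b.
  case: ne; apply: (redge_eq ab uv _ _ s0 s1 e1); rewrite lt_neqAle.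
    by rewrite eq_sym tn0.
  by rewrite tn1.
move=> x ax ux; split; first exact: vert.
move=> y ay uy; apply: contrapT => yx; apply: ne.
have [vx vy] := (vert _ ax ux, vert _ ay uy).
have two p q : adj p q -> redge p q x -> redge p q y ->
    (rv p = x /\ rv q = y) \/ (rv q = x /\ rv p = y).
  move=> pq px py; have := redge_vertices pq px vx; have := redge_vertices pq py vy.
  case=> yE; case=> xE; move: yx; rewrite xE yE => yx; try by case: yx.
    by right.
  by left.
have [[p1 p2]|[p1 p2]] := two _ _ ab ax ay; have [[q1 q2]|[q1 q2]] := two _ _ uv ux uy.
- by apply: redge_ends; congruence.
- by rewrite -(redge_flip u v); apply: redge_ends; congruence.
- by rewrite -(redge_flip a b); apply: redge_ends; congruence.
- by apply: redge_ends; congruence.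
Qed.

Local Notation rgraph S := (subgraph_graph rverts redges S).

Lemma oriented_redge (S : set rpt) (uv : rpt * rpt) : oriented_edges rverts redges S uv ->
  exists a b, [/\ adj a b, 0 < wd a b, uv = (rv a, rv b) & redge a b `<=` S].
Proof.
case: uv => p q [/= vp vq pq [e [a [b [ab l0 ->]]] [ep eq eS]]].
have [pE|pE] := redge_vertices ab ep vp; have [qE|qE] := redge_vertices ab eq vq.
- by case: pq; rewrite pE qE.
- by exists a, b; rewrite pE qE.
- by exists b, a; rewrite pE qE cadjC wdC redge_flip.
- by case: pq; rewrite pE qE.
Qed.

Lemma redge_oriented (S : set rpt) a b : adj a b -> 0 < wd a b -> redge a b `<=` S ->
  oriented_edges rverts redges S (rv a, rv b).
Proof.
move=> ab l0 sub; split; [by exists a|by exists b|move=> /rv_eq; lra|].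
exists (redge a b); first by exists a, b.
by split=> //; [apply: redge_l|apply: redge_r].
Qed.

Lemma rv_joined (S : set rpt) u v :
  (forall a b, separates a b u v -> 0 < wd a b -> redge a b `<=` S) ->
  joined (Q := rgraph S) (rv u) (rv v).
Proof.
apply: (@tree_ind_to G T v (fun u =>
  (forall a b, separates a b u v -> 0 < wd a b -> redge a b `<=` S) ->
  joined (Q := rgraph S) (rv u) (rv v))) => [_|]; first exact: joined_refl.
move=> {}u u1 n IH H.
have IH' : joined (Q := rgraph S) (rv u1) (rv v).
  by apply: IH => a b s; apply: H; apply: next_separates s.
have [z0|l0] : wd u u1 = 0 \/ 0 < wd u u1 by have := wd_ge0 u u1; lra.
  by have -> : rv u = rv u1 by apply/rv_eq.
apply: (@joined_step (rgraph S) (rv u, rv u1)) => //=.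
apply: redge_oriented => //; first by rewrite cadjC (nearer_adj n).
by apply: H => //; apply: next_edge_separates.
Qed.

(** Sides are read off from distances in the realization, since one of its vertices may be the image
    of several vertices of the tree. *)
Definition side a b x : bool := mdist x (rv a) < mdist x (rv b).

Lemma side_nearer a b w : adj a b -> 0 < wd a b -> side a b (rv w) = nearer a b w.
Proof.
move=> ab l0; rewrite /side !mdist_rv; case n : (nearer a b w).
  by rewrite (wd_nearer n); apply/idP; lra.
have n' : nearer b a w by rewrite nearerP ?n // cadjC.
by rewrite (wd_nearer n') (wdC b a); apply/negP => /ltW; lra.
Qed.

Lemma side_flip a b x : adj a b -> 0 < wd a b -> rverts x -> side b a x = ~~ side a b x.
Proof.
move=> ab l0 [w _ <-]; have ba : adj b a by rewrite cadjC.
by rewrite !side_nearer // 1?wdC // nearerP.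
Qed.

Lemma side_crossing a b x y : adj a b -> 0 < wd a b ->
  oriented_edges rverts redges setT (x, y) -> side a b x -> ~~ side a b y ->
  x = rv a /\ y = rv b.
Proof.
move=> ab l0 /oriented_redge[u [v [uv _ [-> ->] _]]].
rewrite !side_nearer // => nu nv.
have nv' : nearer b a v by rewrite nearerP // cadjC.
by have [-> ->] := nearer_crossing uv nu nv'.
Qed.

(** A circuit crosses its first edge from [a] to [b] and must cross it back. As the origins are
    distinct, the edge that returns can only be the second one, which would be a backtrack. *)
Lemma rgraph_forest (S : set rpt) : is_forest (rgraph S).
Proof.
move=> n c [n0 cE ct cinj cbt].
have cET i : oriented_edges rverts redges setT (c i).
  by have [v1 v2 ne [e ee [e1 e2 _]]] := cE i; split=> //; exists e.
(* Indices are read modulo [n], so that [cc n] is the first edge again. *)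
pose cc k : 'I_n := Ordinal (ltn_pmod k n0).
have ccS k : ordS (cc k) = cc k.+1.
  by apply: val_inj => /=; rewrite -addn1 modnDml addn1.
have [a [b [ab l0 c0 _]]] := oriented_redge (cET (cc 0%N)).
have f1 : (c (cc 1%N)).1 = rv b by rewrite -ccS -[LHS]ct c0.
have step k : (c (cc k)).2 = (c (cc k.+1)).1 by rewrite -ccS; apply: ct.
have sa : side a b (rv a) by rewrite side_nearer // nearer_refl.
have sb : ~~ side a b (rv b) by rewrite side_nearer // nearerP // negbK nearer_refl // cadjC.
have key k : (k < n)%N -> ~~ side a b (c (cc k.+1)).1.
  elim: k => [|k IH] kn; first by rewrite f1.
  rewrite -step; apply/negP => sk.
  have [|||||e2 e1] := @side_crossing b a (c (cc k.+1)).1 (c (cc k.+1)).2.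
  - by rewrite cadjC.
  - by rewrite wdC.
  - by rewrite -surjective_pairing.
  - by rewrite side_flip //; [apply/IH/ltnW|case: (cET (cc k.+1))].
  - by rewrite side_flip ?negbK //; case: (cET (cc k.+1)).
  - have : cc k.+1 = cc 1%N by apply: cinj; rewrite /= e2 f1.
    move=> /(congr1 val) /=; rewrite !modn_small //; last by lia.
    move=> [k0]; move: e1 e2; rewrite k0 => e1 e2.
    case: (cbt (cc 0%N)); rewrite ccS c0 /swap /=.
    by rewrite [LHS]surjective_pairing e1 e2.
have := key n.-1; rewrite prednK // leqnn => /(_ isT).
have -> : cc n = cc 0%N by apply: val_inj; rewrite /= modnn mod0n.
by rewrite c0 sa.
Qed.

Lemma rgraph_tree : is_tree (rgraph setT).
Proof.
split; last exact: rgraph_forest.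
  by exists (rv (cbase T)); split=> //; exists (cbase T).
move=> _ _ [[u _ <-] _] [[v _ <-] _]; exact: rv_joined.
Qed.

Lemma ract_redge g a b : ract g @` redge a b = redge (g ** a) (g ** b).
Proof.
apply/seteqP; split=> z.
  move=> [_ /redgeP[t /andP[t0 t1] ->] <-]; rewrite ract_rp //; apply/redgeP.
  by exists t => //; rewrite wd_act t0.
move=> /redgeP[t]; rewrite wd_act => /andP[t0 t1] ->.
by exists (rp a b t); rewrite ?ract_rp //; apply/redgeP; exists t; rewrite ?t0.
Qed.

Lemma ract_redges g e : redges e -> redges (ract g @` e).
Proof.
move=> [a [b [ab l0 ->]]]; exists (g ** a), (g ** b).
by rewrite cadj_act wd_act ract_redge.
Qed.

Lemma ract_rverts g x : rverts x -> rverts (ract g x).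
Proof. by move=> [u _ <-]; exists (g ** u); rewrite ?ract_rv. Qed.

(** A path that leaves an edge passes through one of its ends. *)
Lemma vertex_near a b s y : adj a b -> 0 <= s -> s <= wd a b -> ~ redge a b y ->
  exists w, mdist (rv w) (rp a b s) <= mdist (rp a b s) y.
Proof.
move=> ab s0 s1 nab; have ba : adj b a by rewrite cadjC.
have near c d q w : adj c d -> 0 <= q -> q <= wd c d -> nearer c d w ->
    mdist (rv c) (rp c d q) <= mdist (rp c d q) (rv w).
  move=> cd q0 q1 n; rewrite [leRHS]metric_sym (mdist_near_side n) // mdist_rvl //.
  by have := wd_ge0 w c; lra.
have key u v t : adj u v -> 0 <= t -> t <= wd u v -> y = rp u v t ->
    forall c d q, adj c d -> 0 <= q -> q <= wd c d -> nearer c d u -> nearer c d v ->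
    mdist (rv c) (rp c d q) <= mdist (rp c d q) y.
  move=> uv t0 t1 yE c d q cd q0 q1 nu nv; rewrite [leRHS]metric_sym yE mdist_rvl //.
  have [h1 h2 h3] := mdist_rp (rp c d q) t0 t1.
  have [k1 k2 k3] := mdist_rp (rv c) t0 t1.
  rewrite (mdist_near_side nu) // (mdist_near_side nv) // in h1 h2 h3.
  rewrite !mdist_rv in k1 k2 k3.
  by have := mdist_ge0 (rp u v t) (rv c); case: k3; lra.
have [lt0 lt1] : 0 <= wd a b - s /\ wd a b - s <= wd b a by rewrite (wdC b); lra.
have [[w _ yE]|[e [u [v [uv l0 ->]]] /redgeP[t /andP[t0 t1] yE]]] := redge_cover y.
  rewrite -yE; case n : (nearer a b w).
    by exists a; apply: near.
  exists b; rewrite -(rp_flip s0 s1); apply: near => //.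
  by rewrite nearerP ?n.
have ne : ~ (u = a /\ v = b) /\ ~ (u = b /\ v = a).
  split=> -[ua vb]; subst u v; apply: nab; [|rewrite -redge_flip];
    by apply/redgeP; exists t; rewrite ?t0.
case nu : (nearer a b u); case nv : (nearer a b v).
- by exists a; apply: (key u v t).
- by case: ne => -[]; apply: (nearer_crossing uv nu); rewrite nearerP ?nv.
- case: ne => _ []; have vu : adj v u by rewrite cadjC.
  have nu' : nearer b a u by rewrite nearerP // nu.
  by have [-> ->] := nearer_crossing vu nv nu'.
- exists b; rewrite -(rp_flip s0 s1); apply: (key u v t) => //.
    by rewrite nearerP ?nu.
  by rewrite nearerP ?nv.
Qed.

Lemma wd_gap : exists2 eps : R, 0 < eps & forall u v, wd u v = 0 \/ eps <= wd u v.
Proof.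
have [eps e0 gap] := wl_gap W; exists eps => // u v.
apply: (@tree_ind_to G T v (fun u => wd u v = 0 \/ eps <= wd u v)).
  by left; rewrite wdxx.
move=> {}u u1 n IH; rewrite (wd_first n); have g := wd_ge0 u1 v.
have uu1 : adj u u1 by rewrite cadjC (nearer_adj n).
by rewrite (wd_adj uu1); case: (gap _ _ uu1) => [->|le]; [rewrite add0r|right; lra].
Qed.

Lemma cauchy_in_redge (F : set_system rpt) a b : ProperFilter F -> cauchy F ->
  F (redge a b) -> exists x, F --> x.
Proof.
move=> PF cF Fe; pose c z : R^o := mdist (rv a) z.
have lip x z : `|c x - c z| <= mdist x z.
  rewrite /c; have := metric_triangle (rv a) x z; have := metric_triangle (rv a) z x.
  by rewrite (metric_sym z) ler_norml => h1 h2; apply/andP; split; lra.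
have cG : cauchy (c @ F).
  apply: cauchy_exP => e e0; have /cauchyP/(_ e e0)[x Fx] := cF.
  exists (c x); suff : F [set z | ball (c x) e (c z)] by [].
  apply: filterS Fx => z xz; have {}xz : mdist x z < e by rewrite ballEmdist in xz.
  by rewrite /= -ball_normE /=; exact: le_lt_trans (lip _ _) xz.
have /cauchy_cvg/cvg_ex[r cr] := cG.
have near e : 0 < e -> F [set z | `|r - c z| < e].
  move=> e0; have h : F [set z | ball r e (c z)] by apply: (cvg_ball cr e0).
  by apply: filterS h => z /=; rewrite -ball_normE.
have bd e : 0 < e -> exists2 t, (0 <= t) && (t <= wd a b) & `|r - t| < e.
  move=> e0; have [z [/redgeP[t /andP[t0 t1] zE] rz]] := filter_ex (filterI Fe (near e e0)).
  by exists t; [rewrite t0|move: rz; rewrite /c /= zE mdist_rvl].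
have r0 : 0 <= r.
  rewrite leNgt; apply/negP => lt; have [|t /andP[t0 t1]] := bd (- r); first lra.
  by rewrite ltr_norml => /andP[]; lra.
have r1 : r <= wd a b.
  rewrite leNgt; apply/negP => lt; have [|t /andP[t0 t1]] := bd (r - wd a b); first lra.
  by rewrite ltr_norml => /andP[]; lra.
exists (rp a b r); apply/cvg_ballP => e e0.
apply: filterS (filterI Fe (near e e0)) => z [/redgeP[t /andP[t0 t1] ->]].
by rewrite ballEmdist /c /= mdist_rvl // mdist_same.
Qed.

(** A Cauchy filter concentrated on one edge converges by completeness of the real line. Otherwise
    each small ball that belongs to it leaves every edge, hence comes close to a vertex. Small
    distances between vertices vanish by [wd_gap], so all these vertices are one point, the
    limit. *)
Lemma rpt_complete : metric_complete (T := rpt).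
Proof.
move=> F PF cF.
have [[a [b [ab Fab]]]|nF] := pselect (exists a b, adj a b /\ F (redge a b)).
  exact: cauchy_in_redge Fab.
have cB e : 0 < e -> exists x, F (ball x e) by move=> e0; have /cauchyP/(_ e e0) := cF.
have vert x1 e : F (ball x1 e) -> exists w, mdist (rv w) x1 < 3 * e.
  move=> Fx; have [x xx] := filter_ex Fx.
  have e0 : 0 < e by move: xx; rewrite ballEmdist /=; apply: le_lt_trans; apply: mdist_ge0.
  have [[w _ wx]|[_ [a [b [ab l0 ->]]] /redgeP[s /andP[s0 s1] xE]]] := redge_cover x.
    by exists w; move: xx; rewrite wx ballEmdist /= metric_sym; lra.
  have [y [xy ny]] : exists y, ball x1 e y /\ ~ redge a b y.
    apply: contrapT => no; apply: nF; exists a, b; split=> //.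
    apply: filterS Fx => y xy; apply: contrapT => ny; apply: no; exists y.
    by split.
  have [w hw] := vertex_near ab s0 s1 ny; exists w; rewrite -xE in hw.
  move: xx xy; rewrite !ballEmdist /= => xx xy.
  have := metric_triangle (rv w) x x1; have := metric_triangle x x1 y.
  by rewrite !(metric_sym x x1); lra.
have [eps e0 gap] := wd_gap.
have [|x0 F0] := cB (eps / 16); first lra.
have [w0 hw0] := vert _ _ F0; exists (rv w0); apply/cvg_ballP => eta eta0.
(* The vertex found for a ball of radius [e] is within [3 e] of its center. With radii at most
   [eps / 16] the points [rv w0] and [rv w1] are less than [eps] apart, hence equal; [eta / 4] then
   puts the second ball within [eta] of this point. *)
pose dl := Num.min (eta / 4) (eps / 16).
have dl0 : 0 < dl by rewrite lt_min; apply/andP; split; lra.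
have dl1 : dl <= eta / 4 by rewrite ge_min lexx.
have dl2 : dl <= eps / 16 by rewrite ge_min lexx orbT.
have [x1 F1] := cB _ dl0; have [w1 hw1] := vert _ _ F1.
have [z [z0 z1]] := filter_ex (filterI F0 F1); rewrite !ballEmdist /= in z0 z1.
have w01 : rv w0 = rv w1.
  apply/rv_eq; have [//|le] := gap w0 w1; rewrite -mdist_rv in le.
  have := metric_triangle (rv w0) x0 (rv w1); have := metric_triangle x0 z (rv w1).
  have := metric_triangle z x1 (rv w1).
  by rewrite (metric_sym x1 (rv w1)) (metric_sym z x1); lra.
apply: filterS F1 => y; rewrite !ballEmdist /= w01 => xy.
by have := metric_triangle (rv w1) x1 y; lra.
Qed.

Definition realized_tree : simplicial_metric_tree R :=
  @SimplicialMetricTree R rpt rverts redges redge_metric redge_cover redges_meet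
    rgraph_tree (@rpt_path_metric R G W) rpt_complete.

Definition realize : gtree R G :=
  @GTree R G realized_tree (@ract R G W) (@ract1 R G W) (@ractM R G W)
    (@mdist_ract R G W) ract_rverts ract_redges.

End RealizedGTree.

(** * Realizations that belong to the outer space *)

Section OuterRealization.
Context {R : realType} {p : nat} {Gi : 'I_p -> groupType} {G : groupType}.
Context (iota : forall i, group_hom (Gi i) G).

Definition tstab (T : ctree G) (u : T) : set G := [set g | cact g u = u].

Definition nonfree (T : ctree G) (u : T) : Prop := exists2 g, tstab u g & g <> 1%g.

Definition factor_conj (i : 'I_p) (A : set G) : Prop :=
  conjugacy_class (range (iota i)) A.

(** The conditions on stabilizers only, as minimality and redundancy depend on which edges are
    collapsed. An edge of a [gtree] is stabilized as a set, so the triviality of edge stabilizers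
    splits into [oc_edge] and [oc_inversion]. *)
Record outer_ctree (T : ctree G) : Prop := OuterCTree {
  oc_edge : forall (u v : T) g, cadj u v -> cact g u = u -> cact g v = v -> g = 1%g;
  oc_inversion : forall (u v : T) g, cadj u v -> cact g u = v -> cact g v <> u;
  oc_factor : forall i, exists2 v : T, factor_conj i (tstab v) &
    forall w : T, factor_conj i (tstab w) -> exists g, cact g v = w;
  oc_free : forall v : T, (forall i, ~ factor_conj i (tstab v)) -> ~ nonfree v
}.

Lemma redge_inj (W : wtree R G) (a b u v : W) : cadj a b -> cadj u v ->
  0 < wd a b -> redge a b = redge u v -> (u = a /\ v = b) \/ (u = b /\ v = a).
Proof.
move=> ab uv l0 e.
have : redge a b (rp a b (wd a b / 2)).
  by apply/redgeP; exists (wd a b / 2) => //; apply/andP; split; lra.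
rewrite e => /redgeP[s /andP[s0 s1] e'].
by apply: (redge_interior ab uv _ _ s0 s1 e'); lra.
Qed.

Lemma joined_crosses (W : wtree R G) (S : set (rpt W)) (a b : W) x y :
  cadj a b -> 0 < wd a b ->
  @joined (subgraph_graph (@rverts R G W) (@redges R G W) S) x y ->
  side a b x -> ~~ side a b y -> redge a b `<=` S.
Proof.
move=> ab l0; elim=> {x y} [x|[x z] y exz _ IH sx sy]; first by move=> ->.
case sz : (side a b z); first exact: IH.
have [u [v [uv l1 xuzv sub]]] := oriented_redge exz; case: xuzv => xu zv.
have oxz : oriented_edges (@rverts R G W) (@redges R G W) setT (x, z).
  by case: exz => v1 v2 ne [e ee [e1 e2 _]]; split=> //; exists e.
have [xa zb] := side_crossing ab l0 oxz sx (negbT sz).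
by rewrite (@redge_ends _ _ _ a b u v) // -?xu -?zv ?xa ?zb.
Qed.

Context (W : wtree R G).
Local Notation T := (wt W).
Implicit Types (u v w a b : T) (g h : G).

Lemma rv_stab v : stabilizer (T := realize W) (rv v) = [set g | wd v (cact g v) = 0].
Proof.
apply/seteqP; split=> g /=; rewrite /stabilizer /= ract_rv.
  by move=> e; apply/rv_eq.
by move=> e; apply/esym/rv_eq.
Qed.

Hypothesis hOC : outer_ctree T.

Lemma redge_stab a b : cadj a b -> 0 < wd a b ->
  edge_stabilizer (T := realize W) (redge a b) = [set 1%g].
Proof.
move=> ab l0; apply/seteqP; split=> g /=; rewrite /edge_stabilizer /= ?ract_redge.
  move=> /redge_inj; rewrite cadj_act wd_act => /(_ ab ab l0)[[e1 e2]|[e1 e2]].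
    by apply: (oc_edge hOC ab).
  by case: (oc_inversion hOC ab (esym e2)).
by move=> ->; rewrite !cact1.
Qed.

Hypothesis hull : forall w a b, cadj a b -> 0 < wd a b ->
  exists g h, separates a b (cact g w) (cact h w).

Lemma realize_minimal : minimal_action (realize W).
Proof.
move=> S [_ [[_ [[w _ <-] Sw]] Sj _]] Sinv.
have edge a b : cadj a b -> 0 < wd a b -> redge a b `<=` S.
  move=> ab l0; have [g [h /andP[s1 s2]]] := hull w ab l0.
  apply: (@joined_crosses _ S a b (rv (cact g w)) (rv (cact h w)) ab l0).
  - have orb k : (@rverts R G W `&` S) (rv (cact k w)).
      by split; [exists (cact k w)|rewrite -ract_rv; apply: (Sinv k)].
    apply: Sj; [exact: (orb g)|exact: (orb h)].
  - by rewrite side_nearer.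
  - by rewrite side_nearer // nearerP // negbK.
apply/seteqP; split=> // x _.
have [[v _ <-]|[e [a [b [ab l0 ->]]] ex]] := @redge_cover R G W x; last exact: edge ex.
have : joined (Q := subgraph_graph (@rverts R G W) (@redges R G W) setT) (rv v) (rv w).
  exact: rv_joined.
move e1 : (rv v) => x1; move e2 : (rv w) => x2 j.
case: j e1 e2 => [y _ <- //|[y z] x' /oriented_redge[a [b [ab l0 /= [-> ->] _]]] _ _ _].
exact/(edge a b)/redge_l.
Qed.

(** The vertices at distance 0 from [v] become one point. This makes its stabilizer that of a
    nonfree vertex among them if there is one, and trivial otherwise. *)
Hypothesis stab_move : forall v g, wd v (cact g v) = 0 ->
  nonfree v \/ (forall u, wd v u = 0 -> ~ nonfree u) -> cact g v = v.
(** It excludes redundancy at a free point of the realization: either no edge of positive length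
    leaves its class, or at least three do. *)
Hypothesis degree3 : forall v, (forall u, wd v u = 0 -> ~ nonfree u) ->
  (forall a b, cadj a b -> wd v a = 0 -> wd a b = 0) \/
  exists a1 b1 a2 b2 a3 b3,
    [/\ [/\ cadj a1 b1, wd v a1 = 0 & 0 < wd a1 b1],
        [/\ cadj a2 b2, wd v a2 = 0 & 0 < wd a2 b2],
        [/\ cadj a3 b3, wd v a3 = 0 & 0 < wd a3 b3] &
        [/\ (a1, b1) <> (a2, b2), (a2, b2) <> (a3, b3) & (a1, b1) <> (a3, b3)]].
Hypothesis factors_nontrivial : forall i, exists c, iota i c <> 1%g.

Lemma factor_conj_nontrivial i A : factor_conj i A -> exists2 g, A g & g <> 1%g.
Proof.
move=> [g _ <-]; have [a a1] := factors_nontrivial i; exists (iota i a ^ g)%g.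
  by exists (iota i a) => //; exists a.
by move=> /(congr1 (fun x => x ^ g^-1)%g); rewrite conjgK conj1g.
Qed.

Lemma rv_cases x : (@rverts R G W) x ->
  (exists v, [/\ x = rv v, nonfree v & stabilizer (T := realize W) x = tstab v]) \/
  (exists v, [/\ x = rv v, (forall u, wd v u = 0 -> ~ nonfree u) &
                 stabilizer (T := realize W) x = [set 1%g]]).
Proof.
move=> [v _ <-].
have [[u [vu nu]]|none] := pselect (exists u, wd v u = 0 /\ nonfree u).
  left; exists u; have e : rv v = rv u by apply/rv_eq.
  split=> //; rewrite e rv_stab; apply/seteqP; split=> g /=.
    by move=> h; apply: stab_move h _; left.
  by rewrite /tstab /= => ->; rewrite wdxx.
have free u : wd v u = 0 -> ~ nonfree u by move=> vu nu; apply: none; exists u.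
right; exists v; split=> //; rewrite rv_stab; apply/seteqP; split=> g /=.
  move=> h; have e := stab_move h (or_intror free).
  by apply: contrapT => g1; apply: (free v); [rewrite wdxx|exists g].
by move=> ->; rewrite cact1 wdxx.
Qed.

Lemma realize_outer : outer_space iota (realize W).
Proof.
split.
- move=> x [vx [e1 [e2 [_ /seteqP[sub sup]]]] fixes].
  have [[v [xv [g sg g1] st]]|[v [xv free st]]] := rv_cases vx.
    have [ee1 e1x] : edges (s := realize W) e1 /\ e1 x by apply: sup; left.
    have {}fixes := fixes g _ e1 ee1 e1x; case: ee1 fixes => [a [b [ab l0 ->]]].
    by rewrite redge_stab //= => h; apply/g1/h; rewrite st.
  have [none|[a1 [b1 [a2 [b2 [a3 [b3 [[h1 v1 l1] [h2 v2 l2] [h3 v3 l3] [n12 n23 n13]]]]]]]]] := degree3 free.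
    have [[a [b [ab l0 ->]]] ex] : edges (s := realize W) e1 /\ e1 x by apply: sup; left.
    have [xa|xb] := redge_vertices ab ex vx.
      by have := none a b ab; rewrite -(rv_eq v a) -xa xv => /(_ erefl); lra.
    have := none b a; rewrite cadjC -(rv_eq v b) -xb xv => /(_ ab erefl).
    by rewrite wdC; lra.
  have two a b : cadj a b -> wd v a = 0 -> 0 < wd a b -> redge a b = e1 \/ redge a b = e2.
    move=> ab va l0; apply: sub; split; first by exists a, b.
    by rewrite xv (_ : rv v = rv a); [apply: redge_l|apply/rv_eq].
  have dist a b a' b' : cadj a b -> wd v a = 0 -> 0 < wd a b ->
      cadj a' b' -> wd v a' = 0 -> (a, b) <> (a', b') -> redge a b <> redge a' b'.
    move=> ab va l0 ab' va' ne e.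
    have [[aE bE]|[aE bE]] := redge_inj ab ab' l0 e; subst a' b'; first by [].
    by have := wd_tri v a b; rewrite (wdC a v); lra.
  have := dist _ _ _ _ h1 v1 l1 h2 v2 n12.
  have := dist _ _ _ _ h2 v2 l2 h3 v3 n23.
  have := dist _ _ _ _ h1 v1 l1 h3 v3 n13.
  by case: (two _ _ h1 v1 l1) (two _ _ h2 v2 l2) (two _ _ h3 v3 l3) => -> [] -> [] ->.
- by split; [exact: realize_minimal|move=> e [a [b [ab l0 ->]]]; exact: redge_stab].
- move=> i; have [v fv uniq] := oc_factor hOC i.
  have nv : nonfree v by have [g vg g1] := factor_conj_nontrivial fv; exists g.
  have stab u : nonfree u -> stabilizer (T := realize W) (rv u) = tstab u.
    move=> nu; rewrite rv_stab; apply/seteqP; split=> g /=.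
      by move=> h; apply: stab_move h _; left.
    by rewrite /tstab /= => ->; rewrite wdxx.
  exists (rv v); split; first by exists v.
    by rewrite stab.
  move=> x vx; have [[u [-> _ ->]]|[u [_ _ ->]]] := rv_cases vx.
    by move=> /uniq[g <-]; exists g => //; rewrite /= ract_rv.
  by move=> /factor_conj_nontrivial[g /= ->].
- move=> x vx nf; split=> //; have [[u [xu nu st]]|[u [_ _ //]]] := rv_cases vx.
  exfalso; apply: (oc_free hOC) nu => i; rewrite -st; exact: nf.
Qed.

End OuterRealization.

(** * Cocycles on free products *)

Lemma mk_hom (A B : groupType) (f : A -> B) :
  {morph f : x y / (x * y)%g} -> {phi : group_hom A B | phi =1 f}.
Proof.
move=> fM; have f1 : f 1%g = 1%g by apply: (@mulgI _ (f 1%g)); rewrite -fM !mulg1.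
have fF : {morph f : x y / (x / y)%g}.
  by move=> x y; rewrite fM; congr (_ * _)%g; apply: (@mulgI _ (f y)); rewrite -fM !mulgV f1.
pose phi : group_hom A B :=
  HB.pack_for (group_hom A B) f (isGroupMorphism.Build A B f fF).
by exists phi.
Qed.

Record gset (G : groupType) := GSet {
  gcarrier :> Type;
  gact : G -> gcarrier -> gcarrier;
  gact1 : forall x, gact 1%g x = x;
  gactM : forall g h x, gact (g * h)%g x = gact g (gact h x)
}.

(* [(X -> bool) x| G]: homomorphisms from [G] to it over [G] are cocycles
   with values in the functions modulo 2 on [X]. *)
Section SemidirectProduct.
Context {G : groupType} (X : gset G).

Definition sdprod : Type := ((X -> bool) * G)%type.
HB.instance Definition _ := Choice.on sdprod.
Definition sdone : sdprod := (fun=> false, 1%g).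
Definition sdmul (a b : sdprod) : sdprod :=
  (fun x => a.1 x (+) b.1 (gact a.2^-1 x), (a.2 * b.2)%g).
Definition sdinv (a : sdprod) : sdprod := (fun x => a.1 (gact a.2 x), a.2^-1%g).

Fact sdmulA : associative sdmul.
Proof.
move=> a b c; congr pair; last exact: mulgA.
by apply/funext => x /=; rewrite invgM gactM addbA.
Qed.
Fact sdmul1g : left_id sdone sdmul.
Proof. by move=> [m g]; congr pair; rewrite /= ?mul1g //; apply/funext => x; rewrite invg1 gact1. Qed.
Fact sdmulg1 : right_id sdone sdmul.
Proof. by move=> [m g]; congr pair; rewrite /= ?mulg1 //; apply/funext => x; rewrite addbF. Qed.
Fact sdmulVg : left_inverse sdone sdinv sdmul.
Proof.
move=> [m g]; congr pair; rewrite /= ?mulVg //; apply/funext => x.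
by rewrite invgK addbb.
Qed.
Fact sdmulgV : right_inverse sdone sdinv sdmul.
Proof.
move=> [m g]; congr pair; rewrite /= ?mulgV //; apply/funext => x.
by rewrite -gactM mulgV gact1 addbb.
Qed.
HB.instance Definition _ := isGroup.Build sdprod sdmulA sdmul1g sdmulg1 sdmulVg sdmulgV.

Definition cocycle (m : G -> X -> bool) : Prop :=
  forall g h x, m (g * h)%g x = m g x (+) m h (gact g^-1 x).

Lemma cocycle1 m : cocycle m -> m 1%g = fun=> false.
Proof.
move=> mM; apply/funext => x; have := mM 1%g 1%g x.
by rewrite mulg1 invg1 gact1 addbb.
Qed.

End SemidirectProduct.

Section FreeProduct.
Context {p k : nat} {Gi : 'I_p -> groupType} {G : groupType}.
Context {iota : forall i, group_hom (Gi i) G} {b : 'I_k -> G}.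
Hypothesis hG : is_free_product iota b.

Lemma free_product_ext (H : groupType) (f f' : group_hom G H) :
  (forall i a, f (iota i a) = f' (iota i a)) -> (forall j, f (b j) = f' (b j)) ->
  f =1 f'.
Proof.
move=> fi fb; have Mi i : {morph f \o iota i : x y / (x * y)%g}.
  by move=> x y /=; rewrite !gmulfM.
pose phi i := sval (mk_hom (Mi i)); have phiE i : phi i =1 f \o iota i := svalP (mk_hom (Mi i)).
have [psi [_ uniq]] := hG phi (f \o b).
have e1 : f =1 psi by apply: uniq => // i a; rewrite phiE.
have e2 : f' =1 psi by apply: uniq => [i a|j]; rewrite ?phiE /= ?fi ?fb.
by move=> g; rewrite e1 e2.
Qed.

Lemma cocycle_ext (X : gset G) (m m' : G -> X -> bool) : cocycle m -> cocycle m' ->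
  (forall i a, m (iota i a) = m' (iota i a)) -> (forall j, m (b j) = m' (b j)) ->
  m =1 m'.
Proof.
have hom (n : G -> X -> bool) : cocycle n -> {morph (fun g => (n g, g) : sdprod X) : x y / (x * y)%g}.
  by move=> nM x y; congr pair; apply/funext => z; apply: nM.
move=> cm cm' ei eb g.
have e := svalP (mk_hom (hom _ cm)); have e' := svalP (mk_hom (hom _ cm')).
have := @free_product_ext (sdprod X) (sval (mk_hom (hom _ cm))) (sval (mk_hom (hom _ cm'))).
move=> h; have [] : (m g, g) = (m' g, g) :> sdprod X; last by [].
by rewrite -e -e'; apply: h => [i a|j]; rewrite e e' ?ei ?eb.
Qed.

(** The prescribed values define a homomorphism to the semidirect product; its second component is
    the identity because it is so on the generators. *)
Lemma cocycle_exists (X : gset G) (mi : forall i, Gi i -> X -> bool) (mb : 'I_k -> X -> bool) :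
  (forall i a c x, mi i (a * c)%g x = mi i a x (+) mi i c (gact (iota i a)^-1%g x)) ->
  exists m : G -> X -> bool, [/\ cocycle m, forall i a, m (iota i a) = mi i a
    & forall j, m (b j) = mb j].
Proof.
move=> miM.
have Mi i : {morph (fun a => (mi i a, iota i a) : sdprod X) : x y / (x * y)%g}.
  by move=> x y; congr pair; [apply/funext => z; apply: miM|rewrite gmulfM].
pose phi i := sval (mk_hom (Mi i)).
have phiE i : phi i =1 _ := svalP (mk_hom (Mi i)).
have [psi [[pi pb] _]] := hG phi (fun j => (mb j, b j) : sdprod X).
have M2 : {morph (fun g => (psi g).2) : x y / (x * y)%g} by move=> x y; rewrite gmulfM.
have Mid : {morph (fun g : G => g) : x y / (x * y)%g} by [].
have psi2 g : (psi g).2 = g.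
  rewrite -(svalP (mk_hom M2) g) -[RHS](svalP (mk_hom Mid) g).
  apply: free_product_ext => [i a|j]; rewrite (svalP (mk_hom M2)) (svalP (mk_hom Mid)).
    by rewrite pi phiE.
  by rewrite pb.
exists (fun g => (psi g).1); split=> [g h x|i a|j].
- by rewrite gmulfM /= psi2.
- by rewrite pi phiE.
- by rewrite pb.
Qed.

Definition left_gset (Y : Type) : gset G :=
  @GSet G (G * Y)%type (fun g x => ((g * x.1)%g, x.2))
    (fun x => eq_ind_r (fun z => (z, x.2) = x) (esym (surjective_pairing x)) (mul1g x.1))
    (fun g h x => congr1 (fun z => (z, x.2)) (esym (mulgA g h x.1))).

Lemma free_product_generated (K : set G) : K 1%g ->
  (forall g h, K g -> K h -> K (g * h)%g) -> (forall g, K g -> K g^-1%g) ->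
  (forall i a, K (iota i a)) -> (forall j, K (b j)) -> forall g, K g.
Proof.
move=> K1 KM KV Ki Kb g.
pose m g (x : left_gset unit) := `[< K x.1 >] (+) `[< K (g^-1 * x.1)%g >].
have mc : cocycle m.
  move=> u v x; rewrite /m /= invgM mulgA addbA; congr (_ (+) _).
  by rewrite -addbA addbb addbF.
have K0 h : K h -> m h = fun=> false.
  move=> Kh; apply/funext => -[x []]; rewrite /m /=.
  have -> : `[< K (h^-1 * x)%g >] = `[< K x >]; last exact: addbb.
  apply: asbool_equiv_eq; split=> [Kx|Kx]; last by apply: KM => //; apply: KV.
  by rewrite -[x]mul1g -(mulgV h) -mulgA; apply: KM.
have m0 : cocycle (fun (_ : G) (_ : left_gset unit) => false) by [].
have := cocycle_ext mc m0 (fun i a => K0 _ (Ki i a)) (fun j => K0 _ (Kb j)).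
move=> /(_ g) /(congr1 (fun f => f (1%g, tt))); rewrite /m /= mulg1.
have -> : `[< K 1%g >] = true by apply/asboolP.
by move=> /negbFE/asboolP /KV; rewrite invgK.
Qed.

Lemma factor_retraction i : exists r : group_hom G (Gi i),
  (forall a, r (iota i a) = a) /\ (forall j a, j != i -> r (iota j a) = 1%g).
Proof.
pose cast j (e : j = i) (a : Gi j) : Gi i := ecast j (Gi j) e a.
pose f j (a : Gi j) : Gi i := if j =P i is ReflectT e then cast j e a else 1%g.
have fM j : {morph f j : x y / (x * y)%g}.
  rewrite /f; case: eqP => [e|_] x y; last by rewrite mulg1.
  by subst i.
pose phi j := sval (mk_hom (fM j)); have phiE j : phi j =1 f j := svalP (mk_hom (fM j)).
have [r [[ri _] _]] := hG phi (fun=> 1%g).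
exists r; split=> [a|j a ji]; rewrite ri phiE /f; case: eqP => // e.
  by rewrite /cast (eq_irrelevance e erefl).
by rewrite e eqxx in ji.
Qed.

Lemma iota_inj i a : iota i a = 1%g -> a = 1%g.
Proof.
by have [r [ri _]] := factor_retraction i; move=> e; rewrite -(ri a) e gmulf1.
Qed.

Hypothesis hGi : forall i, exists a : Gi i, a <> 1%g.

Lemma iota_nontrivial i : exists a, iota i a <> 1%g.
Proof. by have [a a1] := hGi i; exists a => /iota_inj. Qed.

Lemma factor_conj_inj i j g : factor_conj iota i (conjugate_set (range (iota j)) g) -> j = i.
Proof.
move=> [h _ e]; apply/eqP/negPn/negP => ji.
have [r [ri rj]] := factor_retraction i; have [a a1] := hGi i.
have : conjugate_set (range (iota i)) h (iota i a ^ h)%g by exists (iota i a) => //; exists a.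
rewrite e => -[_ [c _ <-] ec].
have := congr1 r ec; rewrite !gmulfJ ri rj // conj1g => /(congr1 (fun x => x ^ (r h)^-1)%g).
by rewrite conjgK conj1g => /esym.
Qed.

End FreeProduct.

Lemma walk_redp (V : eqType) (adj : rel V) u p : symmetric adj -> path adj u p ->
  exists q, redp adj u q && (last u q == last u p).
Proof.
move=> adjC; elim: p u => [|a p IH] u; first by move=> _; exists [::]; rewrite eqxx.
move=> /= /andP[ua /IH[q /andP[rq lq]]].
case: q rq lq => [|z q] rq lq; first by exists [:: a]; rewrite redp_cons ua.
have [zu|zu] := eqVneq z u; last by exists [:: a, z & q]; rewrite redp_cons ua zu rq.
by exists q; move: rq lq; rewrite redp_cons zu => /and3P[_ _ ->].
Qed.

(** A closed path must cross its first edge once more. If it does so in the same direction, a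
    shorter nonempty path is closed, against induction. If it crosses back, the part in between is
    closed, hence empty, and the path backtracks. *)
Lemma bridges_acyclic (V : eqType) (adj : rel V) :
  (forall u a, adj u a -> exists f : V -> bool, f u != f a /\
     forall y z, adj y z -> f y != f z -> (y = u /\ z = a) \/ (y = a /\ z = u)) ->
  forall u p, redp adj u p -> last u p = u -> p = [::].
Proof.
move=> bridge u p; move e: (size p) => n.
elim/ltn_ind: n u p e => n IH u [//|a q] sz r l.
have /and3P[ua _ rq] : [&& adj u a, (if q is z :: _ then z != u else true) & redp adj a q].
  by rewrite -redp_cons.
have [f [fua cut]] := bridge u a ua.
have [q1 [z [q2 [qE fz]]]] : exists q1 z q2, q = q1 ++ z :: q2 /\ f (last a q1) != f z.
  have : f a != f (last a q) by rewrite eq_sym -[last a q]/(last u (a :: q)) l.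
  elim: (q) (a) => [|z q' IHq] y; first by rewrite eqxx.
  have [fyz|fyz] := eqVneq (f y) (f z); last by move=> _; exists [::], z, q'.
  rewrite fyz => /= /IHq[q1 [z' [q2 [-> h]]]].
  by exists (z :: q1), z', q2.
have /andP[rq1 rz] : redp adj a q1 && redp adj (last a q1) (z :: q2).
  by apply: redp_split; rewrite -qE.
have adjz : adj (last a q1) z by move: rz; rewrite redp_cons => /and3P[].
have small (s : seq V) : (size s <= size q)%N -> redp adj a s -> last a s = a -> s = [::].
  by move=> ss; apply: (IH (size s)); rewrite // -sz /=; lia.
have [[y1 za]|[y1 zu]] := cut _ _ adjz fz.
  have := small (rcons q1 z); rewrite last_rcons size_rcons => h.
  suff : rcons q1 z = [::] by case: (q1).
  apply: h => //; first by rewrite qE size_cat /=; lia.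
  have : redp adj a (rcons q1 z ++ q2) by rewrite cat_rcons -qE.
  by case/redp_split/andP.
have q10 : q1 = [::] by apply: small; rewrite // qE size_cat; lia.
by move: r; rewrite qE q10 [_ ++ _]/= zu redp_cons eqxx andbF.
Qed.

Lemma nearer_cut (G : groupType) (T : ctree G) (a b x : T) (f : T -> bool) : cadj a b ->
  f a != f b ->
  (forall y z : T, cadj y z -> f y != f z -> (y = a /\ z = b) \/ (y = b /\ z = a)) ->
  nearer a b x = (f x == f a).
Proof.
move=> ab fab cut; apply/esym; move: x; apply: (@tree_ind_to G T a (fun x => (f x == f a) = nearer a b x)).
  by rewrite eqxx nearer_refl.
move=> x y n IH; have xy : cadj x y by rewrite cadjC (nearer_adj n).
have [fxy|fxy] := eqVneq (f x) (f y).
  have ba : cadj b a by rewrite cadjC.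
  rewrite fxy IH; case ny : (nearer a b y); case nx : (nearer a b x) => //.
    have nx' : nearer b a x by rewrite nearerP ?nx.
    have [e1 e2] := nearer_crossing (nearer_adj n) ny nx'.
    by rewrite e1 e2 in fxy; rewrite fxy eqxx in fab.
  have ny' : nearer b a y by rewrite nearerP ?ny.
  have [e1 e2] := nearer_crossing xy nx ny'.
  by rewrite e1 e2 in fxy; rewrite fxy eqxx in fab.
have [[xa yb]|[xb ya]] := cut _ _ xy fxy; subst x y; first by rewrite eqxx nearer_refl.
by rewrite eq_sym (negPf fab) nearerP // nearer_refl // cadjC.
Qed.

(** * The Bass-Serre tree of the free product *)

Section BaseTree.
Context {p k : nat} {Gi : 'I_p -> groupType} {G : groupType}.
Context {iota : forall i, group_hom (Gi i) G} {b : 'I_k -> G}.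
Hypothesis hG : is_free_product iota b.
Hypothesis hGi : forall i, exists a : Gi i, a <> 1%g.

Definition vgroup (o : option 'I_p) : set G :=
  if o is Some i then range (iota i) else [set 1%g].

Lemma vgroup1 o : vgroup o 1%g.
Proof. by case: o => [i|] //=; exists 1%g; rewrite ?gmulf1. Qed.

Lemma vgroupM o g h : vgroup o g -> vgroup o h -> vgroup o (g * h)%g.
Proof.
case: o => [i|] /=; last by move=> -> ->; rewrite mulg1.
by move=> [a _ <-] [c _ <-]; exists (a * c)%g; rewrite ?gmulfM.
Qed.

Lemma vgroupV o g : vgroup o g -> vgroup o g^-1%g.
Proof.
case: o => [i|] /=; last by move=> ->; rewrite invg1.
by move=> [a _ <-]; exists (a^-1)%g; rewrite ?gmulfV.
Qed.

Definition coset (o : option 'I_p) (g : G) : set G := [set h | vgroup o (g^-1 * h)%g].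

Lemma cosetP o g h : coset o g = coset o h <-> vgroup o (g^-1 * h)%g.
Proof.
split=> [e|gh].
  have : coset o h h by rewrite /coset /= mulVg; apply: vgroup1.
  by rewrite -e.
apply/seteqP; split=> x /=; rewrite /coset /= => gx.
  have -> : (h^-1 * x = (g^-1 * h)^-1 * (g^-1 * x))%g.
    by rewrite invgM invgK -mulgA mulVKg.
  by apply: vgroupM => //; apply: vgroupV.
have -> : (g^-1 * x = (g^-1 * h) * (h^-1 * x))%g by rewrite -mulgA mulVKg.
exact: vgroupM.
Qed.

Lemma coset_mul o g h : [set (g * x)%g | x in coset o h] = coset o (g * h)%g.
Proof.
apply/seteqP; split=> [_ [x hx <-]|x]; rewrite /coset /= invgM -mulgA ?mulKg //.
by move=> hx; exists (g^-1 * x)%g; rewrite // mulVKg.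
Qed.

Definition bvertex : Type :=
  {x : option 'I_p * set G | `[< exists g, x.2 = coset x.1 g >]}.
HB.instance Definition _ := Choice.on bvertex.

Fact bv_subproof o g : `[< exists h, (o, coset o g).2 = coset (o, coset o g).1 h >].
Proof. by apply/asboolP; exists g. Qed.

Definition bv o g : bvertex := exist _ (o, coset o g) (bv_subproof o g).

Lemma bvP (v : bvertex) : exists o g, v = bv o g.
Proof.
case: v => -[q C] /= h; have [g e] := asboolW h; exists q, g.
by apply: val_inj => /=; rewrite -e.
Qed.

Lemma bv_eq o g o' g' : bv o g = bv o' g' <-> o = o' /\ vgroup o (g^-1 * g')%g.
Proof.
split=> [/(congr1 val) /= [eo h]|[<- h]]; last first.
  by apply: val_inj => /=; congr pair; apply/cosetP.
by subst o'; split=> //; apply/cosetP.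
Qed.

Fact bact_subproof g (v : bvertex) :
  `[< exists h, ((val v).1, [set (g * x)%g | x in (val v).2]).2 =
        coset ((val v).1, [set (g * x)%g | x in (val v).2]).1 h >].
Proof.
apply/asboolP; have [q [h ->]] := bvP v.
by exists (g * h)%g; rewrite /= coset_mul.
Qed.

Definition bact g (v : bvertex) : bvertex :=
  exist _ ((val v).1, [set (g * x)%g | x in (val v).2]) (bact_subproof g v).

Lemma bact_bv g o h : bact g (bv o h) = bv o (g * h)%g.
Proof. by apply: val_inj => /=; rewrite coset_mul. Qed.

Lemma bact1 v : bact 1%g v = v.
Proof. by have [q [h ->]] := bvP v; rewrite bact_bv mul1g. Qed.

Lemma bactM g h v : bact (g * h)%g v = bact g (bact h v).
Proof. by have [q [x ->]] := bvP v; rewrite !bact_bv mulgA. Qed.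

Definition elabel : Type := left_gset (G := G) ('I_p + 'I_k)%type.

(* The edge with label [(g, t)] joins the vertex [g] to the vertex [g Gi] or
   to the vertex [g b_j]. *)
Definition tgt (x : elabel) : bvertex := match x.2 with
  | inl i => bv (Some i) x.1
  | inr j => bv None (x.1 * b j)%g end.

Definition src (x : elabel) : bvertex := bv None x.1.

Definition badj (u v : bvertex) : bool :=
  `[< exists x, (u = src x /\ v = tgt x) \/ (v = src x /\ u = tgt x) >].

Lemma badj_sym : symmetric badj.
Proof.
move=> u v; apply: asbool_equiv_eq.
by split=> -[x [[? ?]|[? ?]]]; exists x; by [left|right].
Qed.

Lemma src_act g x : bact g (src x) = src (gact g x).
Proof. by rewrite /src bact_bv. Qed.

Lemma tgt_act g x : bact g (tgt x) = tgt (gact g x).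
Proof. by case: x => h [i|j]; rewrite /tgt /= bact_bv // mulgA. Qed.

Lemma badj_act g u v : badj (bact g u) (bact g v) = badj u v.
Proof.
have imp h x y : badj x y -> badj (bact h x) (bact h y).
  move=> /asboolP[e xy]; apply/asboolP; exists (gact h e).
  by rewrite -src_act -tgt_act; case: xy => -[-> ->]; [left|right].
apply/idP/idP; last exact: imp.
by move=> /(imp g^-1%g); rewrite -!bactM mulVg !bact1.
Qed.

(* The parity, for every edge, of the number of crossings of that edge by a
   path from a base point to a vertex. *)
Lemma potential_exists : exists P : bvertex -> elabel -> bool,
  (forall e x, P (src e) x (+) P (tgt e) x = `[< x = e >]) /\
  (exists m, [/\ cocycle (X := left_gset (G := G) ('I_p + 'I_k)) m,
     forall g, m g = P (bv None g),
     forall i a x, m (iota i a) x = `[< x = (1%g, inl i) >] (+) `[< x = (iota i a, inl i) >] &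
     forall j x, m (b j) x = `[< x = (1%g, inr j) >] ]) /\
  (forall i g x, P (bv (Some i) g) x = P (bv None g) x (+) `[< x = (g, inl i) >]).
Proof.
pose dl (e x : elabel) := `[< x = e >].
have dlM g e x : dl e (gact g^-1%g x) = dl (gact g e) x.
  apply: asbool_equiv_eq; split=> [<-|->]; first by rewrite -gactM mulgV gact1.
  by rewrite -gactM mulVg gact1.
(* The path from the vertex [1] to the vertex [iota i a] passes through the vertex of the factor and
   crosses the edges labelled [(1, i)] and [(iota i a, i)]; the path to [b j] is a single edge. *)
have [|m [mM mi mb]] := @cocycle_exists _ _ _ _ _ _ hG (left_gset ('I_p + 'I_k))
  (fun i a x => dl (1%g, inl i) x (+) dl (iota i a, inl i) x)
  (fun j x => dl (1%g, inr j) x).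
  move=> i a c x; rewrite !dlM /= mulg1 gmulfM.
  by rewrite addbA -[in RHS](addbA (dl (1%g, inl i) x)) addbb addbF.
pose Q o g x := if o is Some i then m g x (+) dl (g, inl i) x else m g x.
have Qwd o g h x : vgroup o (g^-1 * h)%g -> Q o g x = Q o h x.
  case: o => [i|] /=; last first.
    by move=> e; rewrite -[h](mulVKg g) e mulg1.
  move=> [a _ e]; rewrite -[h](mulVKg g) -e mM mi !dlM /= mulg1.
  by rewrite addbA -addbA addbb addbF.
pose P v := let w := cid (bvP v) in Q (projT1 w) (projT1 (cid (projT2 w))).
have PE o g : P (bv o g) = Q o g.
  rewrite /P; case: cid => o' h' /=; case: cid => g' /= e.
  move/bv_eq: e => [eo h]; apply/funext => x; rewrite -eo.
  exact/esym/Qwd.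
exists P; split; last split.
- case=> g [i|j] x; rewrite /src /tgt /= !PE /=; first by rewrite addbA addbb.
  by rewrite mM mb dlM /= mulg1 addbA addbb.
- exists m; split=> [//|g|i a x|j x]; rewrite ?PE ?mi ?mb //.
- by move=> i g x; rewrite !PE.
Qed.

End BaseTree.

Lemma separates_flip (G : groupType) (T : ctree G) (a b x y : T) :
  separates b a x y = separates a b y x.
Proof. by rewrite /separates andbC. Qed.

(** * A point of the outer space *)

Section BaseCTree.
Context {R : realType} {p k : nat} {Gi : 'I_p -> groupType} {G : groupType}.
Context {iota : forall i, group_hom (Gi i) G} {b : 'I_k -> G}.
Hypothesis hG : is_free_product iota b.
Hypothesis hGi : forall i, exists a : Gi i, a <> 1%g.
Local Notation bvertex := (@bvertex p Gi G iota).
Local Notation bv := (@bv p Gi G iota).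
Local Notation src := (@src p k Gi G iota).
Local Notation tgt := (@tgt p k Gi G iota b).
Local Notation badj := (@badj p k Gi G iota b).
Local Notation X := (left_gset (G := G) ('I_p + 'I_k)).

Variables (P : bvertex -> X -> bool) (m : G -> X -> bool).
Hypothesis PE : forall e x, P (src e) x (+) P (tgt e) x = `[< x = e >].
Hypothesis mC : cocycle m.
Hypothesis mP : forall g, m g = P (bv None g).
Hypothesis mi : forall i a x,
  m (iota i a) x = `[< x = (1%g, inl i) >] (+) `[< x = (iota i a, inl i) >].
Hypothesis mb : forall j x, m (b j) x = `[< x = (1%g, inr j) >].
Hypothesis Pi : forall i g x,
  P (bv (Some i) g) x = P (bv None g) x (+) `[< x = (g, inl i) >].

Lemma P_edge e : P (src e) e != P (tgt e) e.
Proof. by have := PE e e; rewrite asboolT //; case: (P _ _); case: (P _ _). Qed.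

Lemma P_cut e (y z : bvertex) : badj y z -> P y e != P z e ->
  (y = src e /\ z = tgt e) \/ (y = tgt e /\ z = src e).
Proof.
move=> /asboolP[e' yz] ne; have e'e : e = e'.
  apply/asboolP; rewrite -PE; case: yz ne => -[-> ->];
  by case: (P _ _); case: (P _ _).
by subst e'; case: yz => -[-> ->]; [left|right].
Qed.

Lemma badj_irr : irreflexive badj.
Proof.
move=> u; apply/negP => /asboolP[e ue]; have := P_edge e.
by case: ue => -[<- <-]; rewrite eqxx.
Qed.

Lemma badj_edge e : badj (src e) (tgt e).
Proof. by apply/asboolP; exists e; left. Qed.

Let conn (u v : bvertex) := exists2 q, path badj u q & last u q = v.

Let conn_trans v u w : conn u v -> conn v w -> conn u w.
Proof.
move=> [q pq lq] [r pr lr]; exists (q ++ r); first by rewrite cat_path lq pq.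
by rewrite last_cat lq.
Qed.

Let conn_sym u v : conn u v -> conn v u.
Proof.
move=> [q pq <-]; exists (rev (belast u q)).
  rewrite rev_path (eq_path (e' := badj)) // => x y; exact: badj_sym.
by case: q {pq} => [|z q] //=; rewrite rev_cons last_rcons.
Qed.

Let conn_act g u v : conn u v -> conn (bact g u) (bact g v).
Proof.
move=> [q pq <-]; exists (map (bact g) q); last by rewrite last_map.
by rewrite path_map (eq_path (e' := badj)) // => x y; exact: badj_act.
Qed.

Let conn_adj u v : badj u v -> conn u v.
Proof. by move=> uv; exists [:: v] => //=; rewrite uv. Qed.

Let conn_base g : conn (bv None 1%g) (bv None g).
Proof.
apply: (free_product_generated hG (K := [set g | conn (bv None 1%g) (bv None g)])) => /=.
- by exists [::].
- move=> x y cx cy; apply: conn_trans cx _.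
  by have := conn_act x cy; rewrite !bact_bv mulg1.
- by move=> x cx; apply: conn_sym; have := conn_act x^-1%g cx; rewrite !bact_bv mulg1 mulVg.
- move=> i a; apply: (conn_trans (v := bv (Some i) 1%g)).
    exact/conn_adj/(badj_edge (1%g, inl i)).
  apply: conn_sym; have -> : bv (Some i) 1%g = bv (Some i) (iota i a).
    by apply/bv_eq; split=> //; exists a; rewrite // invg1 mul1g.
  exact/conn_adj/(badj_edge (iota i a, inl i)).
- move=> j; have := badj_edge (1%g, inr j); rewrite /tgt /src /= mul1g.
  exact: conn_adj.
Qed.

Lemma bv_connected u v : exists q, redp badj u q && (last u q == v).
Proof.
have base w : conn (bv None 1%g) w.
  have [[i|] [g ->]] := bvP w => //.
  apply: (conn_trans (conn_base g)); exact/conn_adj/(badj_edge (g, inl i)).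
have [q pq lq] := conn_trans (conn_sym (base u)) (base v).
have [r /andP[rr /eqP lr]] := walk_redp (@badj_sym _ _ _ _ _ _) pq.
by exists r; rewrite rr lr lq eqxx.
Qed.

Lemma bv_acyclic u q : redp badj u q -> last u q = u -> q = [::].
Proof.
apply: bridges_acyclic => {}u a /asboolP[e ua]; exists (P^~ e); split.
  by case: ua => -[-> ->]; have := P_edge e; rewrite // eq_sym.
move=> y z yz /(P_cut yz).
by case: ua => -[-> ->]; case; [left|right|right|left].
Qed.

Definition base_ctree : ctree G :=
  @CTree G bvertex (bv None 1%g) badj (@bact _ _ _ _) (@badj_sym _ _ _ _ _ _) badj_irr
    (@bact1 _ _ _ _) (@bactM _ _ _ _) (@badj_act _ _ _ _ _ _) bv_connected bv_acyclic.

Lemma P_separates e (x y : base_ctree) : P x e != P y e ->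
  separates (src e : base_ctree) (tgt e) x y \/ separates (src e : base_ctree) (tgt e) y x.
Proof.
have st : cadj (src e : base_ctree) (tgt e) by apply: badj_edge.
have ts : cadj (tgt e : base_ctree) (src e) by rewrite cadjC.
have near z : nearer (src e : base_ctree) (tgt e) z = (P z e == P (src e) e).
  apply: (@nearer_cut G base_ctree (src e) (tgt e) z (fun v => P v e)) => //.
    exact: P_edge.
  by move=> u v uv; apply: (P_cut uv).
rewrite /separates !(nearerP _ ts) !near.
by case: (P x e); case: (P y e); case: (P (src e) e) => //= _; [left|right|right|left].
Qed.

Lemma P_act g v x : P (bact g v) x = m g x (+) P v (gact g^-1%g x).
Proof.
have [[i|] [h ->]] := bvP v; rewrite bact_bv ?Pi -!mP mC //.
rewrite addbA; congr (_ (+) _); apply: asbool_equiv_eq.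
split=> [->|e]; first by rewrite /gact /= mulKg.
have := congr1 (gact g) e; rewrite -gactM mulgV gact1 => ->.
by rewrite /gact.
Qed.

(** The edges at the vertices of the first factor are collapsed, which merges every free vertex,
    possibly of degree less than three, with a nonfree one. Without factors nothing is collapsed and
    every vertex has degree [2 k]. *)
Definition zero_type (u v : bvertex) : bool :=
  match (val u).1, (val v).1 with
  | None, Some i | Some i, None => val i == 0%N
  | _, _ => false end.

Definition base_length (u v : base_ctree) : R := if zero_type u v then 0 else 1.

Lemma base_length_ge0 u v : 0 <= base_length u v.
Proof. by rewrite /base_length; case: ifP. Qed.

Lemma base_lengthC u v : base_length u v = base_length v u.
Proof. by rewrite /base_length /zero_type; case: (val u).1; case: (val v).1. Qed.

Lemma base_length_act g u v : base_length (cact g u) (cact g v) = base_length u v.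
Proof. by []. Qed.

Lemma base_length_gap : exists2 eps : R, 0 < eps &
  forall u v : base_ctree, cadj u v -> base_length u v = 0 \/ eps <= base_length u v.
Proof.
by exists 1 => // u v _; rewrite /base_length; case: ifP; [left|right].
Qed.

Definition base_wtree : wtree R G :=
  WTree base_length_ge0 base_lengthC base_length_act base_length_gap.

Lemma bv_none_inj g h : bv None g = bv None h -> g = h.
Proof. by move=> /bv_eq[_ /= e]; rewrite -[h](mulVKg g) e mulg1. Qed.

Lemma labelE (g h : G) (t t' : 'I_p + 'I_k) :
  `[< ((g, t) : X) = (h, t') >] = (g == h) && (t == t').
Proof. by apply/asboolP/andP => [[-> ->]|[/eqP -> /eqP ->]]; rewrite ?eqxx. Qed.

Lemma m1 : m 1%g = fun=> false.
Proof. exact: cocycle1. Qed.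

Lemma bgen_neq1 j : b j <> 1%g.
Proof.
move=> e; have := mb j (1%g, inr j); rewrite e m1 => /esym.
by rewrite asboolT.
Qed.

Lemma bgen_inj j j' : b j = b j' -> j = j'.
Proof.
move=> e; have := mb j (1%g, inr j); rewrite [RHS]asboolT // e mb.
by move=> /asboolP[].
Qed.

Lemma bgen_mul_neq1 j j' : (b j * b j')%g <> 1%g.
Proof.
move=> e; have := mC (b j) (b j') (1%g, inr j); rewrite e m1 !mb [X in X (+) _]asboolT //.
rewrite [X in true (+) X](_ : _ = false) //.
by apply/asboolP; rewrite /gact /= mulg1 => -[/(congr1 (fun x => x^-1)%g)]; rewrite invgK invg1 => /bgen_neq1.
Qed.

Lemma tstab_bv o g : tstab (bv o g : base_ctree) = conjugate_set (@vgroup p Gi G iota o) g^-1%g.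
Proof.
apply/seteqP; split=> h; rewrite /tstab /=.
  rewrite bact_bv => /bv_eq[_ hh]; exists (h ^ g)%g; last exact: conjgK.
  by have := vgroupV hh; rewrite !invgM !invgK /conjg mulgA.
move=> [x ox <-]; rewrite bact_bv; apply/esym/bv_eq; split=> //.
by rewrite /conjg invgK !mulgA mulVg mul1g -mulgA mulVg mulg1.
Qed.

Lemma nonfree_none g : ~ nonfree (bv None g : base_ctree).
Proof. by move=> [h]; rewrite tstab_bv => -[_ -> <-] []; rewrite conj1g. Qed.

Lemma nonfree_some i g : nonfree (bv (Some i) g : base_ctree).
Proof.
have [a a1] := iota_nontrivial hG hGi i; exists (iota i a ^ g^-1)%g.
  by rewrite tstab_bv; exists (iota i a) => //; exists a.
by move=> /(congr1 (fun x => x ^ g)%g); rewrite conjgKV conj1g.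
Qed.

Lemma base_outer : outer_ctree iota base_ctree.
Proof.
have fixsrc g e : bact g (src e) = src e -> g = 1%g.
  rewrite /src bact_bv => /bv_none_inj; rewrite -[RHS]mul1g.
  exact: mulIg.
split.
- by move=> u v g /asboolP[e [[-> _]|[-> _]]] gu gv; apply: (fixsrc g e).
- have inv e g : bact g (src e) = tgt e -> bact g (tgt e) <> src e.
    case: e => h [i|j]; rewrite /src /tgt /= !bact_bv; first by move=> /bv_eq[].
    move=> /bv_none_inj e1 /bv_none_inj; rewrite mulgA e1 -[RHS]mulg1 -mulgA.
    by move=> /mulgI; apply: bgen_mul_neq1.
  move=> u v g /asboolP[e [[-> ->]|[-> ->]]]; first exact: inv.
  by move=> e1 e2; apply: (inv e g).
- move=> i; exists (bv (Some i) 1%g); first by exists 1%g^-1%g => //; rewrite tstab_bv.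
  move=> w; have [[j|] [g ->]] := bvP w; rewrite tstab_bv.
    by move=> /(factor_conj_inj hG hGi) ->; exists g; rewrite /= bact_bv mulg1.
  case=> h _ e; have [a a1] := iota_nontrivial hG hGi i; case: a1.
  have : conjugate_set (range (iota i)) h (iota i a ^ h)%g.
    by exists (iota i a) => //; exists a.
  rewrite e => -[_ -> /= ]; rewrite conj1g => /(congr1 (fun x => x ^ h^-1)%g).
  by rewrite conjgK conj1g.
- move=> v nf; have [[i|] [g vE]] := bvP v; last by rewrite vE; apply: nonfree_none.
  by case: (nf i); exists g^-1%g => //; rewrite vE tstab_bv.
Qed.

Local Notation W := base_wtree.

Lemma base_zero_step (u v : W) : cadj u v -> wd u v = 0 -> zero_type u v.
Proof. by move=> uv; rewrite wd_adj //= /base_length; case: ifP => // _; lra. Qed.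

Lemma base_zero (i : 'I_p) h (u : W) : wd u (bv (Some i) h : W) = 0 ->
  u = bv (Some i) h \/ val i = 0%N /\ exists2 g, u = bv None g & bv (Some i) g = bv (Some i) h.
Proof.
move: u; apply: (@tree_ind_to G W (bv (Some i) h) (fun u => wd u (bv (Some i) h : W) = 0 ->
  u = bv (Some i) h \/ val i = 0%N /\ exists2 g, u = bv None g & bv (Some i) g = bv (Some i) h)).
  by left.
move=> u u1 n IH; rewrite (wd_first n) => z; have uu1 : cadj u u1 by rewrite cadjC (nearer_adj n).
move/eqP: z; rewrite paddr_eq0 ?wd_ge0 // => /andP[/eqP z1 /eqP z2].
have zt := base_zero_step uu1 z1.
have [e|[i0 [g e e']]] := IH z2.
  subst u1; move: zt; case/asboolP: uu1 => -[g [i'|j]] [[-> e]|[e ue]]; rewrite /src /tgt /= in e *.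
  - move=> z'; right; split; first by move/eqP: z'.
    by move/bv_eq: (e) => [[ii] _]; exists g; rewrite // e ii.
  - by move/bv_eq: e => [].
  - by move/bv_eq: e => [].
  - by move/bv_eq: e => [].
subst u1; move: zt; case/asboolP: uu1 => -[g' [i'|j]] [[-> e]|[e ue]]; rewrite /src /tgt /= in e *.
- by move/bv_eq: e => [].
- rewrite ue /zero_type /= => /eqP i'0; left; rewrite -e'.
  have -> : i' = i by apply: val_inj; rewrite /= i'0 -i0.
  by rewrite (bv_none_inj e).
- by [].
- by rewrite ue.
Qed.

Lemma base_zero_none (h : G) (i : 'I_p) : val i = 0%N ->
  wd (bv None h : W) (bv (Some i) h) = 0.
Proof.
move=> i0; rewrite wd_adj; first by rewrite /= /base_length /zero_type /= i0.
exact: (badj_edge (h, inl i)).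
Qed.

Lemma base_zero_p0 (u v : W) : p = 0%N -> wd u v = 0 -> u = v.
Proof.
move=> p0 z; apply: contrapT => /(@geo_first G W)[w n].
have uw : cadj u w by rewrite cadjC (nearer_adj n).
move/eqP: z; rewrite (wd_first n) paddr_eq0 ?wd_ge0 // => /andP[/eqP z1 _].
have := base_zero_step uw z1.
have ni (i : 'I_p) : False by case: i => i; rewrite p0.
by rewrite /zero_type; case: (val u).1 => [i|]; case: (val w).1 => [i'|].
Qed.

(** After a translation the edge has label [(1, t)] and [w] is the coset of [1]; it then suffices to
    find one element that carries this vertex across the edge. *)
Lemma base_hull (w : W) (u v : W) : cadj u v -> 0 < wd u v ->
  exists g h, separates u v (cact g w) (cact h w).
Proof.
move=> uv l0.
suff key e : (forall i, e.2 = inl i -> val i <> 0%N) -> exists g h, P (bact g w) e != P (bact h w) e.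
  have [e [uE vE nz]] : exists e, [/\ (u = src e /\ v = tgt e) \/ (v = src e /\ u = tgt e), True &
      forall i, e.2 = inl i -> val i <> 0%N].
    case/asboolP: (uv) => -[g t] e; exists (g, t); split=> // i /= ti i0.
    move: l0; rewrite wd_adj //= /base_length /zero_type.
    by case: e => -[-> ->]; rewrite /src /tgt /= ti /= i0 ltxx.
  have [g [h /P_separates s]] := key e nz.
  case: uE s => -[-> ->] [s|s]; [by exists g, h|by exists h, g| |].
    by exists h, g; rewrite separates_flip.
  by exists g, h; rewrite separates_flip.
case: e => g0 t nz.
suff [g [h ne]] : exists g h, P (bact g w) (1%g, t) != P (bact h w) (1%g, t).
  exists (g0 * g)%g, (g0 * h)%g; rewrite !bactM !(P_act g0) /gact /= mulVg.
  by move: ne; case: (P (bact g w) _); case: (P (bact h w) _); case: (m _ _).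
have [q [g1 wE]] := bvP w.
suff [h ne] : exists h, P (bv q 1%g) (1%g, t) != P (bv q h) (1%g, t).
  exists g1^-1%g, (h * g1^-1)%g.
  by rewrite wE !bact_bv mulVg -mulgA mulVg mulg1.
have inr_inl i j : (inr j == inl i :> 'I_p + 'I_k) = false by [].
have inl_inr i j : (inl i == inr j :> 'I_p + 'I_k) = false by [].
have inl_inl i j : (inl i == inl j :> 'I_p + 'I_k) = (i == j) by [].
pose E := (inr_inl, inl_inr, inl_inl, labelE, eqxx, andbF, andbT, addbF).
have nt i : exists a, (1%g == iota i a) = false.
  by have [a a1] := iota_nontrivial hG hGi i; exists a; apply/eqP/nesym.
case: q {wE} => [i|].
  case: t nz => [i'|j] nz; last by exists (b j); rewrite !Pi -!mP m1 mb !E.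
  have [ii'|ii'] := eqVneq i i'; last first.
    have [a a1] := nt i'; exists (iota i' a).
    have ni : (i' == i) = false by rewrite eq_sym; apply: negbTE.
    by rewrite !Pi -!mP m1 mi !E ni a1.
  (* The factor [i] fixes its own vertex, so an element of the first factor is taken; the two
     factors differ because the edge is not collapsed. *)
  subst i'; have i0 := nz i erefl.
  have p0 : (0 < p)%N by apply: leq_ltn_trans (ltn_ord i).
  have [a a1] := nt (Ordinal p0); exists (iota (Ordinal p0) a).
  have ni : (i == Ordinal p0) = false by apply/eqP => e; move: i0; rewrite e.
  by rewrite !Pi -!mP m1 mi !E ni a1 !andbF.
case: t nz => [i|j] _; last by exists (b j); rewrite -!mP m1 mb !E.
by have [a a1] := nt i; exists (iota i a); rewrite -!mP m1 mi !E a1.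
Qed.

(** For the infinite cyclic group the tree is a line, all of whose vertices are redundant. *)
Hypothesis hZ : ~ (p = 0%N /\ k = 1%N).

Lemma base_stab_move (v : W) g : wd v (cact g v) = 0 ->
  nonfree v \/ (forall u : W, wd v u = 0 -> ~ nonfree u) -> cact g v = v.
Proof.
have [[i|] [h ->]] := bvP v; rewrite /= bact_bv => z.
  by move=> _; have [//|[_ [g' /bv_eq[]]]] := base_zero z.
case=> [/nonfree_none //|free].
have [p0|p0] := posnP p; first by rewrite -(base_zero_p0 p0 z).
by case: (free _ (base_zero_none h (i := Ordinal p0) erefl)); apply: nonfree_some.
Qed.

Lemma base_degree3 (v : W) : (forall u : W, wd v u = 0 -> ~ nonfree u) ->
  (forall a c : W, cadj a c -> wd v a = 0 -> wd a c = 0) \/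
  exists a1 b1 a2 b2 a3 b3 : W,
    [/\ [/\ cadj a1 b1, wd v a1 = 0 & 0 < wd a1 b1],
        [/\ cadj a2 b2, wd v a2 = 0 & 0 < wd a2 b2],
        [/\ cadj a3 b3, wd v a3 = 0 & 0 < wd a3 b3] &
        [/\ (a1, b1) <> (a2, b2), (a2, b2) <> (a3, b3) & (a1, b1) <> (a3, b3)]].
Proof.
have [[i|] [h ->]] := bvP v => free.
  by case: (free (bv (Some i) h)); [exact: wdxx|apply: nonfree_some].
have [p0|p0] := posnP p; last first.
  by case: (free _ (base_zero_none h (i := Ordinal p0) erefl)); apply: nonfree_some.
have nop (i : 'I_p) : False by case: i => i; rewrite p0.
have [k0|k0] := posnP k.
  have nok (j : 'I_k) : False by case: j => j; rewrite k0.
  by left=> a c /asboolP[[g [i|j]]]; [case: (nop i)|case: (nok j)].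
have k1 : (1 < k)%N by rewrite ltn_neqAle k0 andbT eq_sym; apply/eqP => k1; apply: hZ.
right; pose j0 := Ordinal k0; pose j1 := Ordinal k1.
have pos g : cadj (bv None h : W) (bv None g : W) -> 0 < wd (bv None h : W) (bv None g : W).
  by move=> a; rewrite wd_adj //= /base_length /zero_type /= ltr01.
have out j : cadj (bv None h : W) (bv None (h * b j)%g : W) by apply: (badj_edge (h, inr j)).
have inn j : cadj (bv None h : W) (bv None (h * (b j)^-1)%g : W).
  rewrite cadjC; have := badj_edge (h * (b j)^-1, inr j)%g.
  by rewrite /tgt /src /= -mulgA mulVg mulg1.
exists (bv None h), (bv None (h * b j0)%g), (bv None h), (bv None (h * b j1)%g),
  (bv None h), (bv None (h * (b j0)^-1)%g).
split; try by split; rewrite ?wdxx ?out ?inn ?pos.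
split=> /(congr1 snd)/bv_none_inj/mulgI.
- by move=> /bgen_inj.
- by move=> e; apply: (@bgen_mul_neq1 j1 j0); rewrite e mulVg.
- by move=> e; apply: (@bgen_mul_neq1 j0 j0); rewrite {1}e mulVg.
Qed.

Lemma base_outer_space : outer_space iota (realize W).
Proof.
apply: realize_outer.
- exact: base_outer.
- exact: base_hull.
- exact: base_stab_move.
- exact: base_degree3.
- by move=> i; apply: iota_nontrivial hG hGi i.
Qed.

End BaseCTree.

Lemma outer_space_nonempty (R : realType) (p k : nat) (Gi : 'I_p -> groupType)
    (G : groupType) (iota : forall i, group_hom (Gi i) G) (b : 'I_k -> G) :
  is_free_product iota b -> (forall i, exists a : Gi i, a <> 1%g) ->
  ~ (p = 0%N /\ k = 1%N) -> exists X : gtree R G, outer_space iota X.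
Proof.
move=> hG hGi hZ; have [P [PE [[m [mC mP mi mb]] Pi]]] := potential_exists hG.
by eexists; apply: (base_outer_space (R := R) hG hGi PE mC mP mi mb Pi hZ).
Qed.

(** * The combinatorial tree of a point of the outer space *)

(** The circuit is a shortest closed subwalk: minimality makes its origins distinct. *)
Lemma closed_walk_circuit (Q : multigraph) (n : nat) (c : nat -> medge Q)
    (o : nat -> mvertex Q) : (0 < n)%N -> o n = o 0%N ->
  (forall i, (i < n)%N -> [/\ medges (c i), org (c i) = o i & ter (c i) = o i.+1]) ->
  (forall i, (i < n)%N -> [/\ org (bar (c i)) = o i.+1, ter (bar (c i)) = o i,
                              bar (bar (c i)) = c i & bar (c i) <> c i]) ->
  (forall i, (i.+1 < n)%N -> c i.+1 <> bar (c i)) ->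
  exists m (c' : 'I_m -> medge Q), circuit c'.
Proof.
move=> n0 on cE cb nbt.
pose good d := `[< (0 < d)%N /\ exists2 i, (i + d <= n)%N & o i = o (i + d)%N >].
have : exists d, good d by exists n; apply/asboolP; split=> //; exists 0%N.
move=> /ex_minnP[d /asboolP[d0 [i idn oid]] dmin].
have inj k l : (k < l)%N -> (l < d)%N -> o (i + k)%N <> o (i + l)%N.
  move=> kl ld e; have : (d <= l - k)%N; last lia.
  apply: dmin; apply/asboolP; split; first by lia.
  by exists (i + k)%N; [lia|rewrite e; congr o; lia].
exists d, (fun j => c (i + j)%N); split=> //.
- by move=> j; have [] // := cE (i + j)%N; have := ltn_ord j; lia.
- move=> j; have [|_ _ ->] := cE (i + j)%N; first by have := ltn_ord j; lia.
  have [|_ -> _] := cE (i + ordS j)%N; first by have := ltn_ord (ordS j); lia.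
  rewrite /=; have [lt|ge] := ltnP j.+1 d; first by rewrite modn_small // addnS.
  have -> : j.+1 = d by have := ltn_ord j; lia.
  by rewrite modnn addn0 oid; congr o; have := ltn_ord j; lia.
- move=> j l; have [|_ -> _] := cE (i + j)%N; first by have := ltn_ord j; lia.
  have [|_ -> _] := cE (i + l)%N; first by have := ltn_ord l; lia.
  have := ltn_ord j; have := ltn_ord l => ld jd e; apply: val_inj => /=.
  by case: (ltngtP j l) => // h; [case: (inj _ _ h ld)|case: (inj _ _ h jd)].
- move=> j /=; have jd := ltn_ord j; have [lt|ge] := ltnP j.+1 d.
    by rewrite modn_small // addnS; apply: nbt; lia.
  have jE : j.+1 = d by lia.
  rewrite jE modnn addn0 => e.
  (* A backtrack at the closing point: a single edge would be its own reverse, two edges would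
     backtrack inside the walk, and more edges would contain a shorter closed subwalk. *)
  have [|b1 b2 b3 b4] := cb (i + j)%N; first by lia.
  have [|_ e1 e2] := cE i; first by lia.
  have [j0|j0] := eqVneq (j : nat) 0%N; first by apply: b4; rewrite -e j0 addn0.
  have [j1|j1] := eqVneq (j : nat) 1%N.
    apply: (nbt i); first by lia.
    by rewrite e b3 j1 addn1.
  apply: (inj 1%N j); [lia|lia|].
  by rewrite -b2 -e e2 addn1.
Qed.

Lemma nobacktrack_nth (V : eqType) (x0 x : V) p i : nobacktrack x p ->
  (i.+1 < size p)%N -> nth x0 p i.+1 != nth x0 (x :: p) i.
Proof.
elim: p x i => [|y p IH] x i //= /andP[h nb].
by case: i => [|i] /=; [case: p h {IH nb} => //|move=> lt; apply: (IH y)].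
Qed.

Section VertexTree.
Context {R : realType} (X : simplicial_metric_tree R).
Implicit Types (x y z : X) (e : set X).

Definition xvertex : Type := {x : X | `[< vertices x >]}.
HB.instance Definition _ := Choice.on xvertex.
Implicit Types (u v w a b : xvertex).

Lemma xvertexP u : vertices (val u).
Proof. by apply/asboolP; case: u. Qed.

Definition xv (x : X) (h : vertices x) : xvertex := exist _ x (asboolT h).

Definition xadj u v : bool :=
  `[< oriented_edges (@vertices R X) (@edges R X) setT (val u, val v) >].

Definition ends e u v : Prop := [/\ edges e, e (val u), e (val v) & u <> v].

Lemma xadjP u v : xadj u v <-> exists e, ends e u v.
Proof.
split=> [/asboolP[/= _ _ uv [e ee [eu ev _]]]|[e [ee eu ev uv]]].
  by exists e; split=> // e'; apply: uv; rewrite e'.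
apply/asboolP; split; [exact: xvertexP|exact: xvertexP|by move=> /val_inj|].
by exists e.
Qed.

Lemma xadj_sym : symmetric xadj.
Proof.
suff imp u v : xadj u v -> xadj v u by move=> u v; apply/idP/idP; apply: imp.
by move=> /xadjP[e [? ? ? uv]]; apply/xadjP; exists e; split=> // /esym.
Qed.

Lemma xadj_irr : irreflexive xadj.
Proof. by move=> u; apply/negP => /xadjP[e [_ _ _]]. Qed.

Lemma endsP e : edges e -> exists u v, [/\ ends e u v,
  forall x, e x -> vertices x -> x = val u \/ x = val v,
  forall x, e x -> mdist (val u) x + mdist x (val v) = mdist (val u) (val v) &
  exists x, e x /\ ~ vertices x].
Proof.
move=> ee; have [l [c [l0 eE dE vE]]] := edgesP ee.
have i0 : 0 \in `[0, l] by rewrite in_itv /= lexx ltW.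
have il : l \in `[0, l] by rewrite in_itv /= lexx ltW.
have v0 : vertices (c 0) by apply/vE => //; left.
have vl : vertices (c l) by apply/vE => //; right.
have mem t : t \in `[0, l] -> e (c t) by move=> h; rewrite eE; exists t.
have ne : xv v0 <> xv vl.
  move=> /(congr1 val) /= h; have := dE _ _ i0 il.
  by rewrite h mdistxx sub0r normrN gtr0_norm //; lra.
exists (xv v0), (xv vl); split=> /=.
- by split=> //; apply: mem.
- by move=> x; rewrite eE => -[t /= it <-] /vE -/(_ it)[->|->]; [left|right].
- move=> x; rewrite eE => -[t /= it <-]; rewrite !dE //.
  by move: it; rewrite in_itv /= => /andP[t0 tl]; rewrite !ler0_norm; lra.
- have ih : l / 2 \in `[0, l] by rewrite in_itv /=; apply/andP; split; lra.
  exists (c (l / 2)); split; first exact: mem.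
  by move/vE => /(_ ih)[]; lra.
Qed.

Lemma ends_vertices e u v x : ends e u v -> e x -> vertices x -> x = val u \/ x = val v.
Proof.
move=> [ee eu ev uv] ex vx; have [a [b [_ h _ _]]] := endsP ee.
have := h _ eu (xvertexP u); have := h _ ev (xvertexP v); have := h _ ex vx.
by case=> ->; case=> e1; case=> e2; rewrite ?e1 ?e2; auto;
  case: uv; apply: val_inj; rewrite e1 e2.
Qed.

Lemma ends_same e u v a b : ends e u v -> ends e a b ->
  (a = u /\ b = v) \/ (a = v /\ b = u).
Proof.
move=> uv [_ ea eb nab].
have := ends_vertices uv ea (xvertexP a); have := ends_vertices uv eb (xvertexP b).
case=> /val_inj eB; case=> /val_inj eA; subst a b; [by case: nab|by right|by left|by case: nab].
Qed.

Lemma ends_edge_uniq e e' u v : ends e u v -> ends e' u v -> e = e'.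
Proof.
move=> [ee eu ev uv] [ee' eu' ev' _]; apply: contrapT => ne.
have [_ h] := edges_meet ee ee' ne eu eu'.
by apply: uv; apply/esym/val_inj/h.
Qed.

Lemma xv_connected u v : exists p, redp xadj u p && (last u p == v).
Proof.
have [_ conn _] := tree_graph X.
have := conn (val u) (val v); move=> /(_ (conj (xvertexP u) I) (conj (xvertexP v) I)) j.
suff [p pu lp] : exists2 p, path xadj u p & last u p = v.
  have [q /andP[rq /eqP lq]] := walk_redp xadj_sym pu.
  by exists q; rewrite rq lq lp eqxx.
move e1 : (val u) j => x1; move e2 : (val v) => x2 j.
elim: j u e1 e2 => {x1 x2} [x|[x y] z exy _ IH] u e1 e2.
  by exists [::] => //; apply: val_inj; rewrite e1 e2.
rewrite /= in e1; have [_ /= vy _ _] := exy.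
have [p py lp] := IH (xv vy) erefl e2; exists (xv vy :: p) => //=.
by rewrite py andbT; apply/asboolP; have -> : val u = x by exact: e1.
Qed.

Lemma xv_acyclic u p : redp xadj u p -> last u p = u -> p = [::].
Proof.
move=> /andP[pu nb] l; apply: contrapT => pn.
have n0 : (0 < size p)%N by case: (p) pn.
have [_ _ forest] := tree_graph X.
have edge i : (i < size p)%N -> xadj (nth u (u :: p) i) (nth u p i) by apply/pathP.
have [|||||m [c /forest //]] := @closed_walk_circuit
  (subgraph_graph (@vertices R X) (@edges R X) setT) (size p)
  (fun i => (val (nth u (u :: p) i), val (nth u p i))) (fun i => val (nth u (u :: p) i)).
- by [].
- by rewrite -[size p]/(size (u :: p)).-1 nth_last /= l.
- by move=> i /edge/asboolP h; split.
- move=> i /edge h; split=> // -[e1 _].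
  by move: h; rewrite -(val_inj e1) xadj_irr.
- move=> i lt -[e2]; have := nobacktrack_nth u nb lt.
  by rewrite (val_inj e2) eqxx.
Qed.

End VertexTree.

Section VertexGTree.
Context {R : realType} {G : groupType} (X : gtree R G).
Local Notation V := (xvertex X).
Implicit Types (u v w a b : V) (g h : G) (x y z : X) (e : set X).

Definition xact g u : V := exist _ (act g (val u)) (asboolT (act_vertices g (xvertexP u))).

Lemma xact1 u : xact 1%g u = u.
Proof. by apply: val_inj; rewrite /= act1. Qed.

Lemma xactM g h u : xact (g * h)%g u = xact g (xact h u).
Proof. by apply: val_inj; rewrite /= actM. Qed.

Lemma xact_ends g e u v : ends e u v -> ends (act g @` e) (xact g u) (xact g v).
Proof.
move=> [ee eu ev uv]; split; [exact: act_edges|by exists (val u)|by exists (val v)|].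
move=> /(congr1 (fun q : V => val (xact g^-1%g q))) /=; rewrite -!actM mulVg !act1.
by move=> /val_inj.
Qed.

Lemma xadj_act g u v : xadj (xact g u) (xact g v) = xadj u v.
Proof.
have imp k a b : xadj a b -> xadj (xact k a) (xact k b).
  by move=> /xadjP[e ab]; apply/xadjP; exists (act k @` e); apply: xact_ends.
apply/idP/idP; last exact: imp.
by move=> /(imp g^-1%g); rewrite -!xactM mulVg !xact1.
Qed.

Fact xbase_exists : exists u : V, True.
Proof. by have [[x [vx _]] _ _] := tree_graph X; exists (xv vx). Qed.

Definition xtree : ctree G :=
  @CTree G V (projT1 (cid xbase_exists)) (@xadj R X) xact (@xadj_sym R X) (@xadj_irr R X)
    xact1 xactM xadj_act (@xv_connected R X) (@xv_acyclic R X).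

Definition xlen (u v : xtree) : R := mdist (val u) (val v).

Lemma xlenC u v : xlen u v = xlen v u.
Proof. exact: metric_sym. Qed.

Lemma xlen_act g (u v : xtree) : xlen (cact g u) (cact g v) = xlen u v.
Proof. exact: act_isometry. Qed.

Lemma xdist_step w (a b : xtree) : cadj a b ->
  tdist xlen w b <= tdist xlen w a + mdist (val a) (val b).
Proof.
move=> ab; case n : (nearer a b (w : xtree)); first by rewrite (tdist_nearer _ n).
have n' : nearer b a (w : xtree) by rewrite nearerP ?n // cadjC.
have := mdist_ge0 (val a) (val b).
by rewrite (tdist_nearer _ n') xlenC /xlen; lra.
Qed.

(** The chains of the path metric run through arbitrary points of edges. So the combinatorial
    distance from [w] is extended to all points, as an upper bound [L] that need not grow by more
    than the length of a chain. *)
Definition xreach (w : xtree) x (L : R) : Prop :=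
  (forall e a b, ends e a b -> e x ->
     tdist xlen w a + mdist (val a) x <= L \/ tdist xlen w b + mdist (val b) x <= L) /\
  (forall v, val v = x -> tdist xlen w v <= L).

Lemma xreach_step w x y L e : xreach w x L -> edges e -> e x -> e y ->
  xreach w y (L + mdist x y).
Proof.
move=> [re rv] ee ex ey; have [a [b [ab h hd _]]] := endsP ee.
have adjab : cadj (a : xtree) b by apply/xadjP; exists e.
have adjba : cadj (b : xtree) a by rewrite cadjC.
have tri u : mdist (val u) y <= mdist (val u) x + mdist x y by exact: metric_triangle.
have key : tdist xlen w a + mdist (val a) y <= L + mdist x y \/
    tdist xlen w b + mdist (val b) y <= L + mdist x y.
  by have [|] := re _ _ _ ab ex => le; [left|right]; have := tri a; have := tri b; lra.
have keyv v : val v = y -> tdist xlen w v <= L + mdist x y.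
  move=> vy; have [sa sb] := (xdist_step w adjab, xdist_step w adjba).
  have yv : vertices y by rewrite -vy; apply: xvertexP.
  have [e1|e1] := ends_vertices ab ey yv.
    have -> : v = a by apply: val_inj; rewrite vy.
    by move: key; rewrite e1 mdistxx; case; lra.
  have -> : v = b by apply: val_inj; rewrite vy.
  by move: key; rewrite e1 mdistxx; case; lra.
split=> // e' a' b' ab' e'y; have [ee'|ne] := pselect (e' = e).
  by subst e'; have [[-> ->]|[-> ->]] := ends_same ab ab'; case: key; auto.
have [ee'' e'a e'b _] := ab'.
have [vy _] := edges_meet ee'' ee ne e'y ey.
have [e1|e1] := ends_vertices ab' e'y vy; [left|right]; rewrite e1 mdistxx addr0.
all: by rewrite -e1; apply: keyv (esym e1).
Qed.

Lemma xdist_le_chain (w : xtree) p x L : xreach w x L -> chain (@edges R X) x p ->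
  xreach w (last x p) (L + chain_length x p).
Proof.
elim: p x L => [|y p IH] x L r; first by rewrite /chain_length /= big_nil addr0.
move=> /= /andP[/asboolP[e ee [ex ey]] cp].
rewrite /chain_length /= big_cons addrA; apply: IH => //.
exact: xreach_step r ee ex ey.
Qed.

Lemma xdistE (u v : xtree) : mdist (val u) (val v) = tdist xlen u v.
Proof.
apply/eqP; rewrite eq_le; apply/andP; split.
  apply: (@tree_ind_to G xtree v (fun u => mdist (val u) (val v) <= tdist xlen u v)).
    by rewrite mdistxx tdistxx.
  move=> a b n h; rewrite (tdist_first _ n) /xlen.
  by have := metric_triangle (val a) (val b) (val v); lra.
rewrite -lee_fin (tree_path_metric (val u) (val v)); apply: le_ereal_inf_tmp => _ [p [cp lp] <-].
rewrite lee_fin; have r0 : xreach u (val u) 0.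
  split=> [e a b ab eu|a /val_inj ->]; last by rewrite tdistxx.
  by have [/val_inj <-|/val_inj <-] := ends_vertices ab eu (xvertexP u); [left|right];
    rewrite tdistxx mdistxx addr0.
by have [_ h] := xdist_le_chain r0 cp; have := h v (esym lp); rewrite add0r.
Qed.

End VertexGTree.

Section OuterVertexTree.
Context {R : realType} {p : nat} {Gi : 'I_p -> groupType} {G : groupType}.
Context {iota : forall i, group_hom (Gi i) G}.
Context {X : gtree R G} (hX : outer_space iota X).
Local Notation V := (xtree X).
Implicit Types (u v w a b c d : V) (g h : G) (x y z : X) (e : set X).

Lemma ends_sym e u v : ends e u v -> ends e v u.
Proof. by move=> [ee eu ev uv]; split=> // /esym. Qed.

Lemma xstab u : tstab u = stabilizer (val u).
Proof.
apply/seteqP; split=> g; rewrite /tstab /stabilizer /=; first by move/(congr1 val).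
by move=> e; apply: val_inj.
Qed.

Lemma edge_fixed g e : edges e -> act g @` e = e -> g = 1%g.
Proof.
have [_ [_ st] _ _] := hX.
by move=> ee ge; have : edge_stabilizer e g by []; rewrite st.
Qed.

Lemma x_outer : outer_ctree iota V.
Proof.
have [_ _ fac free] := hX.
split.
- move=> u v g /xadjP[e uv] gu gv; have := xact_ends g uv.
  rewrite -[xact g u]/(cact (g : G) (u : V)) -[xact g v]/(cact (g : G) (v : V)) gu gv => guv.
  by apply: (edge_fixed (e := e)); [case: uv|apply: ends_edge_uniq guv uv].
- move=> u v g /xadjP[e uv] gu gv; have := xact_ends g uv.
  rewrite -[xact g u]/(cact (g : G) (u : V)) -[xact g v]/(cact (g : G) (v : V)) gu gv => guv.
  have g1 : g = 1%g.
    by apply: (edge_fixed (e := e)); [case: uv|apply: ends_edge_uniq guv (ends_sym uv)].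
  by case: uv => _ _ _; apply; rewrite -gu g1 cact1.
- move=> i; have [x [vx fx uniq]] := fac i; exists (xv vx); first by rewrite xstab.
  move=> w; rewrite xstab => /(uniq _ (xvertexP w))[g _ gx].
  by exists g; apply: val_inj.
- move=> v nf; have [|_ st] := free _ (xvertexP v).
    by move=> i; rewrite -xstab; apply: nf.
  by move=> [g]; rewrite xstab st.
Qed.

Lemma xjoined (S : set X) u v :
  (forall a b, separates a b u v -> forall e, ends e a b -> e `<=` S) ->
  joined (Q := subgraph_graph (@vertices R X) (@edges R X) S) (val u) (val v).
Proof.
apply: (@tree_ind_to G V v (fun u =>
  (forall a b, separates a b u v -> forall e, ends e a b -> e `<=` S) ->
  joined (Q := subgraph_graph (@vertices R X) (@edges R X) S) (val u) (val v))).
  by move=> _; apply: joined_refl.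
move=> {}u u1 n IH H.
apply: (@joined_step (subgraph_graph (@vertices R X) (@edges R X) S) (val u, val u1)).
  have /xadjP[e uu1] : xadj u u1 by rewrite xadj_sym; apply: nearer_adj n.
  have [ee eu ev nuv] := uu1; split; [exact: xvertexP|exact: xvertexP|by move/val_inj|].
  exists e => //; split; [exact: eu|exact: ev|].
  have hh := H u u1 (next_edge_separates n) e uu1. exact: hh.
by apply: IH => a b s; apply: H; apply: next_separates s.
Qed.

(** The union of the segments between translates of [w] is an invariant subtree, so by minimality it
    contains every edge. *)
Lemma x_hull w a b : cadj a b -> exists g h, separates a b (cact g w) (cact h w).
Proof.
have [_ [min _] _ _] := hX.
pose S : set X := [set x | (exists g, x = val (cact g w)) \/
  exists c d g h e, [/\ separates c d (cact g w) (cact h w), ends e c d & e x]].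
have Sin c d g h e : separates c d (cact g w) (cact h w) -> ends e c d -> e `<=` S.
  by move=> s cd x ex; right; exists c, d, g, h, e.
have Sseg u : S (val u) -> exists g, forall c d, separates c d u (cact g w) ->
    forall e, ends e c d -> e `<=` S.
  case=> [[g /val_inj ->]|[c [d [g [h [e [s cd eu]]]]]]].
    by exists g => c d /andP[n1 n2]; move: (n1); rewrite (nearerP _ (nearer_adj n1)) n2.
  have [/val_inj uc|/val_inj ud] := ends_vertices cd eu (xvertexP u); subst u.
    exists g => c' d' s' e' cd'; apply: (Sin d' c' g h); last exact: ends_sym.
    exact: separates_sub s s'.
  exists h => c' d' s' e' cd'; apply: (Sin d' c' h g); last exact: ends_sym.
  have sf : separates d c (cact h w) (cact g w) by rewrite separates_flip.
  exact: separates_sub sf s'.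
have ST : S = [set: X].
  apply: min.
    split.
      move=> x [[g ->]|[c [d [g [h [e [s cd ex]]]]]]]; first by left; apply: xvertexP.
      by right; exists e; [case: cd|split=> //; apply: Sin s cd].
    split.
    - by exists (val w); split; [apply: xvertexP|left; exists 1%g; rewrite cact1].
    - move=> x y [vx Sx] [vy Sy]; have [g hg] := Sseg (xv vx) Sx; have [h hh] := Sseg (xv vy) Sy.
      apply: (@xjoined S (xv vx) (xv vy)) => c d s e cd; have cdj := nearer_adj (andP s).1.
      case/orP: (separates_cat (cact g w) cdj s) => [s1|s2]; first exact: hg s1 _ cd.
      case/orP: (separates_cat (cact h w) cdj s2) => [s1|s3]; first exact: Sin s1 cd.
      by apply: (hh d c); [rewrite separates_flip|apply: ends_sym].
    - move=> n c [n0 cE ct ci cb]; have [_ _ forest] := tree_graph X.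
      apply: (forest n c); split=> // i.
      by have [v1 v2 ne [e ee [e1 e2 _]]] := cE i; split=> //; exists e.
  move=> g x [[h ->]|[c [d [h [k [e [s cd ex]]]]]]].
    by left; exists (g * h)%g; rewrite cactM.
  right; exists (cact g c), (cact g d), (g * h)%g, (g * k)%g, (act g @` e); split.
  - by rewrite !cactM separates_act.
  - exact: xact_ends.
  - by exists x.
move=> /xadjP[e ab]; have [ee _ _ _] := ab; have [_ [_ [_ _ _ [x [ex nx]]]]] := endsP ee.
have : S x by rewrite ST.
case=> [[g xE]|[c [d [g [h [e' [s cd ex']]]]]]].
  by case: nx; rewrite xE; apply: xvertexP.
have ee' : e' = e.
  apply: contrapT => ne; apply: nx; have [ee' _ _ _] := cd.
  by have [] := edges_meet ee' ee ne ex' ex.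
subst e'; have [[ca db]|[cb da]] := ends_same ab cd; subst c d; first by exists g, h.
by exists h, g; rewrite separates_flip.
Qed.

(** A free vertex of degree two would be redundant. If [v] were a leaf with neighbor [u0], the hull
    of the orbit of [u0] could only contain this edge if [v] were a translate of [u0], and then the
    edge would be inverted. *)
Lemma x_degree3 v : ~ nonfree v -> (exists a b : V, cadj a b) ->
  exists a b c, [/\ [/\ cadj v a, cadj v b & cadj v c], a <> b, b <> c & a <> c].
Proof.
move=> fv [a0 [b0 ab0]].
have [u0 vu0] : exists u, cadj v u.
  have [w vw] : exists w : V, v <> w.
    have [e|ne] := pselect (v = a0); last by exists a0.
    by exists b0 => e'; move: ab0; rewrite -e -e' cadjxx.
  by have [u n] := geo_first vw; exists u; rewrite cadjC; apply: nearer_adj n.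
have st g : stabilizer (val v) g -> g = 1%g.
  by rewrite -xstab => gv; apply: contrapT => g1; apply: fv; exists g.
apply: contrapT => no3.
have two : forall b c, cadj v b -> cadj v c -> b <> u0 -> c <> u0 -> b = c.
  move=> b c vb vc bu cu; apply: contrapT => bc; apply: no3.
  by exists u0, b, c; split=> // /esym.
have [[u1 [vu1 u10]]|one] := pselect (exists u1, cadj v u1 /\ u1 <> u0).
  have [nred _ _ _] := hX; apply: (nred (val v)).
  have [e0 ve0] := (xadjP v u0).1 vu0; have [e1 ve1] := (xadjP v u1).1 vu1.
  split; first exact: xvertexP.
  - exists e0, e1; split.
      move=> e01; subst e1; apply: u10.
      have [[_ ->]//|[e _]] := ends_same ve0 ve1.
      by case: ve0 => _ _ _; case.
    apply/seteqP; split=> e /=; last first.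
      by case=> ->; [case: ve0|case: ve1].
    case=> ee ev; have [a [b [ab _ _ _]]] := endsP ee.
    have [c vc] : exists c : V, ends e v c.
      have [/val_inj va|/val_inj vb] := ends_vertices ab ev (xvertexP v); subst v.
        by exists b.
      by exists a; apply: ends_sym.
    have vcj : cadj v c by apply/xadjP; exists e.
    have [cu|cu] := pselect (c = u0).
      by left; subst c; apply: ends_edge_uniq vc ve0.
    right; have cu1 : c = u1 by apply: two.
    by subst c; apply: ends_edge_uniq vc ve1.
  - move=> g /st -> e _ _; rewrite /edge_stabilizer /=; apply/seteqP; split=> x.
      by move=> [y ey <-]; rewrite act1.
    by exists x => //; rewrite act1.
have leaf b : cadj v b -> b = u0.
  by move=> vb; apply: contrapT => bu; apply: one; exists b.
have [g [h /andP[n1 _]]] := x_hull u0 vu0.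
have gu : cact g u0 = v.
  apply: contrapT => ne; have [b nb] := geo_first (nesym ne).
  have bu : b = u0 by apply: leaf; rewrite cadjC; apply: nearer_adj nb.
  by subst b; move: n1; rewrite nearerP ?nb.
have u0v : cadj u0 v by rewrite cadjC.
have gv : cact g v = u0 by apply: leaf; rewrite -{1}gu cadj_act.
exact: (oc_inversion x_outer u0v gu gv).
Qed.

End OuterVertexTree.

(** * Finiteness of the quotient *)

Section Transversal.
Context {A : eqType} (E : A -> A -> Prop).
Hypothesis Exx : forall x, E x x.

Lemma transversal_exists (s : seq A) : exists t : seq A,
  [/\ {subset t <= s}, forall x, x \in s -> exists2 y, y \in t & E y x &
      pairwise (fun x y => ~~ `[< E y x >]) t].
Proof.
elim: s => [|x s [t [ts cov pw]]]; first by exists [::].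
have [[y yt yx]|no] := pselect (exists2 y, y \in t & E y x).
  exists t; split=> //; first by move=> z /ts; rewrite inE orbC => ->.
  by move=> z; rewrite inE => /orP[/eqP ->|/cov //]; exists y.
exists (x :: t); split.
- by move=> z; rewrite !inE => /orP[->|/ts ->] //; rewrite orbT.
- move=> z; rewrite inE => /orP[/eqP ->|/cov[y yt yz]].
    by exists x; rewrite // mem_head.
  by exists y; rewrite // inE yt orbT.
- rewrite /= pw andbT; apply/allP => y yt; apply/asboolP => yx.
  by apply: no; exists y.
Qed.

End Transversal.

Lemma indexed_transversal (A : eqType) (E : A -> A -> Prop) (t : seq A) :
  (forall x y, E x y -> E y x) -> pairwise (fun x y => ~~ `[< E y x >]) t ->
  forall i j : 'I_(size t), E (tnth (in_tuple t) i) (tnth (in_tuple t) j) -> i = j.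
Proof.
move=> sym; case: t => [|x0 t] pw; first by case.
move=> i j; rewrite !(tnth_nth x0) /= => eij; apply: val_inj => /=.
move/(pairwiseP x0): pw => pw.
by case: (ltngtP i j) => // ij; [have := pw i j|have := pw j i];
  rewrite !inE => /(_ (ltn_ord _) (ltn_ord _) ij)/asboolP[] //; apply: sym.
Qed.

Section Orbits.
Context {p k : nat} {Gi : 'I_p -> groupType} {G : groupType}.
Context {iota : forall i, group_hom (Gi i) G} {b : 'I_k -> G}.
Hypothesis hG : is_free_product iota b.
Context {T : ctree G} (hT : outer_ctree iota T).
Implicit Types (u v w x y z : T) (g h : G) (e f : T * T).

Definition vorbit u v : Prop := exists g, v = cact g u.

Definition eorbit e f : Prop := exists g,
  (f.1 = cact g e.1 /\ f.2 = cact g e.2) \/ (f.1 = cact g e.2 /\ f.2 = cact g e.1).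

Lemma vorbitxx u : vorbit u u.
Proof. by exists 1%g; rewrite cact1. Qed.

Lemma eorbitxx e : eorbit e e.
Proof. by exists 1%g; left; rewrite !cact1. Qed.

Lemma eorbit_act e u v g : eorbit e (u, v) -> eorbit e (cact g u, cact g v).
Proof.
by case=> h /= [[-> ->]|[-> ->]]; exists (g * h)%g; rewrite !cactM; [left|right].
Qed.

Lemma eorbit_flip e u v : eorbit e (u, v) -> eorbit e (v, u).
Proof. by case=> g /= [[-> ->]|[-> ->]]; exists g; [right|left]. Qed.

Lemma mem_separates x y u v : separates u v x y -> (u, v) \in zip (x :: geo x y) (geo x y).
Proof.
move=> /andP[n1 n2]; rewrite (geo_sep n1 n2).
suff key s z t : (last x s, z) \in zip (x :: s ++ z :: t) (s ++ z :: t).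
  by have := key (geo x u) v (geo v y); rewrite last_geo.
elim: s x {n1 n2} => [|z' s IH] x /=; first by rewrite mem_head.
by rewrite inE IH orbT.
Qed.

Lemma factor_fixed i : exists w : T, forall a, cact (iota i a) w = w.
Proof.
have [v [h _ e] _] := oc_factor hT i; exists (cact h v) => a.
have : tstab v (iota i a ^ h)%g by rewrite -e; exists (iota i a) => //; exists a.
rewrite /tstab /= /conjg !cactM => /(congr1 (cact h)); rewrite cactK => ->.
by [].
Qed.

Lemma vorbit_sym u v : vorbit u v -> vorbit v u.
Proof. by case=> g ->; exists g^-1%g; rewrite cactVK. Qed.

Lemma eorbit_sym e f : eorbit e f -> eorbit f e.
Proof.
by case=> g [[e1 e2]|[e1 e2]]; exists g^-1%g; rewrite e1 e2 !cactVK; [left|right].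
Qed.

Hypothesis hull : forall w u v, cadj u v ->
  exists g h, separates u v (cact g w) (cact h w).

Lemma finite_edge_orbits : exists es : seq (T * T),
  (forall e, e \in es -> cadj e.1 e.2) /\
  forall u v, cadj u v -> exists2 e, e \in es & eorbit e (u, v).
Proof.
have [w wfix] := choice factor_fixed; pose o := cbase T.
pose ed x := zip (o :: geo o x) (geo o x).
pose es := flatten [seq ed x | x <- codom w ++ codom (fun j => cact (b j) o)].
pose cov u v := exists2 e, e \in es & eorbit e (u, v).
have covx x u v : x \in codom w ++ codom (fun j => cact (b j) o) ->
    separates u v o x -> cov u v.
  move=> xin s; exists (u, v); last exact: eorbitxx.
  by apply/flattenP; exists (ed x); [apply: map_f|apply: mem_separates].
have covA g u v : cov (cact g u) (cact g v) -> cov u v.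
  move=> [e ee ev]; exists e => //.
  by have := eorbit_act g^-1%g ev; rewrite -!cactM mulVg !cact1.
have covF u v : cov v u -> cov u v.
  by move=> [e ee ev]; exists e => //; apply: eorbit_flip.
have sepA g u v x y : separates u v x y =
    separates (cact g u) (cact g v) (cact g x) (cact g y) by rewrite separates_act.
have key h : forall u v, separates u v o (cact h o) -> cov u v.
  apply: (free_product_generated hG
    (K := [set h | forall u v, separates u v o (cact h o) -> cov u v])) => /=.
  - move=> u v; rewrite cact1 => /andP[n1 n2].
    by move: (n1); rewrite (nearerP _ (nearer_adj n1)) n2.
  - move=> g g' Kg Kg' u v s; have uv := nearer_adj (andP s).1.
    case/orP: (separates_cat (cact g o) uv s) => [/Kg //|s'].
    apply: (covA g^-1%g); apply: Kg'.
    by move: s'; rewrite (sepA g^-1%g) cactM !cactVK.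
  - move=> g Kg u v s; apply: (covA g); apply: covF; apply: Kg.
    by move: s; rewrite (sepA g) cactK /separates andbC.
  - move=> i a u v s; have uv := nearer_adj (andP s).1.
    have wi : w i \in codom w ++ codom (fun j => cact (b j) o).
      by rewrite mem_cat codom_f.
    case/orP: (separates_cat (w i) uv s) => [|s']; first exact: covx.
    apply: (covA (iota i a)^-1%g); apply: covF; apply: covx wi _.
    move: s'; rewrite (sepA (iota i a)^-1%g) cactVK -{1}(wfix i a) cactVK.
    by rewrite /separates andbC.
  - by move=> j u v; apply: covx; rewrite mem_cat codom_f orbT.
pose es' := [seq e <- es | cadj e.1 e.2].
have cov' u v : cadj u v -> exists2 e, e \in es' & eorbit e (u, v).
  move=> uv; have [g [h s]] := hull o uv.
  have [e ee [f fE]] : cov u v.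
    apply: (covA g^-1%g); apply: (key (g^-1 * h)%g).
    by move: s; rewrite (sepA g^-1%g) cactVK cactM.
  exists e; last by exists f.
  rewrite mem_filter ee andbT -(cadj_act f).
  by case: fE uv => /= -[-> ->] //; rewrite cadjC.
by exists es'; split=> // e; rewrite mem_filter => /andP[].
Qed.

Lemma edge_transversal : exists es : seq (T * T),
  [/\ forall e, e \in es -> cadj e.1 e.2,
      forall u v, cadj u v -> exists2 e, e \in es & eorbit e (u, v) &
      pairwise (fun e f => ~~ `[< eorbit f e >]) es].
Proof.
have [es [ea cov]] := finite_edge_orbits.
have [t [ts tcov pw]] := transversal_exists eorbitxx es.
exists t; split=> // [e /ts /ea //|u v /cov[e /tcov[f ft fe] ev]].
exists f => //; move: fe ev => [g fg] [h hg]; exists (h * g)%g; rewrite !cactM.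
by case: fg hg => /= -[-> ->] [] /= [-> ->]; [left|right|right|left].
Qed.

Lemma vertex_transversal (es : seq (T * T)) :
  (forall u v, cadj u v -> exists2 e, e \in es & eorbit e (u, v)) ->
  exists vs : seq T, (forall u, exists2 v, v \in vs & vorbit v u) /\
    pairwise (fun u v => ~~ `[< vorbit v u >]) vs.
Proof.
move=> cov.
have [t [ts tcov pw]] := transversal_exists vorbitxx (cbase T :: map fst es ++ map snd es).
exists t; split=> // u.
suff [z [zin [g ->]]] : exists z, z \in cbase T :: map fst es ++ map snd es /\ vorbit z u.
  by have [y yt [h ->]] := tcov z zin; exists y => //; exists (g * h)%g; rewrite cactM.
have [uo|/geo_first[x n]] := pselect (u = cbase T).
  by exists (cbase T); rewrite mem_head; split=> //; rewrite uo; exists 1%g; rewrite cact1.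
have [e ee [g ev]] := cov _ _ (nearer_adj n).
case: ev => /= -[_ uE].
  by exists e.2; rewrite inE mem_cat (map_f snd ee) !orbT; split=> //; exists g.
by exists e.1; rewrite inE mem_cat (map_f fst ee) !orbT; split=> //; exists g.
Qed.

Lemma finite_quotient : exists (m n : nat) (re : 'I_m -> T * T) (rv : 'I_n -> T),
  [/\ forall i, cadj (re i).1 (re i).2,
      forall u v, cadj u v -> exists i, eorbit (re i) (u, v),
      forall i j, eorbit (re i) (re j) -> i = j,
      forall u, exists i, vorbit (rv i) u &
      forall i j, vorbit (rv i) (rv j) -> i = j].
Proof.
have [es [ea ecov epw]] := edge_transversal; have [vs [vcov vpw]] := vertex_transversal ecov.
exists (size es), (size vs), (tnth (in_tuple es)), (tnth (in_tuple vs)); split.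
- by move=> i; apply: ea; apply: mem_tnth.
- by move=> u v /ecov[e /(tnthP (in_tuple es))[i ->] ev]; exists i.
- exact: indexed_transversal eorbit_sym epw.
- by move=> u; have [v /(tnthP (in_tuple vs))[i ->] vu] := vcov u; exists i.
- exact: indexed_transversal vorbit_sym vpw.
Qed.

(* A map from edge orbits to [Z/2] is determined by its sums along paths from
   the base point [o] to the representatives of vertex orbits and to the
   points [b_j o]. *)
Section Counting.
Context {m n : nat} (re : 'I_m -> T * T) (rv : 'I_n -> T).
Hypothesis re_adj : forall i, cadj (re i).1 (re i).2.
Hypothesis re_inj : forall i j, eorbit (re i) (re j) -> i = j.
Hypothesis rv_cover : forall u, exists i, vorbit (rv i) u.

Definition parity (w : {ffun 'I_m -> bool}) u v : bool :=
  [exists i, `[< eorbit (re i) (u, v) >] && w i].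

Lemma parityC (w : {ffun _}) u v : parity w u v = parity w v u.
Proof.
by apply: eq_existsb => i; congr (_ && _); apply: asbool_equiv_eq;
  split; apply: eorbit_flip.
Qed.

Lemma parity_act (w : {ffun _}) g u v : parity w (cact g u) (cact g v) = parity w u v.
Proof.
apply: eq_existsb => i; congr (_ && _); apply: asbool_equiv_eq; split.
  by move/(eorbit_act g^-1%g); rewrite !cactVK.
exact: eorbit_act.
Qed.

Lemma parity_re (w : {ffun _}) i : parity w (re i).1 (re i).2 = w i.
Proof.
apply/existsP/idP => [[j /andP[/asboolP ji]]|wi].
  by rewrite (re_inj (i := j) (j := i)) // [re i]surjective_pairing.
by exists i; rewrite wi andbT; apply/asboolP; rewrite -surjective_pairing; apply: eorbitxx.
Qed.

Let D (w : {ffun _}) u v : bool := tdist (parity w) u v.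

Let D_step (w : {ffun _}) z x y : cadj x y -> D w z y = D w z x (+) parity w x y.
Proof.
move=> xy; case nx : (nearer x y z); first exact: tdist_nearer.
have ny : nearer y x z by rewrite nearerP ?nx // cadjC.
have := tdist_nearer (parity w) ny; rewrite -/(D w z x) -/(D w z y) => ->.
by rewrite parityC -[RHS]addbA addbb addbF.
Qed.

Let D_cat (w : {ffun _}) x y z : D w x z = D w x y (+) D w y z.
Proof.
apply: (@tree_ind_to G T y (fun z => D w x z = D w x y (+) D w y z)).
  by rewrite /D tdistxx addbF.
move=> u v nr IH; have vu := nearer_adj nr.
by rewrite !(D_step _ _ vu) IH addbA.
Qed.

Let D_act (w : {ffun _}) g x y : D w (cact g x) (cact g y) = D w x y.
Proof. exact/tdist_act/parity_act. Qed.

Lemma edge_orbits_bound : (m <= k + n)%N.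
Proof.
pose o := cbase T.
pose F (w : {ffun 'I_m -> bool}) : {ffun 'I_k -> bool} * {ffun 'I_n -> bool} :=
  ([ffun j => D w o (cact (b j) o)], [ffun i => D w o (rv i)]).
have Finj : injective F.
  (* [Q] is additive on the orbit of [o]. It vanishes at the [b j] by assumption, and on the factors
     because each of them fixes a vertex. *)
  move=> w w' [/ffunP eb /ffunP ev]; pose Q u := D w o u (+) D w' o u.
  have Qb j : Q (cact (b j) o) = false by have := eb j; rewrite !ffunE /Q => ->; rewrite addbb.
  have Qv i : Q (rv i) = false by have := ev i; rewrite !ffunE /Q => ->; rewrite addbb.
  have Qact g u : Q (cact g u) = Q (cact g o) (+) Q u.
    rewrite /Q (D_cat w o (cact g o)) (D_cat w' o (cact g o)) !D_act.
    by case: (D w o (cact g o)); case: (D w o u); case: (D w' o _); case: (D w' o u).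
  have Q0 g : Q (cact g o) = false.
    apply: (free_product_generated hG (K := [set g | Q (cact g o) = false])) => /=.
    - by rewrite cact1 /Q /D !tdistxx.
    - by move=> x y qx qy; rewrite cactM Qact qx qy.
    - move=> x qx; have := Qact x (cact x^-1%g o); rewrite cactK qx /= => <-.
      by rewrite /Q /D !tdistxx.
    - move=> i a; have [v vfix] := factor_fixed i.
      by have := Qact (iota i a) v; rewrite vfix; case: (Q v); case: (Q _).
    - exact: Qb.
  have Qz u : Q u = false.
    by have [i [g ->]] := rv_cover u; rewrite Qact Q0 Qv.
  apply/ffunP => i; have := Qz (re i).2; have := Qz (re i).1.
  rewrite /Q !(D_step _ _ (re_adj i)) !parity_re.
  by case: (D w _ _); case: (D w' _ _); case: (w i); case: (w' i).
have := leq_card F Finj; rewrite card_prod !card_ffun !card_ord card_bool -expnD.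
by rewrite leq_exp2l.
Qed.

End Counting.
End Orbits.

(** * Bounding the number of vertex orbits *)

Section OrbitBound.
Context {p k : nat} {Gi : 'I_p -> groupType} {G : groupType}.
Context {iota : forall i, group_hom (Gi i) G} {b : 'I_k -> G}.
Context {T : ctree G} (hT : outer_ctree iota T).
Context {m n : nat} (re : 'I_m -> T * T) (rv : 'I_n -> T).
Hypothesis re_cover : forall u v, cadj u v -> exists i, eorbit (re i) (u, v).
Hypothesis rv_inj : forall i j, vorbit (rv i) (rv j) -> i = j.
Hypothesis degree3 : forall v : T, ~ nonfree v -> exists x y z,
  [/\ [/\ cadj v x, cadj v y & cadj v z], x <> y, y <> z & x <> z].

Lemma nonfree_orbits_bound : (#|[set i | `[< nonfree (rv i) >]]%SET| <= p.+1)%N.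
Proof.
have /choice[f fE] : forall i, exists j : option 'I_p, nonfree (rv i) ->
    exists2 j', j = Some j' & factor_conj iota j' (tstab (rv i)).
  move=> i; have [nf|fr] := pselect (nonfree (rv i)); last by exists None.
  have [[j fj]|no] := pselect (exists j, factor_conj iota j (tstab (rv i))).
    by exists (Some j) => _; exists j.
  by case: (oc_free hT _ nf) => j fj; apply: no; exists j.
have inj : {in [set i | `[< nonfree (rv i) >]]%SET &, injective f}.
  move=> i j; rewrite !inE => iF jF.
  have [i' -> fi] := fE i iF; have [j' -> fj] := fE j jF.
  case=> e; subst j'.
  have [v _ uniq] := oc_factor hT i'; apply: rv_inj.
  have [g gi] := uniq _ fi; have [h hj] := uniq _ fj.
  by exists (h * g^-1)%g; rewrite -gi -hj cactM cactVK.
by rewrite -(card_in_imset inj) (leq_trans (max_card _)) // card_option card_ord.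
Qed.

(** Since stabilizers of free vertices are trivial, three edges leaving such a vertex lie in three
    orbits of oriented edges; there are at most [2 m] of these orbits. *)
Lemma free_orbits_bound : (3 * #|[set i | ~~ `[< nonfree (rv i) >]]%SET| <= 2 * m)%N.
Proof.
set F := [set i | _]%SET.
have /choice[nb nbE] : forall i, exists nb : 'I_3 -> T, i \in F ->
    injective nb /\ forall j, cadj (rv i) (nb j).
  move=> i; have [iF|niF] := boolP (i \in F); last by exists (fun=> rv i).
  have fr : ~ nonfree (rv i) by move: iF; rewrite inE => /asboolPn.
  have [x [y [z [[vx vy vz] xy yz xz]]]] := degree3 fr.
  exists (tnth [tuple x; y; z]) => _; split.
    apply/injectiveP; rewrite /injectiveb /dinjectiveb.
    rewrite (map_tnth_enum [tuple x; y; z]) /= !inE.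
    by apply/and3P; split=> //; [apply/norP; split; apply/eqP|apply/eqP].
  by move=> j; rewrite (tnth_nth x); case: j => -[|[|[|]]].
have [->|[i0 i0F]] := finset.set_0Vmem F; first by rewrite cards0 muln0.
have [e0 _] : exists e0 : 'I_m, True.
  by have [_ /(_ ord0)/re_cover[e _]] := nbE _ i0F; exists e.
have /choice[c cE] : forall q : 'I_n * 'I_3, exists c : 'I_m * bool, q.1 \in F ->
    exists g, (rv q.1 = cact g (if c.2 then (re c.1).1 else (re c.1).2)) /\
              (nb q.1 q.2 = cact g (if c.2 then (re c.1).2 else (re c.1).1)).
  move=> [i j]; have [iF|niF] := boolP (i \in F).
    have [_ /(_ j) adj] := nbE i iF; have [e [g eg]] := re_cover adj.
    by case: eg => /= -[e1 e2]; [exists (e, true)|exists (e, false)] => _; exists g.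
  by exists (e0, true).
have inj : {in finset.setX F [set: 'I_3]%SET &, injective c}.
  move=> [i j] [i' j']; rewrite !finset.in_setX !finset.in_setT !andbT => iF i'F cc.
  have [g [g1 g2]] := cE (i, j) iF; have [h [h1 h2]] := cE (i', j') i'F.
  rewrite /= in g1 g2 h1 h2; rewrite -cc in h1 h2.
  have hg : rv i' = cact (h * g^-1)%g (rv i) by rewrite g1 cactM cactVK.
  have ii' : i = i' by apply: rv_inj; exists (h * g^-1)%g.
  subst i'; congr pair; have [nbi _] := nbE i iF; apply: nbi.
  have hg1 : (h * g^-1 = 1)%g.
    apply: contrapT => ne; move: iF; rewrite inE => /asboolPn; apply.
    by exists (h * g^-1)%g.
  have hgE : h = g by rewrite -[g]mul1g -hg1 mulgVK.
  by rewrite h2 g2 hgE.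
have := leq_trans (eq_leq (esym (card_in_imset inj))) (max_card _).
by rewrite cardsX cardsT card_ord card_prod card_ord card_bool mulnC (mulnC m).
Qed.

Lemma vertex_orbits_bound : (3 * n <= 3 * p.+1 + 2 * m)%N.
Proof.
have := nonfree_orbits_bound; have := free_orbits_bound.
have <- : #|~: [set i | `[< nonfree (rv i) >]]%SET| = #|[set i | ~~ `[< nonfree (rv i) >]]%SET|.
  by congr #|pred_of_set _|; apply/setP => i; rewrite !inE.
by have := cardsC [set i | `[< nonfree (rv i) >]]%SET; rewrite card_ord; lia.
Qed.

End OrbitBound.

(** * Trees with indexed edge orbits *)

(** The index set is the same for all trees, so that their length vectors can be compared; some
    indices may belong to no edge. Values of [idx] at nonadjacent vertices carry no meaning. *)
Record indexed_tree (G : groupType) (M : nat) := IndexedTree {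
  itree :> ctree G;
  idx : itree -> itree -> 'I_M;
  idxC : forall u v, idx u v = idx v u;
  idx_act : forall g u v, idx (cact g u) (cact g v) = idx u v;
  idx_orbit : forall u v u' v', cadj u v -> cadj u' v' -> idx u v = idx u' v' ->
    eorbit (u, v) (u', v')
}.

Lemma finite_gap (R : realType) (I : finType) (f : I -> R) :
  exists2 eps : R, 0 < eps & forall i, f i <= 0 \/ eps <= f i.
Proof.
suff [eps e0 h] : exists2 eps : R, 0 < eps &
    forall i, i \in enum I -> f i <= 0 \/ eps <= f i.
  by exists eps => // i; apply: h; rewrite mem_enum.
elim: (enum _) => [|i s [eps e0 h]]; first by exists 1.
have [z|pos] := lerP (f i) 0.
  by exists eps => // j; rewrite inE => /orP[/eqP ->|/h //]; left.
exists (Num.min eps (f i)); first by rewrite lt_min e0.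
move=> j; rewrite inE => /orP[/eqP ->|/h[|le]]; [right|by left|right].
  by rewrite ge_min lexx orbT.
by rewrite ge_min le.
Qed.

Section IndexedTree.
Context {R : realType} {G : groupType} {M : nat} (T : indexed_tree G M).
Implicit Types (u v w a b : T) (g h : G).

Section Weights.
Context (l : 'I_M -> R) (l_ge0 : forall e, 0 <= l e).

Fact iw_gap : exists2 eps : R, 0 < eps &
  forall u v, cadj u v -> l (idx u v) = 0 \/ eps <= l (idx u v).
Proof.
have [eps e0 h] := finite_gap l; exists eps => // u v _.
by case: (h (idx u v)) => [le|]; [left; apply/eqP; rewrite eq_le le l_ge0|right].
Qed.

Definition iweight : wtree R G :=
  @WTree R G T (fun u v => l (idx u v)) (fun u v => l_ge0 _)
    (fun u v => congr1 l (idxC u v)) (fun g u v => congr1 l (idx_act g u v)) iw_gap.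

End Weights.

Definition icount u v : {ffun 'I_M -> nat} :=
  [ffun e => count (pred1 e) (pairmap (@idx G M T) u (geo u v))].

Lemma idist_count (l : 'I_M -> R) l0 u v : wd (W := @iweight l l0) u v = dot (icount u v) l.
Proof.
rewrite /wd /tdist /wlen /icount /dot.
have -> : \sum_e ([ffun e => count (pred1 e) (pairmap (@idx G M T) u (geo u v))] e)%:R * l e
  = \sum_e (count (pred1 e) (pairmap (@idx G M T) u (geo u v)))%:R * l e.
  by apply: eq_bigr => e _; rewrite ffunE.
move: (geo u v) => p; elim: p u {v} => [|a p IH] x /=.
  by rewrite big_nil big1 // => e _; rewrite mul0r.
rewrite big_cons IH [LHS]addrC.
under [RHS]eq_bigr do rewrite natrD mulrDl addrC.
rewrite big_split /=; congr (_ + _).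
rewrite (bigD1 (idx x a)) //= eqxx mul1r big1 ?addr0 // => e ne.
by rewrite eq_sym (negPf ne) mul0r.
Qed.

End IndexedTree.

Section AxisVertex.
Context {G : groupType} (T : ctree G).
Hypothesis no_inversion : forall (u v : T) g, cadj u v -> cact g u = v -> cact g v <> u.
Implicit Types (u v w : T) (g : G).

(* A vertex of minimal displacement lies on the axis. *)
Lemma axis_vertex g : exists u : T, geo u (cact g (cact g u)) =
  geo u (cact g u) ++ map (cact g) (geo u (cact g u)).
Proof.
have [n [[u un] minn]] : exists n, (exists u : T, nsteps u (cact g u) = n) /\
    forall v : T, (n <= nsteps v (cact g v))%N.
  have ex : exists n, `[< exists u : T, nsteps u (cact g u) = n >].
    by exists (nsteps (cbase T) (cact g (cbase T))); apply/asboolP; exists (cbase T).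
  have [n /asboolP h minn] := ex_minnP ex; exists n; split=> // v.
  by apply: minn; apply/asboolP; exists v.
exists u; have ru := geo_red u (cact g u); have lu := last_geo u (cact g u).
have rg := geo_red (cact g u) (cact g (cact g u)).
have lg := last_geo (cact g u) (cact g (cact g u)).
rewrite geo_act in rg lg; rewrite /nsteps in un minn.
move: (geo u (cact g u)) ru lu rg lg un => [|z q].
  by move=> _ /= gu _ _ _; rewrite -!gu geoxx.
move=> ru lu rg lg un; apply: geo_uniq; last by rewrite last_cat lu lg.
(* If the path from [u] to [g u] is one edge, a backtrack at [g u] is an inversion. If it is longer,
   its second vertex [z] would be displaced by two edges less than [u]. *)
case/lastP: q ru lu rg lg un => [|q w] ru lu rg lg un.
  have zgu : z = cact g u by [].
  have adj : cadj u (cact g u) by move: ru; rewrite zgu redp_cons => /and3P[].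
  apply: (redp_cat (p := [::])); rewrite // -?zgu //; first by move: rg; rewrite -zgu.
  by apply/eqP => e; apply: (no_inversion adj erefl); rewrite -zgu.
have wgu : w = cact g u by move: lu; rewrite /= last_rcons.
subst w; rewrite -rcons_cons; apply: redp_cat; [exact: ru|exact: rg|].
apply/eqP => /= lz; have := minn z; rewrite -un /= size_rcons.
suff -> : geo z (cact g z) = q by lia.
apply: geo_uniq; last by [].
have : redp (@cadj G T) u ((z :: q) ++ [:: cact g u]) by rewrite cats1.
by case/redp_split/andP; rewrite redp_cons => /and3P[].
Qed.

End AxisVertex.

(** * Translation lengths and elliptic elements *)

(** A point [x] moved by [t] yields [n tau <= 2 d z x + n t] for all [n], so no displacement is
    below the growth rate [tau] of the orbit of [z]. *)
Lemma translation_lengthE (R : realType) (G : groupType) (Y : gtree R G) g (z : Y) (tau : R) :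
  (forall n, mdist z (iter n (act g) z) = n%:R * tau) -> translation_length Y g = tau.
Proof.
move=> zn; have disp (x : Y) n : mdist x (iter n (act g) x) <= n%:R * mdist x (act g x).
  elim: n => [|n IH]; first by rewrite mdistxx mul0r.
  have := metric_triangle x (act g x) (iter n.+1 (act g) x).
  by rewrite iterS act_isometry -natr1 mulrDl mul1r; lra.
have iso (x y : Y) n : mdist (iter n (act g) x) (iter n (act g) y) = mdist x y.
  by elim: n => [|n IH] //=; rewrite act_isometry.
have lb (x : Y) : tau <= mdist x (act g x).
  rewrite leNgt; apply/negP => lt; pose t := mdist x (act g x).
  pose n := Num.bound (2 * mdist z x / (tau - t)).
  have := archi_boundP (x := 2 * mdist z x / (tau - t)).
  have dt : 0 < tau - t by rewrite subr_gt0.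
  rewrite divr_ge0 ?(ltW dt) ?mulr_ge0 ?mdist_ge0 // => /(_ isT).
  rewrite -/n ltr_pdivrMr // => nlt.
  have := metric_triangle z x (iter n (act g) z).
  have := metric_triangle x (iter n (act g) x) (iter n (act g) z).
  have := disp x n; rewrite zn iso (metric_sym x z) -/t; lra.
apply/eqP; rewrite eq_le; apply/andP; split.
  have -> : tau = mdist z (act g z) by have := zn 1%N; rewrite mul1r.
  apply: ge_inf; last by exists z.
  by exists 0 => _ [x _ <-]; apply: mdist_ge0.
apply: lb_le_inf; first by exists (mdist z (act g z)), z.
by move=> _ [x _ <-].
Qed.

Section AxisLength.
Context {R : realType} {G : groupType} (W : wtree R G) (u : W) (g : G).
Hypothesis axis : geo u (cact g (cact g u)) =
  geo u (cact g u) ++ map (cact g) (geo u (cact g u)).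

(** The hypothesis settles two steps, and the four-point condition propagates additivity; when
    [tau = 0] the triangle inequality does it. *)
Lemma axis_iter n : wd u (iter n (cact g) u) = n%:R * wd u (cact g u).
Proof.
set tau := wd u (cact g u); pose x n := iter n (cact g) u.
have sh i j : wd (x i.+1) (x j.+1) = wd (x i) (x j) by rewrite /x /= wd_act.
have d2 : wd (x 0%N) (x 2%N) = 2 * tau.
  rewrite /wd /tdist /x /= axis wlen_cat last_geo mulr2n mulrDl mul1r; congr (_ + _).
  rewrite -geo_act; exact: (wd_act g u (cact g u)).
have d1 i : wd (x i) (x i.+1) = tau by elim: i => [|i IH] //; rewrite sh.
have d2' i : wd (x i) (x i.+2) = 2 * tau by elim: i => [|i IH] //; rewrite sh.
have t0 : 0 <= tau := wd_ge0 _ _.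
suff [] : wd (x 0%N) (x n) = n%:R * tau /\ wd (x 0%N) (x n.+1) = n.+1%:R * tau by [].
elim: n => [|n [IH1 IH2]]; first by rewrite wdxx mul0r mul1r d1.
split=> //.
have := wd4 (x 0%N) (x n.+1) (x n) (x n.+2).
have := wd_tri (x n.+1) (x 0%N) (x n.+2).
rewrite d2' !d1 IH1 IH2 -[n.+2%:R]natr1 -![n.+1%:R]natr1 !mulrDl !mul1r => h1 h2.
have [tz|tp] : tau = 0 \/ 0 < tau by lra.
  by rewrite tz !mulr0 in h1 h2 *; have := wd_ge0 (x 0%N) (x n.+2); lra.
by move: h2; rewrite (wdC (x n.+1)) d1; case; lra.
Qed.

(** As [u] is chosen in the combinatorial tree, before the lengths, the translation length of [g] is
    one fixed linear function of the length vector. *)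
Lemma axis_realize_length : translation_length (realize W) g = wd u (cact g u).
Proof.
apply: (@translation_lengthE R G (realize W) g (rv u)) => n.
rewrite -axis_iter -mdist_rv; congr mdist.
by elim: n => [|n IH] //=; rewrite IH /= ract_rv.
Qed.

End AxisLength.

Section Elliptic.
Context {p : nat} {Gi : 'I_p -> groupType} {G : groupType}.
Context (iota : forall i, group_hom (Gi i) G).

(** It refers to the factors alone, which makes hyperbolicity the same in all trees. *)
Definition elliptic (g : G) : Prop := g = 1%g \/ exists i A, factor_conj iota i A /\ A g.

Lemma factor_conj_stab (T : ctree G) i A : outer_ctree iota T -> factor_conj iota i A ->
  exists v : T, tstab v = A.
Proof.
move=> hT [h _ <-]; have [v [h0 _ e0] _] := oc_factor hT i.
exists (cact (h^-1 * h0)%g v); apply/seteqP; split=> g.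
  rewrite /tstab /= -cactM => e.
  have : tstab v (g ^ (h^-1 * h0))%g.
    rewrite /tstab /= /conjg cactM.
    by rewrite -[RHS](cactVK (h^-1 * h0)%g) -[in RHS]e.
  rewrite -e0 => -[a ia ea]; exists a => //.
  by rewrite -[RHS](conjgK (h^-1 * h0)%g) -ea -conjgM invgM invgK mulVKg.
move=> [a ia <-]; rewrite /tstab /=.
have : tstab v (a ^ h0)%g by rewrite -e0; exists a.
rewrite /tstab /= => e; rewrite -[in RHS]e -!cactM; congr cact.
by rewrite /conjg !mulgA mulgK -!mulgA mulVKg !mulgA.
Qed.

Lemma ctree_elliptic (T : ctree G) g : outer_ctree iota T ->
  (exists u : T, cact g u = u) <-> elliptic g.
Proof.
move=> hT; split=> [[u gu]|[->|[i [A [fA Ag]]]]].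
- have [->|g1] := pselect (g = 1%g); first by left.
  right; apply: contrapT => no; apply: (oc_free hT (v := u)); last by exists g.
  by move=> i fi; apply: no; exists i, (tstab u).
- by exists (cbase T); rewrite cact1.
- by have [v vA] := factor_conj_stab hT fA; exists v; move: Ag; rewrite -vA.
Qed.

Lemma outer_space_elliptic (R : realType) (X : gtree R G) g : outer_space iota X ->
  (exists x : X, act g x = x) <-> elliptic g.
Proof.
move=> hX; rewrite -(ctree_elliptic g (x_outer hX)).
split=> [[x gx]|[u /(congr1 val) gu]]; last by exists (val u).
have [vx|nvx] := pselect (vertices x); first by exists (xv vx); apply: val_inj.
have [//|[e ee ex]] := points_cover x.
have gex : (act g @` e) x by exists x.
have g1 : g = 1%g.
  apply: (edge_fixed hX ee); apply: contrapT => ne; apply: nvx.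
  by have [] := edges_meet (act_edges g ee) ee ne gex ex.
by exists (cbase (xtree X)); rewrite g1 cact1.
Qed.

Lemma Hyp_elliptic (R : realType) (X : gtree R G) g : outer_space iota X ->
  Hyp (R := R) iota g <-> ~ elliptic g.
Proof.
move=> hX; split=> [hg /(outer_space_elliptic g hX)[x]|ne Y hY x gx]; first exact: hg.
by apply/ne/(outer_space_elliptic g hY); exists x.
Qed.

Lemma Aut_factor_conj (Phi : group_hom G G) i A : Aut_O iota Phi -> factor_conj iota i A ->
  exists j, factor_conj iota j (Phi @` A).
Proof.
move=> [_ aut] fA.
have : [set [set Phi @` A | A in C] | C in factor_classes iota]
    [set Phi @` A | A in conjugacy_class (range (iota i))].
  by exists (conjugacy_class (range (iota i))) => //; exists i.
rewrite aut => -[j _ e]; exists j.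
have : [set Phi @` A | A in conjugacy_class (range (iota i))] (Phi @` A) by exists A.
by rewrite -e.
Qed.

Lemma Aut_elliptic (Phi : group_hom G G) g : Aut_O iota Phi -> elliptic g ->
  elliptic (Phi g).
Proof.
move=> aut [->|[i [A [fA Ag]]]]; first by left; rewrite gmulf1.
have [j fj] := Aut_factor_conj aut fA; right; exists j, (Phi @` A).
by split=> //; exists g.
Qed.

End Elliptic.

(** * Equivariant maps to realizations *)

Section FixedPoints.
Context {R : realType} {p : nat} {Gi : 'I_p -> groupType} {G : groupType}.
Context {iota : forall i, group_hom (Gi i) G} (W : wtree R G).
Hypothesis hT : outer_ctree iota W.
Implicit Types (u v w a b : W) (g h : G) (z q : rpt W).

Lemma first_positive_edge u v : 0 < wd u v ->
  exists a b, [/\ separates a b u v, 0 < wd a b & wd u a = 0].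
Proof.
apply: (@tree_ind_to G W v (fun u => 0 < wd u v ->
  exists a b, [/\ separates a b u v, 0 < wd a b & wd u a = 0])).
  by rewrite wdxx ltxx.
move=> {}u u1 n IH uv; have [l0|l0] : 0 < wd u u1 \/ wd u u1 = 0.
  by have := wd_ge0 u u1; rewrite le_eqVlt => /orP[/eqP <-|]; [right|left].
  by exists u, u1; split; rewrite ?wdxx //; apply: next_edge_separates.
have [|a [b [s ab ua]]] := IH; first by rewrite (wd_first n) l0 add0r in uv.
exists a, b; split=> //; first exact: next_separates s.
by apply/eqP; rewrite eq_le wd_ge0 andbT (le_trans (wd_tri u1 u a)) // l0 ua addr0.
Qed.

Lemma fixed_vertex g z : g <> 1%g -> ract g z = z -> exists u, z = rv u.
Proof.
move=> g1 gz; have [[u _ <-]|[e [a [b [ab l0 ->]]] /redgeP[t /andP[t0 t1] zE]]] := redge_cover z.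
  by exists u.
have [tz|tn0] := eqVneq t 0; first by exists a; rewrite zE tz rp0.
have [tz|tn1] := eqVneq t (wd a b); first by exists b; rewrite zE tz rp1.
have tp : 0 < t by rewrite lt_neqAle eq_sym tn0.
have tl : t < wd a b by rewrite lt_neqAle tn1.
have gab : cadj (cact g a) (cact g b) by rewrite cadj_act.
move: gz; rewrite zE ract_rp // => /esym eg.
have t1' : t <= wd (cact g a) (cact g b) by rewrite wd_act.
have [[ga gb]|[ga gb]] := redge_interior ab gab tp tl t0 t1' eg.
  by case: g1; apply: (oc_edge hT ab).
by case: (oc_inversion hT ab ga gb).
Qed.

(** Otherwise [g] fixes the segment between the two points, hence its first edge of positive length,
    although edge stabilizers are trivial. *)
Lemma fixed_unique g z q : g <> 1%g -> ract g z = z -> ract g q = q -> z = q.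
Proof.
move=> g1 gz gq; have [u zu] := fixed_vertex g1 gz; have [v qv] := fixed_vertex g1 gq.
subst z q; move: gz gq; rewrite !ract_rv => gu gv.
apply/rv_eq/eqP; rewrite eq_le wd_ge0 andbT leNgt; apply/negP => uv.
have [a [b [s l0 ua]]] := first_positive_edge uv.
have /andP[nu nv] := s; have ab := nearer_adj nu.
have rua : rv u = rv a by apply/rv_eq.
have gab : cadj (cact g a) (cact g b) by rewrite cadj_act.
have rga : rv (cact g a) = rv a by rewrite -ract_rv -rua ract_rv gu.
have agv : wd (cact g a) v = wd (cact g a) (cact g b) + wd (cact g b) v.
  by rewrite -!mdist_rv -gv !mdist_rv !wd_act; apply: wd_first.
have av : wd a v = wd a b + wd b v by apply: wd_first.
have aga : wd a (cact g a) = 0 by apply/rv_eq.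
have e1 : wd (cact g a) v = wd a v by rewrite -[LHS]mdist_rv rga mdist_rv.
have e2 : wd (cact g b) a = wd a b by rewrite wdC -[LHS]mdist_rv -rga mdist_rv wd_act.
have rgb : rv b = rv (cact g b).
  apply: mdist_eq; rewrite mdist_rv; rewrite wd_act in agv.
  have := wd_ge0 b (cact g b); have := wdC b a.
  case: (wd4 b (cact g b) a v) => h ba ge; clear -h ba ge agv av e1 e2; lra.
have := @redge_ends _ _ _ a b (cact g a) (cact g b) (esym rga) rgb.
move/(redge_inj ab gab l0) => [[ga gb]|[ga gb]].
  by apply: g1; apply: (oc_edge hT ab).
by case: (oc_inversion hT ab ga gb).
Qed.

End FixedPoints.

Section TwistedSpace.
Context {R : realType} {G : groupType} (W : wtree R G) (phi : group_hom G G).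

Fact rspace1 (z : rpt W) : ract (phi 1%g) z = z.
Proof. by rewrite gmulf1 ract1. Qed.

Fact rspaceM g h (z : rpt W) : ract (phi (g * h)%g) z = ract (phi g) (ract (phi h) z).
Proof. by rewrite gmulfM ractM. Qed.

(** The group acts through [phi], so that maps equivariant up to [Phi] become equivariant maps into
    this space, and the elimination applies to them. *)
Definition rspace : hspace R G :=
  @HSpace R G (rpt W) (rv (cbase W)) (@mdist R (rpt W)) (fun g z => ract (phi g) z)
    (@mdistxx _ _) (@metric_sym _ _) (@mdist4 R G W) (@rpt_geodesic R G W)
    rspace1 rspaceM (fun g => @mdist_ract R G W (phi g)).

End TwistedSpace.

Section EquivariantMaps.
Context {R : realType} {G : groupType} {M n : nat}.
Context (T : indexed_tree G M) (rep : 'I_n -> T) (S : pred 'I_M).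
Hypothesis rep_cover : forall u, exists i, vorbit (rep i) u.
Hypothesis rep_inj : forall i j, vorbit (rep i) (rep j) -> i = j.
Implicit Types (u v : T) (g h : G).

Definition unit_weight (e : 'I_M) : {ffun 'I_M -> nat} := [ffun f => (f == e : nat)].

Lemma dot_unit e (r : 'I_M -> R) : dot (unit_weight e) r = r e.
Proof.
rewrite /dot (bigD1 e) //= ffunE eqxx mul1r big1 ?addr0 // => f ne.
by rewrite ffunE (negPf ne) mul0r.
Qed.

Lemma wsize_unit e : wsize (unit_weight e) = 1%N.
Proof.
rewrite /wsize (bigD1 e) //= ffunE eqxx big1 // => f ne.
by rewrite ffunE (negPf ne).
Qed.

(** This lets one constraint stand for a whole stabilizer, which may be infinite. *)
Definition fixes_stabilizers (Y : hspace R G) : Prop :=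
  forall u g z, g <> 1%g -> tstab u g -> hd z (hact g z) <= 0 ->
  forall h, tstab u h -> @hact R G Y h z = z.

(* One constraint for each orbit of edges in [S], and one for each orbit of
   nonfree vertices, whose image has to be fixed by one nontrivial element of
   the stabilizer. *)
Lemma equivariant_maps : exists H : seq (hcstr (G := G) (M := M)),
  [/\ {in H, forall x, (wsize x.2 <= 3 ^ n)%N},
      forall (l : 'I_M -> R) (l0 : forall e, 0 <= l e) (r : 'I_M -> R),
        (forall e, 0 <= r e) -> (forall e, S e -> l e <= r e) ->
        {in H, forall x, moves (rspace (iweight T l0) idfun) x.1 (dot x.2 r)} &
      forall Y : hspace R G, fixes_stabilizers Y -> forall r, (forall e, 0 <= r e) ->
        {in H, forall x, moves Y x.1 (dot x.2 r)} ->
        exists f : T -> Y, (forall g v, f (cact g v) = hact g (f v)) /\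
          forall u v, cadj u v -> S (idx u v) -> hd (f u) (f v) <= r (idx u v)].
Proof.
pose edge_cstr e (x : option (cstr (G := G) (I := T) (M := M))) :=
  exists u v g h i j, [/\ cadj u v, idx u v = e, u = cact g (rep i), v = cact h (rep j) &
    x = Some (rep i, (g^-1 * h)%g, rep j, unit_weight e)].
have /choice[ce ceP] : forall e, exists x, (forall u v, cadj u v -> idx u v = e -> edge_cstr e x) /\
    (x <> None -> edge_cstr e x).
  move=> e; have [[u [v [uv uve]]]|no] := pselect (exists u v, cadj u v /\ idx u v = e).
    have [i [g ug]] := rep_cover u; have [j [h vh]] := rep_cover v.
    exists (Some (rep i, (g^-1 * h)%g, rep j, unit_weight e)).
    suff ec : edge_cstr e (Some (rep i, (g^-1 * h)%g, rep j, unit_weight e)) by split.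
    by exists u, v, g, h, i, j.
  by exists None; split=> // u v uv uve; case: no; exists u, v.
pose stab_cstr i (x : option (cstr (G := G) (I := T) (M := M))) :=
  exists2 g, g <> 1%g /\ tstab (rep i) g & x = Some (rep i, g, rep i, [ffun=> 0%N]).
have /choice[cs csP] : forall i, exists x, (nonfree (rep i) -> stab_cstr i x) /\
    (x <> None -> stab_cstr i x).
  move=> i; have [nf|fr] := pselect (nonfree (rep i)); last by exists None.
  have [g ug g1] := nf; exists (Some (rep i, g, rep i, [ffun=> 0%N])).
  suff sc : stab_cstr i (Some (rep i, g, rep i, [ffun=> 0%N])) by split.
  by exists g.
pose L := pmap ce (seq.filter S (enum 'I_M)) ++ pmap cs (enum 'I_n).
have Lin x : x \in L -> (exists2 e, S e & ce e = Some x) \/ exists i, cs i = Some x.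
  rewrite mem_cat !mem_pmap => /orP[/mapP[e]|/mapP[i _ ->]]; last by right; exists i.
  by rewrite mem_filter => /andP[Se _] ->; left; exists e.
have [|H [Hsize Hsat]] := @tree_elimination R G T M (codom rep) L 1.
  move=> x /Lin[[e _ ex]|[i ix]].
    have [_ []] := ceP e; first by rewrite ex.
    move=> u [v [g [h [i [j [_ _ _ _]]]]]]; rewrite ex => -[->].
    by rewrite /= !codom_f /csize /= wsize_unit.
  have [_ []] := csP i; first by rewrite ix.
  move=> g _; rewrite ix => -[->]; rewrite /= codom_f /csize /= /wsize.
  by rewrite big1 // => e _; rewrite ffunE.
exists H; split.
- by move=> x /Hsize; rewrite size_codom card_ord muln1.
(* The vertices themselves solve the system in the realization with lengths [l]. *)
- move=> l l0 r r0 lr; apply: (iffRL (Hsat _ r r0)); exists (@rv R G (iweight T l0)) => x /Lin[[e Se ex]|[i ix]].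
    have [_ []] := ceP e; first by rewrite ex.
    move=> u [v [g [h [i [j [uv ue ug vh]]]]]]; rewrite ex => -[->].
    rewrite /= dot_unit ract_rv mdist_rv -(wd_act g) -cactM mulVKg -ug -vh.
    by rewrite wd_adj //= ue lr.
  have [_ []] := csP i; first by rewrite ix.
  move=> g [_ gi]; rewrite ix => -[->]; rewrite /= ract_rv gi mdistxx.
  exact: dot_ge0.
- move=> Y fixY r r0 /(iffLR (Hsat Y r r0))[y sy].
  have yfix i h : tstab (rep i) h -> hact h (y (rep i)) = y (rep i).
    move=> hi; have [->|h1] := pselect (h = 1%g); first exact: hact1.
    have [nf _] := csP i; have [|g [g1 gi] ci] := nf; first by exists h.
    apply: (fixY (rep i) g) => //.
    have := sy (rep i, g, rep i, [ffun=> 0%N]); rewrite mem_cat orbC mem_pmap -ci map_f ?mem_enum //.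
    by move=> /(_ isT) /=; rewrite /dot big1 // => e _; rewrite ffunE mul0r.
  have /choice[c cE] : forall v, exists c : 'I_n * G, v = cact c.2 (rep c.1).
    by move=> v; have [i [g ->]] := rep_cover v; exists (i, g).
  pose f v := hact (c v).2 (y (rep (c v).1)).
  (* The choice of [g] does not matter, since the stabilizer of a representative fixes the point
     chosen for it. *)
  have fE v i g : v = cact g (rep i) -> f v = hact g (y (rep i)).
    move=> vE; rewrite /f; have := cE v; move: (c v) => [j h] /= vE'.
    have ij : i = j.
      by apply: rep_inj; exists (h^-1 * g)%g; rewrite cactM -vE vE' cactVK.
    subst j; have hg : tstab (rep i) (g^-1 * h)%g by rewrite /tstab /= cactM -vE' vE cactVK.
    by rewrite -[in RHS](yfix i _ hg) -hactM mulVKg.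
  have feq g v : f (cact g v) = hact g (f v).
    have [i [h vE]] := rep_cover v.
    by rewrite (fE _ i (g * h)%g) ?(fE v i h) ?hactM ?cactM ?vE.
  exists f; split=> // u v uv Se.
  have [/(_ u v uv erefl)[a [b [g [h [i [j [ab abe ag bh ex]]]]]]] _] := ceP (idx u v).
  have fab : hd (f a) (f b) <= r (idx u v).
    rewrite (fE a i g) // (fE b j h) // hdC -hactVd hdC -hactM.
    have := sy (rep i, (g^-1 * h)%g, rep j, unit_weight (idx u v)).
    rewrite mem_cat mem_pmap -ex map_f; last by rewrite mem_filter Se mem_enum.
    by move=> /(_ isT) /=; rewrite dot_unit.
  by have [k [[/= -> ->]|[/= -> ->]]] := idx_orbit ab uv abe;
    rewrite !feq hactd idx_act ?(hdC (f b)) ?(idxC b) abe.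
Qed.

End EquivariantMaps.

Section Count.
Context {R : realType} {G : groupType} {M : nat} (T : indexed_tree G M).

Lemma realize_length_count g :
    (forall (u v : T) g, cadj u v -> cact g u = v -> cact g v <> u) ->
  exists c : {ffun 'I_M -> nat}, forall (l : 'I_M -> R) (l0 : forall e, 0 <= l e),
    translation_length (realize (iweight T l0)) g = dot c l.
Proof.
move=> /axis_vertex/(_ g)[u hu]; exists (icount u (cact g u)) => l l0.
by rewrite (@axis_realize_length R G (iweight T l0) u g hu) idist_count.
Qed.

Lemma moves_length (l : 'I_M -> R) (l0 : forall e, 0 <= l e) g s :
    (forall (u v : T) g, cadj u v -> cact g u = v -> cact g v <> u) ->
  (exists z : rpt (iweight T l0), mdist z (ract g z) <= s) <->
  translation_length (realize (iweight T l0)) g <= s.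
Proof.
move=> /axis_vertex/(_ g)[u hu]; split=> [[z]|].
  apply: le_trans; apply: ge_inf; last by exists z.
  by exists 0 => _ [x _ <-]; apply: mdist_ge0.
by rewrite (@axis_realize_length R G (iweight T l0) u g hu) => le; exists (@rv R G (iweight T l0) u); rewrite ract_rv mdist_rv.
Qed.

End Count.

Lemma tdist_ext (R : realType) (G : groupType) (T : ctree G) (w w' : T -> T -> R) u v :
  (forall a b, cadj a b -> w a b = w' a b) -> tdist w u v = tdist w' u v.
Proof.
move=> ww; apply: (@tree_ind_to G T v (fun u => tdist w u v = tdist w' u v)).
  by rewrite !tdistxx.
by move=> a b n IH; rewrite !(tdist_first _ n) IH ww // cadjC (nearer_adj n).
Qed.

Lemma eorbit_trans (G : groupType) (T : ctree G) (e f k : T * T) :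
  eorbit e f -> eorbit f k -> eorbit e k.
Proof.
case: f k => [a b] [c d] ef [h /= [[-> ->]|[-> ->]]]; first exact: eorbit_act.
by apply: eorbit_flip; apply: eorbit_act.
Qed.

(** * Encoding a point of the outer space by a tree and a length vector *)

Section MarkedTree.
Context {p k : nat} {Gi : 'I_p -> groupType} {G : groupType}.
Context (iota : forall i, group_hom (Gi i) G).

Record marked_tree (M : nat) (T : indexed_tree G M) : Prop := MarkedTree {
  mt_outer : outer_ctree iota T;
  mt_hull : forall (w a b : T), cadj a b -> exists g h, separates a b (cact g w) (cact h w);
  mt_degree3 : forall v : T, ~ nonfree v -> exists a b c : T,
    [/\ [/\ cadj v a, cadj v b & cadj v c], a <> b, b <> c & a <> c];
  mt_rep : exists n (rep : 'I_n -> T), [/\ (n <= M)%N,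
    forall u, exists i, vorbit (rep i) u & forall i j, vorbit (rep i) (rep j) -> i = j]
}.

Context {R : realType} {b : 'I_k -> G}.
Hypothesis hG : is_free_product iota b.
Context {X : gtree R G} (hX : outer_space iota X).
Hypothesis some_edge : exists u v : xtree X, cadj u v.
(** The bounds [m <= k + n] and [3 n <= 3 (p + 1) + 2 m] give [n <= 3 p + 2 k + 3] and
    [m <= 3 (p + k + 1)]. The successor makes the index type nonempty, which provides a default
    index. *)
Local Notation M := (3 * (p + k).+1).+1.

Definition pick_idx m (re : 'I_m -> xtree X * xtree X) (u v : xtree X) : 'I_M :=
  if [pick i | `[< eorbit (re i) (u, v) >]] is Some i then inord i else ord0.

Lemma outer_space_marked : exists (T : indexed_tree G M) (l : 'I_M -> R) (l0 : forall e, 0 <= l e),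
  [/\ marked_tree T, (exists u v : T, cadj u v), (forall u v : T, cadj u v -> 0 < l (idx u v)),
      forall e, 0 < l e -> exists u v : T, cadj u v /\ idx u v = e &
      forall g, translation_length X g = translation_length (realize (iweight T l0)) g].
Proof.
have hT := x_outer hX; have hull := x_hull hX.
have [m [n [re [rv [re_adj re_cover re_inj rv_cover rv_inj]]]]] := finite_quotient hG hT hull.
have deg (v : xtree X) : ~ nonfree v -> exists x y z : xtree X,
    [/\ [/\ cadj v x, cadj v y & cadj v z], x <> y, y <> z & x <> z].
  by move=> fv; exact: (x_degree3 hX fv some_edge).
have mkn := edge_orbits_bound hG hT re_adj re_inj rv_cover.
have nb := vertex_orbits_bound hT re_cover rv_inj deg.
pose ix := pick_idx re.
have ixC u v : ix u v = ix v u.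
  rewrite /ix /pick_idx; congr (if _ is Some i then _ else _).
  by apply: eq_pick => i; apply: asbool_equiv_eq; split; apply: eorbit_flip.
have ixA g u v : ix (cact g u) (cact g v) = ix u v.
  rewrite /ix /pick_idx; congr (if _ is Some i then _ else _).
  apply: eq_pick => i; apply: asbool_equiv_eq; split; last exact: eorbit_act.
  by move/(eorbit_act g^-1%g); rewrite !cactVK.
have ixE u v : cadj u v -> exists2 i : 'I_m, ix u v = inord i & eorbit (re i) (u, v).
  move=> uv; rewrite /ix /pick_idx; case: pickP => [i /asboolP h|no]; first by exists i.
  by have [i h] := re_cover u v uv; have := no i; rewrite asboolT.
have ixO u v u' v' : cadj u v -> cadj u' v' -> ix u v = ix u' v' -> eorbit (u, v) (u', v').
  move=> /ixE[i -> iuv] /ixE[j -> juv] /(congr1 val) /=.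
  have := ltn_ord i; have := ltn_ord j => ? ?; rewrite !inordK; [|lia|lia].
  move=> /val_inj ij; subst j; apply: eorbit_trans juv; exact: eorbit_sym.
pose T := IndexedTree ixC ixA ixO.
have lenO u v u' v' : eorbit (u, v) (u', v') -> xlen u v = xlen u' v'.
  by move=> [g /= [[-> ->]|[-> ->]]]; rewrite xlen_act // xlenC.
(* An index without edges gets length 0, so that an index of positive length is always used. *)
have /choice[l lP] : forall e, exists r : R, 0 <= r /\
    ((forall u v, cadj u v -> ix u v = e -> xlen u v = r) /\
     (0 < r -> exists u v, cadj u v /\ ix u v = e)).
  move=> e; have [[u [v [uv uve]]]|no] := pselect (exists u v, cadj u v /\ ix u v = e).
    exists (xlen u v); split; first exact: mdist_ge0.
    split; last by exists u, v.
    by move=> u' v' uv' e'; apply/esym/lenO/ixO; rewrite ?uve.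
  by exists 0; split=> //; split; [move=> u v uv ue; case: no; exists u, v|rewrite ltxx].
have l0 e : 0 <= l e by have [] := lP e.
exists T, l, l0; split.
- split=> //; exists n, rv; split=> //; lia.
- exact: some_edge.
- move=> u v uv.
  have [_ [/(_ u v uv erefl) <- _]] := lP (ix u v).
  rewrite /xlen lt_neqAle mdist_ge0 andbT eq_sym; apply/eqP => /mdist_positivity/val_inj e.
  by move: uv; rewrite e cadjxx.
- by move=> e le; have [_ [_ /(_ le)]] := lP e.
move=> g.
have dE u v : mdist (val u) (val v) = wd (W := iweight T l0) u v.
  rewrite xdistE; apply: (@tdist_ext R G (xtree X)) => a c ac.
  by have [_ [h _]] := lP (ix a c); rewrite h.
have [u hu] := @axis_vertex G T (oc_inversion hT) g.
rewrite (@axis_realize_length R G (iweight T l0) u g hu).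
apply: (@translation_lengthE R G X g (val u)) => i.
rewrite -(@axis_iter R G (iweight T l0) u g hu) -dE; congr mdist.
by elim: i => [|i IH] //=; rewrite IH.
Qed.

Lemma hyperbolic_length g : ~ elliptic iota g -> 0 < translation_length X g.
Proof.
have [T [l [l0 [mT _ lpos _ ->]]]] := outer_space_marked.
move=> ng; have [u hu] := @axis_vertex G T (oc_inversion (mt_outer mT)) g.
rewrite (@axis_realize_length R G (iweight T l0) u g hu).
have [|x n] := @geo_first G T u (cact g u).
  by move=> gu; apply/ng/(ctree_elliptic g (mt_outer mT)); exists u.
have ux : cadj u x by rewrite cadjC (nearer_adj n).
rewrite (@wd_first R G (iweight T l0) _ _ _ n) (@wd_adj R G (iweight T l0)) //.
by rewrite ltr_pwDl ?lpos ?wd_ge0.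
Qed.

(** The factor [s] is the largest edge length; it cancels in every stretching factor. *)
Lemma outer_space_normalized : exists (T : indexed_tree G M) (l : 'I_M -> R) (l0 : forall e, 0 <= l e),
  [/\ marked_tree T, (forall e, l e <= 1), (exists e, l e = 1),
      forall e, 0 < l e -> exists u v : T, cadj u v /\ idx u v = e &
      exists2 s, 0 < s & forall g,
        translation_length X g = s * translation_length (realize (iweight T l0)) g].
Proof.
have [T [l [l0 [mT [u [v uv]] /(_ u v uv) luv used tl]]]] := outer_space_marked.
pose e1 := [arg max_(e > idx u v) l e]%O.
have e1max e : l e <= l e1 by rewrite /e1; case: arg_maxP => // i _ /(_ e isT).
have le1 : 0 < l e1 := lt_le_trans luv (e1max _).
have l0' e : 0 <= l e / l e1 by rewrite divr_ge0.
exists T, (fun e => l e / l e1), l0'; split=> //.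
- by move=> e; rewrite ler_pdivrMr // mul1r.
- by exists e1; rewrite divff // gt_eqF.
- by move=> e h; apply: used; move: h; rewrite pmulr_lgt0 // invr_gt0.
exists (l e1) => // g; rewrite tl.
have [c cE] := @realize_length_count R G M T g (oc_inversion (mt_outer mT)).
rewrite !cE /dot mulr_sumr; apply: eq_bigr => e _.
by rewrite mulrCA [l e1 * _]mulrC divfK // gt_eqF.
Qed.

End MarkedTree.

(** * Collapsing edges *)

Section CollapsedTree.
Context {R : realType} {p : nat} {Gi : 'I_p -> groupType} {G : groupType}.
Context (iota : forall i, group_hom (Gi i) G) {M : nat} (T : indexed_tree G M).
Hypothesis mT : marked_tree iota T.
Context (l : 'I_M -> R) (l0 : forall e, 0 <= l e).
Local Notation W := (iweight T l0).
Local Notation wd := (@wd R G W).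
Implicit Types (u v w x y a b : T) (g h : G).

Definition class_free v : Prop := forall u, wd v u = 0 -> ~ nonfree u.

Hypothesis stab_move : forall v g, wd v (cact g v) = 0 ->
  nonfree v \/ class_free v -> cact g v = v.

Lemma wd_class u v w : wd u v = 0 -> wd u w = wd v w.
Proof.
move=> uv; have := @wd_tri R G W v u w; have := @wd_tri R G W u v w.
rewrite (@wdC R G W v u) uv; lra.
Qed.

Lemma class_path u v : wd u v = 0 -> exists s : seq T, [/\ uniq s, size s = (nsteps u v).+1 &
  forall x, x \in s -> wd x v = 0 /\ (nsteps x v <= nsteps u v)%N].
Proof.
apply: (@tree_ind_to G T v (fun u => wd u v = 0 -> exists s : seq T, [/\ uniq s,
  size s = (nsteps u v).+1 & forall x, x \in s -> wd x v = 0 /\ (nsteps x v <= nsteps u v)%N])).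
  move=> _; exists [:: v]; split=> //; first by rewrite /nsteps geoxx.
  by move=> x; rewrite inE => /eqP ->; rewrite wdxx.
move=> a b n IH av; have := av; rewrite (@wd_first R G W _ _ _ n) => /eqP.
rewrite paddr_eq0 ?wd_ge0 // => /andP[_ /eqP /IH[s [us ss sC]]].
exists (a :: s); rewrite (nsteps_first n) /= ss us andbT; split=> //.
  by apply/negP => /sC[_]; rewrite (nsteps_first n) ltnn.
by move=> x; rewrite inE => /orP[/eqP ->|/sC[-> le]]; rewrite ?(nsteps_first n) // ?(leqW le).
Qed.

(** By [stab_move] the vertices of a path inside a free class lie in different orbits, so there are
    at most as many of them as vertex orbits. *)
Lemma class_bound v u : class_free v -> wd v u = 0 -> (nsteps v u < M)%N.
Proof.
move=> fv vu; have [s [us ss sC]] := class_path vu.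
have [n [rep [nM cover inj]]] := mt_rep mT; apply: leq_trans nM.
have /choice[orb ro] : forall x, exists i, vorbit (rep i) x by move=> x; have [i] := cover x; exists i.
rewrite -ss -(size_map orb) -[X in (_ <= X)%N](card_ord n).
suff /card_uniqP <- : uniq (map orb s) by apply: max_card.
rewrite map_inj_in_uniq // => x y /sC[xu _] /sC[yu _] oxy.
have [g gx] := ro x; have [h hy] := ro y.
have yx : y = cact (h * g^-1)%g x by rewrite hy gx oxy cactM cactVK.
have xv : wd x v = 0 by rewrite wdC (wd_class _ vu) wdC.
have xy : wd x y = 0 by rewrite (wd_class _ xu) wdC.
rewrite yx in xy *; apply/esym; apply: stab_move xy _; right=> z xz.
by apply: fv; rewrite -(wd_class _ xv).
Qed.

(** Take a longest path inside the class. At each end only the edge toward the other end can stay in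
    the class, so at least two edges of positive length leave. If the class is one vertex, its own
    three edges leave. *)
Lemma collapse_degree3 v : class_free v -> exists a1 b1 a2 b2 a3 b3 : T,
    [/\ [/\ cadj a1 b1, wd v a1 = 0 & 0 < wd a1 b1],
        [/\ cadj a2 b2, wd v a2 = 0 & 0 < wd a2 b2],
        [/\ cadj a3 b3, wd v a3 = 0 & 0 < wd a3 b3] &
        [/\ (a1, b1) <> (a2, b2), (a2, b2) <> (a3, b3) & (a1, b1) <> (a3, b3)]].
Proof.
move=> fv; pose P d := `[< exists x y, [/\ wd v x = 0, wd v y = 0 & nsteps x y = d] >].
have Pex : exists d, P d by exists 0%N; apply/asboolP; exists v, v; rewrite wdxx /nsteps geoxx.
have Pbound d : P d -> (d <= M)%N.
  move=> /asboolP[x [y [vx vy <-]]]; apply: ltnW; apply: class_bound.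
    by move=> z xz; apply: fv; rewrite (wd_class _ vx).
  by rewrite -(wd_class _ vx).
have [d /asboolP[x [y [vx vy dE]]] dmax] := ex_maxnP Pex Pbound.
have maxd x' y' : wd v x' = 0 -> wd v y' = 0 -> (nsteps x' y' <= d)%N.
  by move=> vx' vy'; apply: dmax; apply/asboolP; exists x', y'.
have out z z' a : wd v z = 0 -> wd v z' = 0 -> nsteps z z' = d -> cadj z a ->
    ~~ nearer a z z' -> 0 < wd z a.
  move=> vz vz' zz' za na; rewrite lt_neqAle wd_ge0 andbT eq_sym; apply/eqP => az.
  have n : nearer z a z' by rewrite nearerP // cadjC.
  have va : wd v a = 0 by rewrite wdC -(wd_class _ az) wdC.
  by have := maxd a z' va vz'; rewrite (nsteps_first n) zz' ltnn.
have uniq_near z z' a a' : nearer a z z' -> nearer a' z z' -> a = a'.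
  by move=> /nearer_cons e /nearer_cons; rewrite e => -[].
have free z : wd v z = 0 -> ~ nonfree z by move=> vz; apply: fv.
have two z z' : wd v z = 0 -> wd v z' = 0 -> nsteps z z' = d -> exists a a',
    [/\ [/\ cadj z a & 0 < wd z a], [/\ cadj z a' & 0 < wd z a'] & a <> a'].
  move=> vz vz' zz'; have [a [b [c [[za zb zc] ab bc ac]]]] := mt_degree3 mT (free z vz).
  have [na|na] := boolP (nearer a z z'); last first.
    have [nb|nb] := boolP (nearer b z z'); last by exists a, b; split=> //; split=> //; apply: out zz' _ _.
    exists a, c; split=> //; split=> //; apply: out zz' _ _ => //.
    by apply/negP => nc; apply: bc; apply: uniq_near nb nc.
  exists b, c; split=> //; split=> //; apply: out zz' _ _ => //; apply/negP => n.
    by apply: ab; apply: uniq_near na n.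
  by apply: ac; apply: uniq_near na n.
have [xy|xy] := pselect (x = y).
  have [a [b [c [[xa xb xc] ab bc ac]]]] := mt_degree3 mT (free x vx).
  have xxd : nsteps x x = d by rewrite [in X in nsteps _ X]xy.
  have nx z : cadj x z -> 0 < wd x z.
    move=> xz; apply: (out x x) => //; rewrite -nearerP // ?nearer_refl // cadjC //.
  exists x, a, x, b, x, c; split; [by split=> //; apply: nx..|].
  by split=> -[].
have [a [a' [[xa pa] [xa' pa'] aa']]] := two x y vx vy dE.
have [|c [_ [[yc pc] _ _]]] := two y x vy vx; first by rewrite nstepsC.
exists x, a, x, a', y, c; split=> //; split; [by case|by case|by case].
Qed.

Hypothesis factors_nontrivial : forall i, exists c, iota i c <> 1%g.

Lemma collapse_outer : outer_space iota (realize W).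
Proof.
apply: realize_outer => //.
- exact: mt_outer mT.
- by move=> w a b ab _; apply: (mt_hull mT).
- by move=> v fv; right; apply: collapse_degree3.
Qed.

End CollapsedTree.

(** * The uncollapsed tree with unit lengths *)

Section UnitLength.
Context {R : realType} {p : nat} {Gi : 'I_p -> groupType} {G : groupType}.
Context (iota : forall i, group_hom (Gi i) G) {M : nat} (T : indexed_tree G M).

Fact unit_ge0 (e : 'I_M) : 0 <= (1 : R). Proof. by []. Qed.

(** Irreducibility speaks of points of the outer space. With unit lengths nothing is collapsed, and
    membership follows from the marking alone. *)
Definition unit_tree : wtree R G := iweight T unit_ge0.

Lemma unit_tree_eq (u v : T) : wd (W := unit_tree) u v = 0 -> u = v.
Proof.
have [//|/eqP uv] := eqVneq u v.
have [x n] := geo_first uv; rewrite (@wd_first R G unit_tree _ _ _ n) => /eqP.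
rewrite paddr_eq0 ?wd_ge0 // => /andP[/eqP + _].
rewrite (@wd_adj R G unit_tree) 1?cadjC ?(nearer_adj n) //= => /eqP.
by rewrite oner_eq0.
Qed.

Lemma unit_tree_outer : marked_tree iota T -> (forall i, exists c, iota i c <> 1%g) ->
  outer_space iota (realize unit_tree).
Proof.
move=> mT; apply: (collapse_outer mT) => v g /unit_tree_eq gv _.
by rewrite -gv.
Qed.

End UnitLength.

(** * Linear extension of vertex maps *)

Section LinearExtension.
Context {R : realType} {p : nat} {Gi : 'I_p -> groupType} {G : groupType}.
Context {iota : forall i, group_hom (Gi i) G} {M : nat} {T : indexed_tree G M}.
Hypothesis mT : marked_tree iota T.
Context (Phi : group_hom G G) (bij_Phi : bijective Phi).
Context (f : T -> T) (f_act : forall g v, f (cact g v) = cact (Phi g) (f v)).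
Hypothesis neighbor : forall u : T, exists v : T, cadj u v.
Local Notation U := (@unit_tree R G M T).
Local Notation wd := (@wd R G U).
Local Notation rp := (@rp R G U).
Local Notation rv := (@rv R G U).
Implicit Types (u v w a b c d : T) (g h : G) (z q : rpt U).

Lemma unit_adj u v : cadj u v -> wd u v = 1.
Proof. by move=> uv; rewrite (@wd_adj R G U). Qed.

(** The graph of the extension, as a relation. It is single-valued because an interior point
    determines its edge up to orientation, and because at a vertex every edge gives the value of
    [f]. *)
Definition extends_to z q : Prop := exists u v (t : R), [/\ cadj u v, 0 <= t, t <= 1, z = rp u v t &
  q = rp (f u) (f v) (t * wd (f u) (f v))].

Lemma extends_vertex u q : extends_to (rv u) q -> q = rv (f u).
Proof.
move=> [a [b [t [ab t0 t1 e ->]]]]; have l1 := unit_adj ab.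
have [|tE|tE] := @redge_vertex R G U a b u t ab t0 _ (esym e); first by rewrite l1.
  move: e; rewrite tE mul0r !rp0 => /rv_eq/unit_tree_eq ->.
  by [].
by move: e; rewrite tE rp1 l1 mul1r rp1 => /rv_eq/unit_tree_eq ->.
Qed.

Lemma extends_fun z q q' : extends_to z q -> extends_to z q' -> q = q'.
Proof.
move=> ext ext'; have [u [v [t [uv t0 t1 zE qE]]]] := ext; have l1 := unit_adj uv.
have [tz|tn0] := eqVneq t 0.
  have zu : z = rv u by rewrite zE tz rp0.
  by rewrite zu in ext ext'; rewrite (extends_vertex ext) (extends_vertex ext').
have [tz|tn1] := eqVneq t 1.
  have zv : z = rv v by rewrite zE tz -l1 rp1.
  by rewrite zv in ext ext'; rewrite (extends_vertex ext) (extends_vertex ext').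
have [u' [v' [t' [uv' t0' t1' zE' qE']]]] := ext'; have l1' := unit_adj uv'.
have tp : 0 < t by rewrite lt_neqAle eq_sym tn0.
have tl : t < wd u v by rewrite l1 lt_neqAle tn1.
have tw : t <= wd u v := ltW tl.
have tw' : t' <= wd u' v' by rewrite l1'.
have [[uu vv]|[uv1 vu1]] := @redge_interior R G U _ _ _ _ _ _ uv uv' tp tl t0' tw' (etrans (esym zE) zE').
  subst u' v'; have tt : t = t'.
    by rewrite -(mdist_rvl t0 tw) -zE zE' mdist_rvl.
  by rewrite qE qE' tt.
subst u' v'; have tt : t' = 1 - t.
  by rewrite -(mdist_rvl t0' tw') -zE' zE mdist_rvr // l1.
have d0 := @wd_ge0 R G U (f u) (f v); rewrite qE qE' tt (@wdC R G U (f v)) mulrBl mul1r.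
by rewrite rp_flip ?mulr_ge0 // ler_piMl.
Qed.

Lemma on_some_edge z : exists u v (t : R), [/\ cadj u v, 0 <= t, t <= 1 & z = rp u v t].
Proof.
have [[u _ <-]|[e [a [b [ab _ ->]]] /redgeP[t /andP[t0 t1] zE]]] := redge_cover z.
  by have [v uv] := neighbor u; exists u, v, 0; rewrite rp0.
by exists a, b, t; rewrite -(unit_adj ab).
Qed.

Lemma extends_total z : exists q, extends_to z q.
Proof.
have [u [v [t [uv t0 t1 zE]]]] := on_some_edge z.
by exists (rp (f u) (f v) (t * wd (f u) (f v))), u, v, t.
Qed.

Lemma edge_stretch : exists2 K : R, 0 <= K & forall u v, cadj u v -> wd (f u) (f v) <= K.
Proof.
have /choice[k kP] : forall e : 'I_M, exists k : R, 0 <= k /\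
    forall u v, cadj u v -> idx u v = e -> wd (f u) (f v) = k.
  move=> e; have [[u [v [uv uve]]]|no] := pselect (exists u v, cadj u v /\ idx u v = e).
    exists (wd (f u) (f v)); split=> [|a b ab abe]; first exact: wd_ge0.
    have [g [/= [-> ->]|/= [-> ->]]] := idx_orbit uv ab (etrans uve (esym abe)).
      by rewrite !f_act wd_act.
    by rewrite !f_act wd_act wdC.
  by exists 0; split=> // u v uv uve; case: no; exists u, v.
have k0 e : 0 <= k e by have [] := kP e.
exists (\sum_e k e); first exact: sumr_ge0.
move=> u v uv; have [_ ->] := kP (idx u v) => //.
by rewrite (bigD1 (idx u v)) //= lerDl sumr_ge0.
Qed.

Lemma crossing_edge a b u v : cadj a b -> separates a b (f u) (f v) ->
  exists c d, cadj c d /\ separates a b (f c) (f d).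
Proof.
move=> ab; apply: (@tree_ind_to G T v (fun u => separates a b (f u) (f v) ->
  exists c d, cadj c d /\ separates a b (f c) (f d))).
  by move=> /andP[n]; rewrite nearerP 1?cadjC // n.
move=> x y n IH /(@separates_cat G T a b _ (f y) _ ab)/orP[s|/IH //].
by exists x, y; rewrite cadjC (nearer_adj n).
Qed.

Lemma linear_extension : exists F : realize U -> realize U,
  [/\ represents Phi F, forall u, F (rv u) = rv (f u) &
      forall u v (t : R), cadj u v -> 0 <= t -> t <= 1 ->
        F (rp u v t) = rp (f u) (f v) (t * wd (f u) (f v))].
Proof.
have /choice[F FP] := extends_total.
have FE u v (t : R) : cadj u v -> 0 <= t -> t <= 1 ->
    F (rp u v t) = rp (f u) (f v) (t * wd (f u) (f v)).
  by move=> uv t0 t1; apply: extends_fun (FP _) _; exists u, v, t.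
have seg_le u v t : t <= 1 -> t * wd (f u) (f v) <= wd (f u) (f v).
  by move=> t1; rewrite ler_piMl // wd_ge0.
exists F; split=> //; last by move=> u; apply: extends_vertex; apply: FP.
split.
- have [K K0 KP] := edge_stretch; exists K => x y.
  have edge_le e (q q' : rpt U) : redges e -> e q -> e q' -> mdist (F q) (F q') <= K * mdist q q'.
    move=> [u [v [uv _ ->]]] /redgeP[s /andP[s0 s1] ->] /redgeP[t /andP[t0 t1] ->].
    rewrite mdist_same //; move: s1 t1; rewrite unit_adj // => s1 t1.
    have d0 := @wd_ge0 R G U (f u) (f v).
    rewrite !FE // mdist_same ?mulr_ge0 ?seg_le // -mulrBl normrM (ger0_norm d0) mulrC.
    by rewrite ler_wpM2r ?normr_ge0 // KP.
  have [s [cs <- <-]] := @rpt_chain R G U x y.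
  elim: s x cs => [|z s IH] x /=; first by rewrite /chain_length /= big_nil mdistxx mulr0.
  move=> /andP[/asboolP[e ee [ex ez]] cs]; rewrite /chain_length /= big_cons mulrDr.
  apply: le_trans (metric_triangle _ (F z) _) _; apply: lerD; first exact: edge_le ee ex ez.
  exact: IH.
(* Surjectivity: as [Phi] is onto, all translates of [f (cbase T)] are values of [f]. The edge of
   [z] separates two of them, hence also the values at the ends of some edge, whose image then runs
   over it. *)
- move=> z; have [a [b [t [ab t0 t1 ->]]]] := on_some_edge z.
  have [g [h s]] := mt_hull mT (f (cbase T)) ab.
  have [Psi _ PhiK] := bij_Phi.
  rewrite -(PhiK g) -(PhiK h) -!f_act in s.
  have [c [d [cd scd]]] := crossing_edge ab s; have /andP[n1 n2] := scd.
  have l1 := unit_adj ab; have DE := @wd_sep R G U _ _ _ _ scd; rewrite l1 in DE.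
  have ca := @wd_ge0 R G U (f c) a; have bd := @wd_ge0 R G U b (f d).
  set D := wd (f c) (f d) in DE.
  have D0 : 0 < D by rewrite DE; lra.
  exists (rp c d ((wd (f c) a + t) / D)).
  rewrite FE //; last 2 first.
  - by rewrite divr_ge0 ?(ltW D0) // addr_ge0.
  - by rewrite ler_pdivrMr // mul1r DE; lra.
  rewrite -/D divfK ?gt_eqF //; apply/esym; apply: rp_unique.
  - by rewrite addr_ge0.
  - by rewrite -/D DE; lra.
  - by rewrite (@mdist_near_side R G U _ _ _ _ n1) ?l1.
  rewrite -rp_flip ?l1 // (@mdist_near_side R G U _ _ _ _ n2) ?(@wdC R G U b a) ?l1 ?subr_ge0 //; last by lra.
  by rewrite -/D DE (@wdC R G U _ b); lra.
- move=> g z; apply: extends_fun (FP _) _.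
  have [u [v [t [uv t0 t1 -> ->]]]] := FP z.
  exists (cact g u), (cact g v), t; rewrite /= cadj_act !f_act wd_act !ract_rp ?seg_le ?mulr_ge0 ?wd_ge0 ?(unit_adj uv) //.
Qed.

End LinearExtension.

Section EquivariantChoice.
Context {G : groupType} {A B : Type} (aA : G -> A -> A) (aB : G -> B -> B).
Hypothesis aA1 : forall x, aA 1%g x = x.
Hypothesis aAM : forall g h x, aA (g * h)%g x = aA g (aA h x).
Hypothesis aBM : forall g h x, aB (g * h)%g x = aB g (aB h x).

(** A value is chosen at one point of each orbit and transported by [G]; this is consistent because
    the stabilizer of that point fixes the value. *)
Lemma equivariant_choice (P : A -> B -> Prop) :
  (forall g x y, P x y -> P (aA g x) (aB g y)) ->
  (forall x, exists y, P x y /\ forall g, aA g x = x -> aB g y = y) ->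
  exists F : A -> B, forall x, P x (F x) /\ forall g, F (aA g x) = aB g (F x).
Proof.
move=> Pact /choice[y yP].
pose orb x : set A := [set aA g x | g in [set: G]].
have orb_act g x : orb (aA g x) = orb x.
  apply/seteqP; split=> _ [h _ <-]; first by exists (h * g)%g; rewrite ?aAM.
  by exists (h * g^-1)%g; rewrite // -aAM mulgVK.
have /choice[rep repP] : forall S : set A, exists r : option A,
    (exists x, S x) -> exists2 x, r = Some x & S x.
  move=> S; have [[x Sx]|no] := pselect (exists x, S x); last by exists None.
  by exists (Some x) => _; exists x.
have /choice[c cP] : forall x, exists c : A * G, rep (orb x) = Some c.1 /\ aA c.2 c.1 = x.
  move=> x; have [|r re [g _ gx]] := repP (orb x); first by exists x, 1%g.
  exists (r, g^-1%g); split=> //=.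
  by rewrite -gx -aAM mulVg aA1.
exists (fun x => aB (c x).2 (y (c x).1)) => x; split.
  by have [_ {1}<-] := cP x; apply: Pact; have [] := yP (c x).1.
move=> g; have [r1 e1] := cP x; have [] := cP (aA g x).
rewrite orb_act r1 => -[<-] e2.
have [_ /(_ ((g * (c x).2)^-1 * (c (aA g x)).2)%g) fix_y] := yP (c x).1.
rewrite -[in RHS]fix_y; first by rewrite -aBM -aBM mulVKg.
by rewrite aAM e2 -[in aA g x]e1 -(aAM g) -aAM mulVg aA1.
Qed.

End EquivariantChoice.

(** * From an equivariant map into the collapsed tree to a vertex map *)

Section Reduction.
Context {R : realType} {p : nat} {Gi : 'I_p -> groupType} {G : groupType}.
Context {iota : forall i, group_hom (Gi i) G} {M : nat} {T : indexed_tree G M}.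
Hypothesis mT : marked_tree iota T.
Context (Phi : group_hom G G) (aut : Aut_O iota Phi).
Context (l : 'I_M -> R) (l0 : forall e, 0 <= l e).
Local Notation W := (iweight T l0).
Local Notation rv := (@rv R G W).
Implicit Types (u v w a b c d : T) (g h k : G) (z q : rpt W).

Let hT : outer_ctree iota T := mt_outer mT.

Lemma Phi_nontrivial g : g <> 1%g -> Phi g <> 1%g.
Proof. by have /bij_inj inj := aut.1; move=> g1 e; apply/g1/inj; rewrite e gmulf1. Qed.

Lemma Phi_stab u : nonfree u -> exists v, tstab v = Phi @` tstab u.
Proof.
move=> nu; have [i fi] : exists i, factor_conj iota i (tstab u).
  by apply: contrapT => no; apply: (oc_free hT (v := u)) nu => i fi; apply: no; exists i.
have [j fj] := Aut_factor_conj aut fi.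
exact: factor_conj_stab hT fj.
Qed.

(** [Phi] carries the stabilizer of [u] onto that of some vertex [v]. By [fixed_unique] the image of
    [v] is the only point fixed by a nontrivial element of it. *)
Lemma rspace_fixes_stabilizers : fixes_stabilizers T (rspace W Phi).
Proof.
move=> u g z g1 ug zg h uh.
have [v vE] : exists v, tstab v = Phi @` tstab u by apply: Phi_stab; exists g.
have fv k : tstab u k -> ract (Phi k) (rv v) = rv v.
  by move=> uk; rewrite ract_rv; congr rv; rewrite -[_ = v]/(tstab v (Phi k)) vE; exists k.
suff -> : z = rv v by apply: fv.
apply: (fixed_unique (W := W) hT (Phi_nontrivial g1)); last exact: fv.
by apply: mdist_eq; rewrite metric_sym.
Qed.

Context (f : T -> rpt W) (f_act : forall g v, f (cact g v) = ract (Phi g) (f v)).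
Hypothesis f_zero : forall u v, cadj u v -> l (idx u v) = 0 -> f u = f v.

(** Points with nontrivial stabilizer are vertices already; the others may go to any vertex. From
    here on only equalities between values of [f] matter, so Lipschitz bounds may be lost. *)
Lemma push_to_vertices : exists pi : rpt W -> rpt W,
  (forall z, exists w, pi z = rv w) /\ forall g z, pi (ract g z) = ract g (pi z).
Proof.
have [||pi piP] := @equivariant_choice G (rpt W) (rpt W) (@ract R G W) (@ract R G W)
    (@ract1 R G W) (@ractM R G W) (@ractM R G W) (fun _ q => exists w, q = rv w).
- by move=> g _ _ [w ->]; exists (cact g w); rewrite ract_rv.
- move=> z; have [[g [g1 gz]]|free] := pselect (exists g, g <> 1%g /\ ract g z = z).
    by exists z; split=> //; apply: (fixed_vertex (W := W) hT g1 gz).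
  exists (rv (cbase T)); split=> [|g gz]; first by exists (cbase T).
  have -> : g = 1%g by apply: contrapT => g1; apply: free; exists g.
  exact: ract1.
- by exists pi; split=> [z|g z]; have [] := piP z.
Qed.

(** A vertex of the collapsed tree may have several lifts to [T]. At a nonfree vertex the lift must
    be fixed by the image of the stabilizer, and [Phi_stab] provides it; elsewhere any lift will
    do. *)
Lemma equivariant_vertex_map : exists f' : T -> T,
  (forall g v, f' (cact g v) = cact (Phi g) (f' v)) /\
  forall u v, cadj u v -> l (idx u v) = 0 -> wd (W := W) (f' u) (f' v) = 0.
Proof.
have [pi [piV pi_act]] := push_to_vertices.
have [|||f' f'P] := @equivariant_choice G T T (@cact G T) (fun g => @cact G T (Phi g))
    (@cact1 G T) (@cactM G T) _ (fun v w => rv w = pi (f v)).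
- by move=> g h x; rewrite gmulfM cactM.
- by move=> g v w e; rewrite f_act pi_act -e ract_rv.
- move=> v; have [nv|fv] := pselect (nonfree v); last first.
    have [w wE] := piV (f v); exists w; split=> // g gv.
    have -> : g = 1%g by apply: contrapT => g1; apply: fv; exists g.
    by rewrite gmulf1 cact1.
  have [w wE] := Phi_stab nv; exists w.
  have fw g : tstab v g -> cact (Phi g) w = w.
    by move=> vg; rewrite -[_ = w]/(tstab w (Phi g)) wE; exists g.
  split; last exact: fw.
  have [g vg g1] := nv; apply: (fixed_unique (W := W) hT (Phi_nontrivial g1)).
    by rewrite ract_rv fw.
  by rewrite -pi_act -f_act (_ : cact g v = v).
exists f'; split=> [g v|u v uv uv0]; first by have [_ ->] := f'P v.
apply/rv_eq; have [-> _] := f'P u; have [-> _] := f'P v.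
by rewrite (f_zero uv uv0).
Qed.

End Reduction.

Lemma separates_zero (R : realType) (G : groupType) (W : wtree R G) (a b u v : W) :
  separates a b u v -> wd u v = 0 -> wd a b = 0.
Proof.
move=> /wd_sep -> e; have := wd_ge0 u a; have := wd_ge0 b v; have := wd_ge0 a b; lra.
Qed.

Lemma nsteps_path (G : groupType) (T : ctree G) (x : nat -> T) n :
  (forall i, (i < n)%N -> cadj (x i) (x i.+1)) ->
  forall i j, (i <= j)%N -> (j <= n)%N -> (nsteps (x i) (x j) <= j - i)%N.
Proof.
move=> xadj i; elim=> [|j IH] ij jn; first by rewrite (_ : i = 0%N) ?/nsteps ?geoxx //; lia.
have [e|lt] := eqVneq i j.+1; first by rewrite e /nsteps geoxx.
have := nsteps_tri (x j) (x i) (x j.+1); rewrite (nsteps_adj (xadj j jn)).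
by have := IH _ (ltnW jn); lia.
Qed.

(** * The subgraph of collapsed edges *)

Section ZeroSubgraph.
Context {R : realType} {p : nat} {Gi : 'I_p -> groupType} {G : groupType}.
Context {iota : forall i, group_hom (Gi i) G} {M : nat} {T : indexed_tree G M}.
Hypothesis mT : marked_tree iota T.
Context (l : 'I_M -> R) (l0 : forall e, 0 <= l e).
Local Notation W := (iweight T l0).
Local Notation D := (@wd R G W).
Local Notation U := (@unit_tree R G M T).
Local Notation rp := (@rp R G U).
Local Notation rv := (@rv R G U).
Implicit Types (u v w a b c d : T) (g h k : G) (z q : rpt U).

Let hT : outer_ctree iota T := mt_outer mT.

(** All vertices belong to it, so that its invariance under a map that preserves vertices only has
    to be checked on collapsed edges. *)
Definition zero_subgraph : set (realize U) := [set z | (exists u, z = rv u) \/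
  exists a b, [/\ cadj a b, D a b = 0 & @redge R G U a b z]].

Lemma zero_edge a b : cadj a b -> D a b = 0 -> @redge R G U a b `<=` zero_subgraph.
Proof. by move=> ab ab0 z abz; right; exists a, b. Qed.

Lemma rvU_inj u v : rv u = rv v -> u = v.
Proof. by move=> /rv_eq/unit_tree_eq. Qed.

Lemma zero_subgraph_is_subgraph : is_subgraph zero_subgraph.
Proof.
move=> z [[u ->]|[a [b [ab ab0 abz]]]]; first by left; exists u.
right; exists (@redge R G U a b); first by exists a, b; rewrite unit_adj.
by split=> //; apply: zero_edge.
Qed.

Lemma zero_subgraph_invariant : ginvariant zero_subgraph.
Proof.
move=> g z [[u ->]|[a [b [ab ab0 abz]]]]; first by left; exists (cact g u); rewrite /= ract_rv.
right; exists (cact g a), (cact g b); rewrite cadj_act (@wd_act R G W); split=> //.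
by rewrite -(@ract_redge R G U); exists z.
Qed.

Lemma zero_subgraph_proper : (exists a b, cadj a b /\ 0 < D a b) -> zero_subgraph <> setT.
Proof.
move=> [a [b [ab l1]]] e; have u1 : wd (W := U) a b = 1 by apply: unit_adj.
have [h0 h1] : 0 < (2^-1 : R) /\ 2^-1 < wd (W := U) a b by rewrite u1; split; lra.
have : zero_subgraph (rp a b 2^-1) by rewrite e.
case=> [[u zu]|[c [d [cd cd0]]]].
  by have [|] := @redge_vertex R G U a b u _ ab (ltW h0) (ltW h1) zu; lra.
move=> /redgeP[t /andP[t0 t1] ze].
have [[ca db]|[cb da]] := @redge_interior R G U _ _ _ _ _ _ ab cd h0 h1 t0 t1 ze.
  by move: cd0; rewrite ca db; lra.
by move: cd0; rewrite cb da (@wdC R G W); lra.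
Qed.

Lemma extension_preserves_zero (f : T -> T) (F : realize U -> realize U) :
  (forall u v, cadj u v -> l (idx u v) = 0 -> D (f u) (f v) = 0) ->
  (forall u, F (rv u) = rv (f u)) ->
  (forall u v (t : R), cadj u v -> 0 <= t -> t <= 1 ->
     F (rp u v t) = rp (f u) (f v) (t * wd (W := U) (f u) (f v))) ->
  F @` zero_subgraph `<=` zero_subgraph.
Proof.
move=> f0 Fv Fe _ [z [[u ->]|[a [b [ab ab0 /redgeP[t /andP[t0 t1] ->]]]]] <-].
  by left; exists (f u).
rewrite unit_adj // in t1; rewrite Fe //.
have fab : D (f a) (f b) = 0 by apply: f0 => //; rewrite -ab0 (@wd_adj R G W).
have d0 := @wd_ge0 R G U (f a) (f b).
have [||[w ->]|[c [d [s [scd s0 s1 ->]]]]] := @rp_cover R G U (f a) (f b) (t * wd (W := U) (f a) (f b)).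
- by rewrite mulr_ge0.
- by rewrite ler_piMl.
- by left; exists w.
have /andP[n _] := scd; apply: (zero_edge (nearer_adj n)).
  exact: (@separates_zero R G W c d (f a) (f b)).
by apply/redgeP; exists s; rewrite ?ltW.
Qed.

Local Notation Q := (quotient_graph zero_subgraph).
Definition qedge u v : medge Q := gorbit2 (T := realize U) (rv u, rv v).

Lemma qedge_edges u v : cadj u v -> D u v = 0 -> medges (qedge u v).
Proof.
move=> uv uv0; exists (rv u, rv v) => //.
by apply: (@redge_oriented R G U) => //; [rewrite unit_adj|apply: zero_edge].
Qed.

Lemma org_qedge u v : org (qedge u v) = gorbit (T := realize U) (rv u).
Proof.
apply/seteqP; split=> [_ [_ [g _ <-] <-]|_ [g _ <-]]; first by exists g.
by exists (@act R G (realize U) g (rv u), @act R G (realize U) g (rv v)) => //; exists g.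
Qed.

Lemma bar_qedge u v : bar (qedge u v) = qedge v u.
Proof.
apply/seteqP; split=> [_ [_ [g _ <-] <-]|_ [g _ <-]]; first by exists g.
by exists (@act R G (realize U) g (rv u), @act R G (realize U) g (rv v)) => //; exists g.
Qed.

Lemma ter_qedge u v : ter (qedge u v) = gorbit (T := realize U) (rv v).
Proof.
apply/seteqP; split=> [_ [_ [g _ <-] <-]|_ [g _ <-]]; first by exists g.
by exists (@act R G (realize U) g (rv u), @act R G (realize U) g (rv v)) => //; exists g.
Qed.

Lemma qedge_inj u v u' v' : qedge u v = qedge u' v' ->
  exists g, u' = cact g u /\ v' = cact g v.
Proof.
move=> e; have : qedge u v (rv u', rv v') by rewrite e; exists 1%g => //=; rewrite !ract1.
by move=> [g _ [/= e1 e2]]; exists g; rewrite !ract_rv in e1 e2; split; apply/esym/rvU_inj.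
Qed.

Lemma zero_joined u v : D u v = 0 ->
  joined (Q := Q) (gorbit (T := realize U) (rv u)) (gorbit (T := realize U) (rv v)).
Proof.
apply: (@tree_ind_to G T v (fun u => D u v = 0 -> joined (Q := Q)
  (gorbit (T := realize U) (rv u)) (gorbit (T := realize U) (rv v)))) => [_|x y n IH xv].
  exact: joined_refl.
have xy : cadj x y by rewrite cadjC (nearer_adj n).
have xy0 : D x y = 0 := @separates_zero R G W x y x v (next_edge_separates n) xv.
rewrite -(org_qedge x y); apply: joined_step; first exact: qedge_edges.
by rewrite ter_qedge; apply: IH; move: xv; rewrite (@wd_first R G W _ _ _ n) xy0 add0r.
Qed.

Lemma nonfree_rv u : nonfree u -> nonfree_vertex (T := realize U) (rv u).
Proof.
move=> [g ug g1]; split; first by exists u.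
move=> /seteqP[sub _]; apply: g1; apply: sub.
by rewrite /stabilizer /= ract_rv ug.
Qed.

Hypothesis good : quotient_union_of_trees zero_subgraph.

Lemma nonfree_same_orbit u v : nonfree u -> nonfree v -> D u v = 0 ->
  exists g, v = cact g u.
Proof.
move=> nu nv uv; have [_ sep] := good.
have e : gorbit (T := realize U) (rv u) = gorbit (T := realize U) (rv v).
  apply: sep; [by left; exists u|by left; exists v|exact: nonfree_rv..|exact: zero_joined].
have : gorbit (T := realize U) (rv u) (rv v) by rewrite e; exists 1%g => //=; rewrite ract1.
by move=> [g _ /=]; rewrite ract_rv => /rvU_inj <-; exists g.
Qed.

(* A path of collapsed edges from [x 0] to a translate [x n] without
   backtracking projects to a closed path of the quotient, and it does not
   backtrack there either if its interior vertices are free. *)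
Lemma no_zero_loop n (x : nat -> T) g : (0 < n)%N ->
  (forall i, (i < n)%N -> cadj (x i) (x i.+1) /\ D (x i) (x i.+1) = 0) ->
  (forall i, (i.+1 < n)%N -> x i.+2 <> x i /\ ~ nonfree (x i.+1)) ->
  x n <> cact g (x 0%N).
Proof.
move=> n0 xe xint xn; have [forest _] := good.
have [||||m [c cc]] := @closed_walk_circuit Q n (fun i => qedge (x i) (x i.+1))
    (fun i => gorbit (T := realize U) (rv (x i))) n0.
- rewrite xn; apply/seteqP; split=> _ [h _ <-].
    by exists (h * g)%g => //; rewrite /= ractM ract_rv.
  by exists (h * g^-1)%g => //; rewrite /= !ract_rv cactM cactVK.
- move=> i /xe[xi xi0]; split; [exact: qedge_edges|exact: org_qedge|exact: ter_qedge].
- move=> i /xe[xi xi0]; rewrite !bar_qedge; split=> //; [exact: org_qedge|exact: ter_qedge|].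
  move=> /qedge_inj[h [e1 e2]]; exact: (oc_inversion hT xi (esym e2) (esym e1)).
- move=> i lt; rewrite bar_qedge => /qedge_inj[h [e1 e2]].
  have [nbt fr] := xint i lt; apply: nbt.
  have h1 : h = 1%g by apply: contrapT => h1; apply: fr; exists h => //; rewrite /tstab /= -e1.
  by rewrite e2 h1 cact1.
exact: forest cc.
Qed.

Lemma zero_path u v : D u v = 0 -> exists x : nat -> T, [/\ x 0%N = u, x (nsteps u v) = v,
  forall i, (i < nsteps u v)%N -> cadj (x i) (x i.+1) /\ D (x i) (x i.+1) = 0 &
  forall i, (i.+1 < nsteps u v)%N -> x i.+2 <> x i].
Proof.
move=> uv; exists (fun i => nth u (u :: geo u v) i); have /andP[pth nbt] := geo_red u v.
split=> //; first by rewrite /nsteps -last_nth last_geo.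
  move=> i lt; have adj : cadj (nth u (u :: geo u v) i) (nth u (u :: geo u v) i.+1).
    by move/(pathP u): pth; apply.
  split=> //; rewrite (@wd_adj R G W) //.
  have pos a (s : seq T) : 0 <= wlen (fun a b => l (idx a b)) a s.
    by elim: s a => [|b s IH] a; rewrite ?wlen_nil // wlen_cons addr_ge0.
  have aux a (s : seq T) j : wlen (fun a b => l (idx a b)) a s = 0 -> (j < size s)%N ->
      l (idx (nth u (a :: s) j) (nth u (a :: s) j.+1)) = 0.
    elim: s a j => [|b s IH] a j //; rewrite wlen_cons => /eqP; rewrite paddr_eq0 //.
    by move=> /andP[/eqP ab /eqP bs]; case: j => [|j] //= lt'; apply: IH.
  exact: aux uv lt.
by move=> i lt; apply/eqP; exact: (nobacktrack_nth u nbt lt).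
Qed.

(** Otherwise the path from [v] to [g v] is excluded by [no_zero_loop]. Freeness is only assumed for
    vertices closer to [v] than [g v], which suits the induction in [zero_stab_move]. *)
Lemma free_interior_fixed v g : D v (cact g v) = 0 ->
  (forall w, D v w = 0 -> w <> v -> (nsteps v w < nsteps v (cact g v))%N -> ~ nonfree w) ->
  cact g v = v.
Proof.
move=> gv free; apply: contrapT => ne.
have [x [x0 xn xe nbt]] := zero_path gv; set n := nsteps v _ in free xn xe nbt.
have n0 : (0 < n)%N by rewrite lt0n /n nsteps_eq0; apply/eqP => e; apply: ne; rewrite -e.
apply: (no_zero_loop n0 xe) (etrans xn (congr1 (cact g) (esym x0))) => i lt.
split; first exact: nbt.
have D0 j : (j <= n)%N -> D v (x j) = 0.
  elim: j => [|j IH] jn; first by rewrite x0 wdxx.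
  have := @wd_tri R G W (x j) v (x j.+1); have [_ ->] := xe j jn; rewrite IH ?(ltnW jn) // addr0.
  by have := @wd_ge0 R G W v (x j.+1) => ge le; apply/eqP; rewrite eq_le le.
have xadj j : (j < n)%N -> cadj (x j) (x j.+1) by move=> /xe[].
have le1 : (nsteps v (x i.+1) <= i.+1)%N.
  by have := @nsteps_path G T x n xadj 0%N i.+1 isT (ltnW lt); rewrite x0 subn0.
have le2 := @nsteps_path G T x n xadj i.+1 n (ltnW lt) (leqnn n).
have tri := nsteps_tri (x i.+1) v (x n); rewrite {1}xn -/n in tri.
apply: free; [exact: D0 (ltnW lt)| |lia].
by move=> /eqP; rewrite eq_sym -nsteps_eq0; lia.
Qed.

(** Induction on the distance from [v] to [g v]. A nonfree vertex inside the path is a translate of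
    [v], as each tree of the quotient has at most one nonfree vertex; being closer, it equals [v], a
    contradiction. *)
Lemma zero_stab_move v g : D v (cact g v) = 0 -> nonfree v \/ class_free l0 v ->
  cact g v = v.
Proof.
move=> gv [nv|fv]; last by apply: free_interior_fixed gv _ => w vw _ _; apply: fv.
move e : (nsteps v (cact g v)) => n; elim/ltn_ind: n g e gv => n IH g e gv.
apply: free_interior_fixed gv _ => w vw wv lt nw.
have [k wE] := nonfree_same_orbit nv nw vw.
by apply: wv; rewrite wE; apply: (IH (nsteps v w)); rewrite -?wE // -e.
Qed.

End ZeroSubgraph.

(** * The limit of a minimizing sequence *)

Section Limit.
Context {R : realType} {M : nat}.
Implicit Types (x y : 'I_M -> R) (a c : {ffun 'I_M -> nat}).

Lemma cluster_point (l : nat -> 'I_M -> R) : (forall n e, 0 <= l n e <= 1) ->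
  exists2 loo : 'I_M -> R, (forall e, 0 <= loo e) &
    forall (eta : R) n0, 0 < eta -> exists2 n, (n0 <= n)%N & forall e, `|loo e - l n e| < eta.
Proof.
move=> l01; pose v n : 'rV[R]_M := \row_e l n e.
pose A : set 'rV[R]_M := [set w | forall i, `[0, 1]%classic (w ord0 i)].
have cA : compact A by apply: (@rV_compact R M (fun=> `[0, 1]%classic)) => i; apply: segment_compact.
have [|w [Aw cw]] := cA (v @ \oo) _; first by exists 0%N => // n _ i; rewrite /= mxE in_itv /= l01.
exists (fun e => w ord0 e) => [e|eta n0 eta0].
  by have := Aw e; rewrite /= in_itv => /andP[].
have Ftail : (v @ \oo) (v @` [set n | (n0 <= n)%N]) by exists n0 => // n /= n0n; exists n.
have [_ [[n /= n0n <-] [_ B]]] := cw _ _ Ftail (nbhsx_ballx w eta eta0).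
by exists n => // e; have := B ord0 e; rewrite /ball /= mxE.
Qed.

Lemma dot_perturb c x y (eta : R) : (forall e, x e <= y e + eta) ->
  dot c x <= dot c y + (wsize c)%:R * eta.
Proof.
move=> xy; rewrite /dot /wsize natr_sum mulr_suml -big_split /=.
by apply: ler_sum => e _; rewrite -mulrDr ler_wpM2l.
Qed.

Lemma dot_le a c x : (forall e, 0 <= x e) -> (forall e, (a e <= c e)%N) -> dot a x <= dot c x.
Proof. by move=> x0 ac; apply: ler_sum => e _; rewrite ler_wpM2r // ler_nat. Qed.

Lemma wsize_le c (B : nat) : (forall e, (c e <= B)%N) -> (wsize c <= M * B)%N.
Proof.
move=> cB; rewrite /wsize -[X in (_ <= X * _)%N]card_ord -sum_nat_const.
by apply: leq_sum => e _.
Qed.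

Lemma coef_le_wsize c e : (c e <= wsize c)%N.
Proof. by rewrite /wsize (bigD1 e) //= leq_addr. Qed.

(* Only the coefficients of [a] at the indices with [0 < loo e] matter in the
   limit; they are bounded, so finitely many pairs of vectors are involved. *)
Lemma limit_inequality (l : nat -> 'I_M -> R) (K : nat) (lam : R) :
  (forall n e, 0 <= l n e <= 1) -> (forall n, exists e, l n e = 1) -> 0 <= lam ->
  exists (loo : 'I_M -> R) n, [/\ forall e, 0 <= loo e, exists e, 0 < loo e,
    forall e, 0 < loo e -> 0 < l n e &
    forall a c, (wsize c <= K)%N ->
      dot a (l n) <= (lam + n.+1%:R^-1) * dot c (l n) -> dot a loo <= lam * dot c loo].
Proof.
move=> l01 l1 lam0; have [loo loo0 clus] := cluster_point l01.
have [m m0 gap] := finite_gap loo.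
(* Where [loo e] is positive, it is at least [m] and [l n e] is at least [m / 2], so the inequality
   bounds [a e] by this quotient, independently of [n]. *)
pose B := Num.bound ((lam + 1) * K%:R / (m / 2)).
have Bbound (x : R) : x <= (lam + 1) * K%:R / (m / 2) -> x < B%:R.
  move=> /le_lt_trans; apply; apply: archi_boundP.
  by rewrite divr_ge0 ?mulr_ge0 ?addr_ge0 // ltW // divr_gt0.
pose nf J (q : {ffun 'I_M -> 'I_J}) : {ffun 'I_M -> nat} := [ffun e => q e : nat].
(* The positive values of the difference at these finitely many pairs are at least [d]. *)
have [d d0 dgap] := @finite_gap R ({ffun 'I_M -> 'I_B.+1} * {ffun 'I_M -> 'I_K.+1})%type
  (fun q => dot (nf _ q.1) loo - lam * dot (nf _ q.2) loo).
pose S : R := lam * K%:R + (M * B)%:R.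
have S0 : 0 <= S by rewrite addr_ge0 // mulr_ge0.
(* The first bound keeps [l n e] above [m / 2] where [loo e] is positive, the second makes [loo]
   nonzero because some [l n e] is 1, and the third keeps the error of replacing [l n] by [loo]
   below [d / 2]. The choice of [n0] spends the other half of [d] on the term [1 / (n + 1)]. *)
pose eta : R := Num.min (Num.min (m / 2) 2^-1) (d / 2 / (S + 1)).
have eta0 : 0 < eta by rewrite !lt_min !divr_gt0 ?invr_gt0 ?ltr0n // ltr_wpDl.
have eta_m : eta <= m / 2 by rewrite !ge_min lexx.
have eta_2 : eta <= 2^-1 by rewrite !ge_min lexx orbT.
have eta_d : eta * S < d / 2.
  have h : eta * (S + 1) <= d / 2.
    by rewrite -ler_pdivlMr ?ltr_wpDl // !ge_min lexx !orbT.
  by rewrite mulrDr mulr1 in h; lra.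
pose n0 := Num.bound (K%:R / (d / 2)).
have [n nn0 near_l] := clus eta n0 eta0.
have nK : K%:R * n.+1%:R^-1 < d / 2.
  rewrite ltr_pdivrMr ?ltr0n // mulrC -ltr_pdivrMr ?divr_gt0 //.
  apply: lt_le_trans (archi_boundP _) _; first by rewrite divr_ge0 // ltW // divr_gt0.
  by rewrite ler_nat; apply: leq_trans nn0 (leqnSn n).
have l0 e : 0 <= l n e by have /andP[] := l01 n e.
have dist_l e : loo e <= l n e + eta /\ l n e <= loo e + eta.
  by have := near_l e; rewrite ltr_norml => /andP[h1 h2]; split; lra.
have pos_l e : 0 < loo e -> m / 2 <= l n e.
  by move=> h; case: (gap e) => g; have [h1 h2] := dist_l e; lra.
exists loo, n; split=> //.
- have [e le] := l1 n; exists e; have [_ h] := dist_l e; rewrite le in h; lra.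
- by move=> e /pos_l; apply: lt_le_trans; rewrite divr_gt0.
move=> a c cK acn.
have dc1 : dot c (l n) <= K%:R.
  have := @dot_perturb c (l n) (fun=> 0) 1; rewrite mulr1 => h; apply: le_trans (h _) _.
    by move=> e; rewrite add0r; have /andP[] := l01 n e.
  by rewrite /dot big1 ?add0r ?ler_nat // => e _; rewrite mulr0.
have dc0 : 0 <= dot c (l n) by apply: dot_ge0.
have inv1 : n.+1%:R^-1 <= 1 :> R by rewrite invf_le1 ?ltr0n // ler1n.
have inv0 : 0 <= n.+1%:R^-1 :> R by rewrite invr_ge0.
(* Coefficients at collapsed indices have no bound. Dropping them leaves [dot a loo] unchanged and
   can only decrease [dot a (l n)]. *)
pose a' : {ffun 'I_M -> nat} := [ffun e => if 0 < loo e then a e else 0%N].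
have a'le e : (a' e <= a e)%N by rewrite ffunE; case: ifP.
have aoo : dot a loo = dot a' loo.
  apply: eq_bigr => e _; rewrite ffunE; case: ifPn => // np.
  have -> : loo e = 0 by apply/eqP; rewrite eq_le loo0 andbT leNgt.
  by rewrite !mulr0.
have a'B e : (a' e < B.+1)%N.
  rewrite ffunE; case: ifP => // le; rewrite ltnS; apply: ltnW.
  rewrite -(ltr_nat R); apply: Bbound; rewrite ler_pdivlMr ?divr_gt0 //.
  have h1 : (a e)%:R * (m / 2) <= (a e)%:R * l n e by rewrite ler_wpM2l ?pos_l.
  have h2 : (a e)%:R * l n e <= dot a (l n).
    by rewrite /dot (bigD1 e) //= lerDl sumr_ge0 // => f _; rewrite mulr_ge0.
  have h3 : (lam + n.+1%:R^-1) * dot c (l n) <= (lam + 1) * K%:R.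
    by rewrite ler_pM ?addr_ge0 // lerD2l.
  by apply: le_trans h1 (le_trans h2 (le_trans acn h3)).
have cB e : (c e < K.+1)%N by rewrite ltnS (leq_trans (coef_le_wsize c e)).
pose q := ([ffun e => Ordinal (a'B e)] : {ffun 'I_M -> 'I_B.+1},
           [ffun e => Ordinal (cB e)] : {ffun 'I_M -> 'I_K.+1}).
have q1 : nf _ q.1 = a' by apply/ffunP => e; rewrite !ffunE /= ffunE.
have q2 : nf _ q.2 = c by apply/ffunP => e; rewrite !ffunE.
have dq : dot a' loo - lam * dot c loo <= 0 \/ d <= dot a' loo - lam * dot c loo.
  by rewrite -q1 -q2; apply: dgap.
case: dq => h; rewrite aoo; first by rewrite -subr_le0.
exfalso; move: h; apply/negP; rewrite -ltNge.
have e1 : dot a' loo <= dot a' (l n) + (M * B)%:R * eta.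
  apply: le_trans (dot_perturb a' (fun e => (dist_l e).1)) _.
  rewrite lerD2l ler_wpM2r ?(ltW eta0) // ler_nat; apply: wsize_le => e.
  by have := a'B e; rewrite ltnS.
have e2 : dot a' (l n) <= dot a (l n) := dot_le l0 a'le.
have e3 : dot c (l n) <= dot c loo + K%:R * eta.
  apply: le_trans (dot_perturb c (fun e => (dist_l e).2)) _.
  by rewrite lerD2l ler_wpM2r ?(ltW eta0) // ler_nat.
have e4 : lam * dot c (l n) <= lam * dot c loo + lam * (K%:R * eta).
  by rewrite -mulrDr ler_wpM2l.
have e5 : n.+1%:R^-1 * dot c (l n) <= K%:R * n.+1%:R^-1.
  by rewrite mulrC ler_wpM2r.
rewrite mulrDl in acn; rewrite /S mulrDr in eta_d.
have e6 : eta * (lam * K%:R) = lam * (K%:R * eta) by rewrite mulrC mulrA.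
have e7 : eta * (M * B)%:R = (M * B)%:R * eta by rewrite mulrC.
rewrite e6 e7 in eta_d.
move: acn e1 e2 e4 e5 eta_d nK; clear.
move: (dot a' loo) (dot a' (l n)) (dot a (l n)) (lam * dot c (l n)) (lam * dot c loo) => A1 A2 A3 A4 A5.
move: (n.+1%:R^-1 * _) (K%:R * n.+1%:R^-1) (lam * _) ((M * B)%:R * eta) => A6 A7 A8 A9.
lra.
Qed.

End Limit.

(** * Stretching factors and translation lengths *)

Section Stretch.
Context {R : realType} {p k : nat} {Gi : 'I_p -> groupType} {G : groupType}.
Context {iota : forall i, group_hom (Gi i) G} {b : 'I_k -> G}.
Hypothesis hG : is_free_product iota b.
Implicit Types (X : gtree R G) (g : G).

Lemma translation_length_fixed X g : (exists x : X, act g x = x) -> translation_length X g = 0.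
Proof.
move=> [x gx]; apply: (@translation_lengthE R G X g x) => n; rewrite mulr0.
by elim: n => [|n IH]; rewrite ?mdistxx //= -[X in mdist X]gx act_isometry.
Qed.

Lemma hyperbolic_edge X g : outer_space iota X -> Hyp (R := R) iota g ->
  exists u v : xtree X, cadj u v.
Proof.
move=> hX hg; pose u := cbase (xtree X).
have [|x n] := @geo_first G (xtree X) u (cact g u).
  by move=> /(congr1 val) /= gu; apply: (hg X hX (val u)).
by exists x, u; exact: nearer_adj n.
Qed.

Lemma Hyp_length X g : outer_space iota X -> Hyp (R := R) iota g -> 0 < translation_length X g.
Proof.
move=> hX hg; apply: (hyperbolic_length hG hX (hyperbolic_edge hX hg)).
exact/(Hyp_elliptic g hX).
Qed.

Context (Phi : group_hom G G) (aut : Aut_O iota Phi).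

Lemma Lambda_le X (L : R) : outer_space iota X ->
  (forall g, translation_length X (Phi g) <= L * translation_length X g) ->
  (Lambda_R iota X (twist Phi X) <= L%:E)%E.
Proof.
move=> hX le; apply: ge_ereal_sup => _ [g hg <-]; rewrite lee_fin.
by rewrite ler_pdivrMr ?Hyp_length //; apply: le.
Qed.

(** The supremum runs over hyperbolic elements only. For an elliptic [g] both sides vanish, because
    [Phi] preserves ellipticity. *)
Lemma le_Lambda X (L : R) : outer_space iota X -> (Lambda_R iota X (twist Phi X) <= L%:E)%E ->
  forall g, translation_length X (Phi g) <= L * translation_length X g.
Proof.
move=> hX le g; have [ell|hyp] := pselect (elliptic iota g).
  rewrite !translation_length_fixed ?mulr0 //; apply/(outer_space_elliptic _ hX) => //.
  exact: Aut_elliptic.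
have hg : Hyp (R := R) iota g by apply/(Hyp_elliptic g hX).
rewrite -ler_pdivrMr ?Hyp_length // -lee_fin; apply: le_trans le.
by apply: ereal_sup_ubound; exists g.
Qed.

Lemma Lambda_ge0 X g : outer_space iota X -> Hyp (R := R) iota g ->
  (0 <= Lambda_R iota X (twist Phi X))%E.
Proof.
move=> hX hg; have h : (0 <= (translation_length (twist Phi X) g / translation_length X g)%:E)%E.
  rewrite lee_fin divr_ge0 ?(ltW (Hyp_length hX hg)) //.
  have [ell|hyp] := pselect (elliptic iota (Phi g)).
    have -> : translation_length (twist Phi X) g = 0 by apply/translation_length_fixed/(outer_space_elliptic _ hX).
    by [].
  by have/(Hyp_elliptic _ hX)/(Hyp_length hX)/ltW := hyp.
by apply: le_trans h _; apply: ereal_sup_ubound; exists g.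
Qed.

End Stretch.

(** * Attaining the infimum *)

Section Minimum.
Context {R : realType} {p k : nat} {Gi : 'I_p -> groupType} {G : groupType}.
Context {iota : forall i, group_hom (Gi i) G} {b : 'I_k -> G}.
Hypothesis hG : is_free_product iota b.
Hypothesis hGi : forall i, exists a : Gi i, a <> 1%g.
Context (Phi : group_hom G G) (aut : Aut_O iota Phi).
Hypothesis hirr : irreducible (R := R) iota Phi.

Section EquivariantLipschitz.
Context {M : nat} {T : indexed_tree G M} (mT : marked_tree iota T).
Context (l : 'I_M -> R) (l0 : forall e, 0 <= l e).
Local Notation W := (iweight T l0).
Hypothesis positive_edge : exists u v : T, cadj u v /\ 0 < l (idx u v).
Context (lam : R) (lam0 : 0 <= lam).
Context (f : T -> rpt W) (f_act : forall g v, f (cact g v) = ract (Phi g) (f v)).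
Hypothesis f_lip : forall u v : T, cadj u v -> mdist (f u) (f v) <= lam * l (idx u v).

Lemma lipschitz_length g :
  translation_length (realize W) (Phi g) <= lam * translation_length (realize W) g.
Proof.
have lip (u v : T) : mdist (f u) (f v) <= lam * wd (W := W) u v.
  apply: (@tree_ind_to G T v (fun u => mdist (f u) (f v) <= lam * wd (W := W) u v)).
    by rewrite mdistxx wdxx mulr0.
  move=> x y n IH; have xy : cadj x y by rewrite cadjC (nearer_adj n).
  rewrite (@wd_first R G W _ _ _ n) (@wd_adj R G W) // mulrDr.
  by apply: le_trans (metric_triangle _ (f y) _) _; rewrite lerD ?f_lip.
have [u hu] := @axis_vertex G T (oc_inversion (mt_outer mT)) g.
rewrite (@axis_realize_length R G W u g hu); apply: le_trans (lip _ _).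
rewrite f_act; apply: ge_inf; last by exists (f u).
by exists 0 => _ [x _ <-]; apply: mdist_ge0.
Qed.

Lemma equivariant_outer : outer_space iota (realize W).
Proof.
have fac i : exists c, iota i c <> 1%g := iota_nontrivial hG hGi i.
have f_zero (u v : T) : cadj u v -> l (idx u v) = 0 -> f u = f v.
  by move=> uv e; apply: mdist_eq; have := f_lip uv; rewrite e mulr0.
have [f' [f'_act f'_zero]] := equivariant_vertex_map mT aut f_act f_zero.
have [u0 [v0 [uv0 luv0]]] := positive_edge.
have neighbor (u : T) : exists v : T, cadj u v.
  have [->|ne] := pselect (u = u0); first by exists v0.
  by have [x n] := geo_first ne; exists x; rewrite cadjC (nearer_adj n).
have [F [rF Fv Fe]] := @linear_extension R p Gi G iota M T mT Phi aut.1 f' f'_act neighbor.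
have good : quotient_union_of_trees (zero_subgraph (T := T) l0).
  apply: (hirr (unit_tree_outer mT fac) rF).
  - exact: zero_subgraph_is_subgraph.
  - exact: zero_subgraph_invariant.
  - exact: extension_preserves_zero f'_zero Fv Fe.
  - by apply: zero_subgraph_proper; exists u0, v0; rewrite (@wd_adj R G W).
apply: (collapse_outer mT) => // v g gv cl.
exact: (zero_stab_move mT good gv cl).
Qed.

End EquivariantLipschitz.

Local Notation M := (3 * (p + k).+1).+1.

Lemma minimum_attained (lam : R) : (0 <= lam) -> (exists g, Hyp (R := R) iota g) ->
  (forall n : nat, exists2 X : gtree R G, outer_space iota X &
     (Lambda_R iota X (twist Phi X) <= (lam + n.+1%:R^-1)%:E)%E) ->
  exists2 X : gtree R G, outer_space iota X & (Lambda_R iota X (twist Phi X) <= lam%:E)%E.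
Proof.
move=> lam0 [g0 hg0] seqX.
have /choice[l lP] : forall n : nat, exists l : 'I_M -> R,
    exists (T : indexed_tree G M) (l0 : forall e, 0 <= l e),
    [/\ marked_tree iota T, (forall e, l e <= 1), (exists e, l e = 1),
      forall e, 0 < l e -> exists u v : T, cadj u v /\ idx u v = e &
      forall g, translation_length (realize (iweight T l0)) (Phi g) <=
        (lam + n.+1%:R^-1) * translation_length (realize (iweight T l0)) g].
  move=> n; have [X hX LX] := seqX n.
  have [T [l [l0 [mT l1 le used [s s0 tl]]]]] :=
    outer_space_normalized hG hX (hyperbolic_edge hX hg0).
  exists l, T, l0; split=> // g; have := le_Lambda hG aut hX LX g.
  by rewrite !tl mulrCA ler_pM2l.
(* The bound on the weights is fixed before the tree is chosen: every tree of the sequence has at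
   most [M] vertex orbits, so [3 ^ M] serves for all. *)
have [||loo [n [loo0 [e0 e0pos] lpos lim]]] := @limit_inequality R M l (3 ^ M) lam _ _ lam0.
- by move=> n e; have [T [l0 [_ l1 _ _ _]]] := lP n; rewrite l0 l1.
- by move=> n; have [T [l0 [_ _ le _ _]]] := lP n.
have [T [l0 [mT _ _ used stretch]]] := lP n.
have [m [rep [mM cover inj]]] := mt_rep mT.
have inv := oc_inversion (mt_outer mT).
have [H [Hsize sound complete]] := @equivariant_maps R G M m T rep xpredT cover inj.
have [|||f [f_act f_lip]] := complete (rspace (iweight T loo0) Phi) _ (fun e => lam * loo e).
- exact: (rspace_fixes_stabilizers mT aut).
- by move=> e; rewrite mulr_ge0.
(* With lengths [l n] the identity solves the system with weights [l n], so [h] has translation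
   length at most [dot c (l n)]; [Phi] multiplies it by at most [lam + 1 / (n + 1)], and [lim]
   carries the resulting inequality over to [loo]. *)
- move=> [h c] xH /=; have [a aE] := @realize_length_count R G M T (Phi h) inv.
  apply/(moves_length loo0 (Phi h) _ inv); rewrite aE.
  have -> : dot c (fun e => lam * loo e) = lam * dot c loo.
    by rewrite /dot mulr_sumr; apply: eq_bigr => e _; rewrite mulrCA.
  apply: lim; first by apply: leq_trans (Hsize _ xH) _; rewrite leq_exp2l.
  rewrite -(aE (l n) l0); apply: le_trans (stretch h) _.
  rewrite ler_wpM2l ?addr_ge0 ?invr_ge0 //; apply/(moves_length l0 h _ inv).
  exact: (sound (l n) l0 (l n) l0 (fun e _ => lexx _) _ xH).
have lip (u v : T) : cadj u v -> mdist (f u) (f v) <= lam * loo (idx u v).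
  by move=> uv; apply: f_lip.
have pos : exists u v : T, cadj u v /\ 0 < loo (idx u v).
  by have [u [v [uv uve]]] := used e0 (lpos e0 e0pos); exists u, v; rewrite uve.
have hX := equivariant_outer mT pos f_act lip.
exists (realize (iweight T loo0)) => //.
apply: (Lambda_le hG hX) => g; exact: (lipschitz_length mT f_act lip).
Qed.

End Minimum.

Theorem theorem8p4 (R : realType) (p k : nat) (Gi : 'I_p -> groupType)
    (G : groupType) (iota : forall i, group_hom (Gi i) G)
    (b : 'I_k -> G) (hG : is_free_product iota b)
    (hGi : forall i, exists a : Gi i, a <> 1%g)
    (hZ : ~ (p = 0%N /\ k = 1%N))
    (Phi : group_hom G G)
    (hPhi : Aut_O iota Phi) (hirr : irreducible (R := R) iota Phi) :
  exists X : gtree R G, outer_space iota X /\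
    Lambda_R iota X (twist Phi X) = lambda (R := R) iota Phi.
Proof.
have lb X : outer_space iota X -> (lambda (R := R) iota Phi <= Lambda_R iota X (twist Phi X))%E.
  by move=> hX; apply: ereal_inf_lbound; exists X.
suff [X hX le] : exists2 X, outer_space iota X &
    (Lambda_R iota X (twist Phi X) <= lambda (R := R) iota Phi)%E.
  by exists X; split=> //; apply/eqP; rewrite eq_le le lb.
have [X0 hX0] : exists X : gtree R G, outer_space iota X := outer_space_nonempty R hG hGi hZ.
(* Without hyperbolic elements every stretching factor is the supremum of the empty set, minus
   infinity. *)
have [hyp|none] := pselect (exists g, Hyp (R := R) iota g); last first.
  exists X0 => //; apply: ge_ereal_sup => _ [g hg <-]; case: none; exists g; exact: hg.
have [g hg] := hyp.
have lam0 : (0 <= lambda (R := R) iota Phi)%E.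
  by apply: le_ereal_inf_tmp => _ [X hX ->]; apply: Lambda_ge0 hX hg.
(* If the infimum is plus infinity, every point attains it. *)
move e : (lambda (R := R) iota Phi) lam0 => [lam||] //; last first.
  by exists X0 => //; rewrite leey.
rewrite lee_fin => lam0; apply: (minimum_attained hG hGi hPhi hirr lam0 hyp) => n.
apply: contrapT => no; have : (lam%:E < (lam + n.+1%:R^-1)%:E)%E.
  by rewrite lte_fin ltrDl invr_gt0 ltr0n.
apply/negP; rewrite -leNgt -e; apply: le_ereal_inf_tmp => _ [X hX ->].
by apply/ltW; rewrite ltNge; apply/negP => le; apply: no; exists X.
Qed.
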